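(* Let $G$ be a homogeneous graph. Then $$\mathcal{A}=\Big\{(\alpha,\beta)\;:\;\rho_u>\tfrac12\Big(\sum_{v\preceq u}n_v-1\Big)\ \text{for all } u\in T\Big\}.$$ More specifically, for $(\alpha,\beta)\in\mathcal{A}$ and $\sigma\in Q_G$, the integral below converges and $$\int_{Q_G}e^{-\langle x,\hat\sigma^{-1}\rangle}H_G(\alpha,\beta;x)\,\mu_G(dx)=\prod_{u\in T}\pi^{\frac12\sum_{v\prec u}n_un_v}\,|\sigma_{[u]\cdot}|^{\rho_u}\,\Gamma_{n_u}\Big(\rho_u-\sum_{v\prec u}\frac{n_v}{2}\Big)=H_G(\alpha,\beta;\sigma)\prod_{u\in T}\pi^{\frac12\sum_{v\prec u}n_un_v}\,\Gamma_{n_u}\Big(\rho_u-\sum_{v\prec u}\frac{n_v}{2}\Big).$$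
   Context: **Graphs.** $G=(V,E)$ is an undirected graph with $V=\{1,\dots,r\}$; $E\subset V\times V$ is symmetric and contains all $(i,i)$; $i\sim j$ means $i\ne j$, $(i,j)\in E$. $G$ is decomposable if it is connected and has no induced cycle of length $\ge4$. $G$ is homogeneous if it is decomposable and has no induced subgraph equal to the path on four vertices. A clique is a maximal complete subset of $V$; $\mathcal{C}$ is the set of cliques. A perfect order of the cliques is an order $(C_1,\dots,C_k)$ such that, with $S_j=(C_1\cup\dots\cup C_{j-1})\cap C_j$, for each $j\ge2$ there is $i<j$ with $S_j\subset C_i$; every decomposable graph has one. The sets $S_2,\dots,S_k$ are the minimal separators; $\mathcal{S}$ is the set of distinct ones and $\nu(S)$, the number of $j$ with $S_j=S$, does not depend on the perfect order. **Cones.** $I_G$ is the real space of functions $x:E\to\mathbb{R}$ with $x_{ij}=x_{ji}$ ($G$-incomplete symmetric matrices); $Z_G$ is the space of symmetric $r\times r$ matrices $y$ with $y_{ij}=0$ for $(i,j)\notin E$. $P_G=\{y\in Z_G: y \text{ positive definite}\}$; $Q_G=\{x\in I_G: x_C \text{ positive definite for every clique } C\}$, where $x_C=(x_{ij})_{i,j\in C}$. For $x\in Q_G$ there is a unique positive definite $\hat x$ with $\hat x_{ij}=x_{ij}$ for $(i,j)\in E$ and $\hat x^{-1}\in P_G$; the map $x\mapsto \hat x^{-1}$ is a bijection $Q_G\to P_G$ with inverse $\varphi$. $\langle x,y\rangle=\sum_{(i,j)\in E}x_{ij}y_{ij}$. $dx=\prod_{i\le j,(i,j)\in E}dx_{ij}$.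 $|\cdot|$ of a matrix is its determinant, of a set its cardinality. **Measures.** For $\alpha:\mathcal{C}\to\mathbb{R}$, $\beta:\mathcal{S}\to\mathbb{R}$ and $x\in Q_G$, $H_G(\alpha,\beta;x)=\prod_{C\in\mathcal{C}}|x_C|^{\alpha(C)}\big/\prod_{S\in\mathcal{S}}|x_S|^{\nu(S)\beta(S)}$, and $\mu_G(dx)=\prod_{C\in\mathcal{C}}|x_C|^{-(|C|+1)/2}\prod_{S\in\mathcal{S}}|x_S|^{\nu(S)(|S|+1)/2}\,\mathbf 1_{Q_G}(x)\,dx$. $\mathcal{A}$ is the set of $(\alpha,\beta)$ such that $I(\alpha,\beta;y)=\int_{Q_G}e^{-\langle x,y\rangle}H_G(\alpha,\beta;x)\mu_G(dx)$ converges for all $y\in P_G$ and $y\mapsto I(\alpha,\beta;y)/H_G(\alpha,\beta;\varphi(y))$ is constant on $P_G$. $\Gamma_n(p)=\pi^{n(n-1)/4}\prod_{j=1}^n\Gamma(p-\frac{j-1}{2})$ for $p>\frac{n-1}{2}$. **Hasse tree.** Write $nb(i)=\{j: j\sim i\}$ and $i\to j$ if $\{i\}\cup nb(i)\supseteq\{j\}\cup nb(j)$, a preorder on $V$. Let $T$ be the set of equivalence classes ($i,j$ equivalent iff $i\to j$ and $j\to i$) with the induced partial order $\bar i\preceq\bar j$ iff $i\to j$. For $G$ homogeneous, the Hasse diagram of $T$ is a rooted tree whose root is the minimum of $T$. For $u\in T$, $V_u=\bigcup_{v\preceq u}v$. The map $u\mapsto V_u$ is a bijection from endpoints of $T$ (vertices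 with no children, denoted $t$) to cliques, and from non-endpoints (denoted $q$) to minimal separators; put $\alpha_t=\alpha(V_t)$, $\beta_q=\beta(V_q)$, $\nu(q)=\nu(V_q)$ (equal to the number of children of $q$ minus one). $n_u$ is the number of elements of $V$ in the class $u$, and $\rho_u=\sum_{t:\,u\preceq t}\alpha_t-\sum_{q:\,u\preceq q}\nu(q)\beta_q$. **Blocks.** For $x\in Q_G$ and $u\in T$: $x_{[u]}=(x_{ij})_{\bar i=\bar j=u}$, $x_{[u>}=(x_{ij})_{\bar i=u,\bar j\prec u}$, $x_{<u]}=x_{[u>}^t$, $x_{<u>}=(x_{ij})_{\bar i\prec u,\bar j\prec u}$, $x_{[u]\cdot}=x_{[u]}-x_{[u>}x_{<u>}^{-1}x_{<u]}$ (with $x_{[u]\cdot}=x_{[u]}$ for the root). *)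

(* Defs.v *)
From HB Require Import structures.
From mathcomp Require Import all_boot all_order all_algebra.
From mathcomp Require Import all_classical all_reals all_analysis.

Set Implicit Arguments.
Unset Strict Implicit.
Unset Printing Implicit Defensive.

Import Order.TTheory GRing.Theory Num.Theory.

Local Open Scope ring_scope.

(* A graph on 'I_r is given by its edge set E, a reflexive symmetric relation;
   both properties are hypotheses of the theorem. *)
Section Graph.
Variables (r : nat) (E : rel 'I_r).
Implicit Types (i j : 'I_r) (C S u v w : {set 'I_r}) (Cs : seq {set 'I_r}).

Definition adj i j := (i != j) && E i j.

Definition connected_graph := (0 < r)%N /\ forall i j, connect adj i j.

Definition induced_cycle (c : seq 'I_r) :=
  uniq c /\ {in c &, forall i j, adj i j = (next c i == j) || (next c j == i)}.

Definition induced_path4 (a b c d : 'I_r) :=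
  [/\ uniq [:: a; b; c; d], [&& adj a b, adj b c & adj c d]
    & ~~ [|| adj a c, adj b d | adj a d]].

Definition decomposable :=
  connected_graph /\ forall c, (4 <= size c)%N -> ~ induced_cycle c.

Definition homogeneous :=
  decomposable /\ forall a b c d, ~ induced_path4 a b c d.

Definition complete C := [forall i in C, forall j in C, E i j].

Definition cliques : {set {set 'I_r}} := [set C | maxset complete C]%SET.

(* The cliques of an order are numbered from 0, so that the separators are
   those of index 1, ..., size Cs - 1. *)
Definition sep Cs (k : nat) : {set 'I_r} :=
  ((\bigcup_(C <- take k Cs) C) :&: nth finset.set0 Cs k)%SET.

Definition perfect_order Cs :=
  [/\ uniq Cs, Cs =i cliques
    & forall k, (0 < k < size Cs)%N ->
        exists2 l, (l < k)%N & sep Cs k \subset nth finset.set0 Cs l].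

(* For a decomposable graph the separators and their multiplicities nu do not
   depend on the perfect order; the theorem holds for every perfect order Cs. *)
Definition separators Cs := [seq sep Cs k | k <- iota 1 (size Cs).-1].

Definition min_separators Cs : {set {set 'I_r}} :=
  [set S in separators Cs]%SET.

Definition nu Cs S : nat := count_mem S (separators Cs).

Definition nb i : {set 'I_r} := [set j | adj j i]%SET.

Definition arrow i j := (j |: nb j \subset i |: nb i)%SET.

(* The vertices of the Hasse tree are the equivalence classes themselves, so
   that n_u is #|u|. *)
Definition T : {set {set 'I_r}} :=
  equivalence_partition (fun i j => arrow i j && arrow j i) [set: 'I_r]%SET.

Definition tle u v := [forall i in u, forall j in v, arrow i j].
Definition tlt u v := (u != v) && tle u v.

Definition child u v :=
  [&& v \in T, tlt u v & [forall w in T, ~~ (tlt u w && tlt w v)]].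

Definition endpoint u := [forall v, ~~ child u v].

Definition anc u : {set 'I_r} := (\bigcup_(v in T | tlt v u) v)%SET.
Definition Vset u : {set 'I_r} := (\bigcup_(v in T | tle v u) v)%SET.

(* Here and below alpha and beta are defined on all sets of vertices; only the
   values of alpha on cliques and of beta on minimal separators matter. *)
Section Rho.
Variables (R : realType) (Cs : seq {set 'I_r}) (alpha beta : {set 'I_r} -> R).

Definition rho u : R :=
  \sum_(t in T | endpoint t && tle u t) alpha (Vset t)
  - \sum_(q in T | ~~ endpoint q && tle u q)
      (nu Cs (Vset q))%:R * beta (Vset q).

End Rho.

End Graph.

(* Lebesgue measure on R^n, as the n-fold product of lebesgue_measure. *)
Section LebesgueTuple.
Local Open Scope classical_set_scope.
Variable R : realType.
Local Notation mR := (measurableTypeR R).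

Definition tcons n (p : mR * n.-tuple mR) : n.+1.-tuple mR :=
  [tuple of p.1 :: p.2].

Definition tuncons n (t : n.+1.-tuple mR) : mR * n.-tuple mR :=
  (thead t, [tuple of behead t]).

Lemma tconsK n : cancel (@tcons n) (@tuncons n).
Proof. by case=> x t; congr pair; apply/val_inj. Qed.

Lemma measurable_tcons n : measurable_fun setT (@tcons n).
Proof. exact: measurable_cons. Qed.

Lemma measurable_tuncons n : measurable_fun setT (@tuncons n).
Proof.
apply/measurable_fun_pairP; split; first exact: measurable_tnth.
exact: measurable_behead.
Qed.

Section LebesgueCons.
Variables (n : nat) (m : {sigma_finite_measure set (n.-tuple mR) -> \bar R}).

Definition lebesgue_cons : set (n.+1.-tuple mR) -> \bar R :=
  pushforward (lebesgue_measure \x m)%E (@tcons n).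

HB.instance Definition _ := Measure.copy lebesgue_cons
  (measure_function_pushforward__canonical__measure_function_Measure
     (lebesgue_measure \x m)%E (@measurable_tcons n)).

Let lebesgue_cons_sigma_finite : sigma_finite setT lebesgue_cons.
Proof.
have /sigma_finiteP[F [TF ndF Foo]] := sigma_finiteT (@lebesgue_measure R).
have /sigma_finiteP[G [TG ndG Goo]] := sigma_finiteT m.
exists (fun k => @tuncons n @^-1` (F k `*` G k)).
  apply/esym; rewrite -subTset => t _.
  have [k _ Fk] : (\bigcup_k F k) (tuncons t).1 by rewrite -TF.
  have [l _ Gl] : (\bigcup_k G k) (tuncons t).2 by rewrite -TG.
  exists (maxn k l) => //; split.
    by move: Fk; exact/subsetPset/ndF/leq_maxl.
  by move: Gl; exact/subsetPset/ndG/leq_maxr.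
move=> k; have [mF Fk] := Foo k; have [mG Gk] := Goo k; split.
  rewrite -[X in measurable X]setTI; apply: measurable_tuncons => //.
  exact: measurableX.
rewrite /lebesgue_cons /pushforward -comp_preimage (_ : _ \o _ = id); last first.
  exact/funext/tconsK.
rewrite preimage_id.
by rewrite product_measure1E// lte_mul_pinfty// ge0_fin_numE.
Qed.

HB.instance Definition _ :=
  Measure_isSigmaFinite.Build _ _ _ lebesgue_cons lebesgue_cons_sigma_finite.

End LebesgueCons.

Fixpoint lebesgue_tuple n : {sigma_finite_measure set (n.-tuple mR) -> \bar R} :=
  match n with
  | 0 => \d_[tuple]
  | n'.+1 => lebesgue_cons (lebesgue_tuple n')
  end.

Lemma lebesgue_tuple_box n (A : 'I_n -> set mR) :
  (forall i, measurable (A i)) ->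
  lebesgue_tuple n [set t | forall i, A i (tnth t i)] =
    (\prod_(i < n) lebesgue_measure (A i))%E.
Proof.
elim: n A => [|n IHn] A mA.
  by rewrite big_ord0 /= diracE mem_set//= => -[].
rewrite big_ord_recl -IHn// /lebesgue_tuple -/lebesgue_tuple /= /lebesgue_cons.
rewrite /pushforward [X in _ X = _](_ : _ = A ord0 `*`
    [set t | forall i, A (lift ord0 i) (tnth t i)]); last first.
  apply/seteqP; split=> -[x t] /=.
    move=> At; split=> [|i]; first exact: (At ord0).
    by have := At (lift ord0 i); rewrite tnthS.
  by case=> A0 At i; case: (unliftP ord0 i) => [j|] ->; rewrite ?tnthS//; exact: At.
rewrite product_measure1E//.
rewrite (_ : mkset _ =
    \bigcap_(i : 'I_n) [set t | A (lift ord0 i) (tnth t i)]); last first.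
  by apply/seteqP; split=> t At i; [move=> _|]; exact: At.
apply: fin_bigcap_measurable => // i _.
rewrite -[X in measurable X]setTI.
exact: (@measurable_tnth _ mR n i).
Qed.

End LebesgueTuple.

Section GammaFunctions.
Local Open Scope classical_set_scope.
Variable R : realType.

Definition Gamma (p : R) : R :=
  \int[@lebesgue_measure R]_(x in `]0, +oo[) (x `^ (p - 1) * expR (- x)).

Definition Gamma_multi (n : nat) (p : R) : R :=
  pi `^ ((n * n.-1)%:R / 4) * \prod_(j < n) Gamma (p - j%:R / 2).

End GammaFunctions.

Section Matrices.
Variables (R : realType) (r : nat).
Implicit Types (x : 'M[R]_r) (A B : {set 'I_r}).

Definition posdef n (x : 'M[R]_n) :=
  x^T = x /\ forall v : 'cV[R]_n, v != 0 -> 0 < (v^T *m x *m v) 0 0.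

Definition submat A B x : 'M[R]_(#|A|, #|B|) :=
  \matrix_(k < #|A|, l < #|B|) x (enum_val k) (enum_val l).

End Matrices.

Section Cones.
Local Open Scope classical_set_scope.
Variables (R : realType) (r : nat) (E : rel 'I_r).
Implicit Types (x y sigma : 'M[R]_r) (u : {set 'I_r}).

Definition ZG : set 'M[R]_r :=
  [set y | y^T = y /\ forall i j, ~~ E i j -> y i j = 0].

(* An incomplete symmetric matrix x : E -> R is encoded by its extension by 0,
   so that I_G has the same carrier as Z_G. *)
Definition IG : set 'M[R]_r := ZG.

Definition PG : set 'M[R]_r := [set y | ZG y /\ posdef y].

Definition QG : set 'M[R]_r :=
  [set x | IG x /\ forall C, C \in cliques E -> posdef (submat C C x)].

Definition completion x : set 'M[R]_r :=
  [set xhat | [/\ posdef xhat, forall i j, E i j -> xhat i j = x i j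
                & PG (invmx xhat)]].

(* completion x is a singleton for x in Q_G and a decomposable graph. *)
Definition hat x : 'M[R]_r := xget 0 (completion x).

(* The inverse of the bijection x |-> invmx (hat x) from Q_G to P_G. *)
Definition phi y : 'M[R]_r := xget 0 [set x | QG x /\ invmx (hat x) = y].

Definition pairing x y : R := \sum_(p | E p.1 p.2) x p.1 p.2 * y p.1 p.2.

Definition block u x := submat u u x.
Definition row_block u x := submat u (anc E u) x.
Definition col_block u x := (row_block u x)^T.
Definition anc_block u x := submat (anc E u) (anc E u) x.

(* When u is the root, anc E u is empty and the correction term is 0. *)
Definition schur_block u x :=
  block u x - row_block u x *m invmx (anc_block u x) *m col_block u x.

(* The coordinates (x_ij), i <= j, (i, j) \in E, of I_G. *)
Definition upper_edges : {set 'I_r * 'I_r} :=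
  [set p : 'I_r * 'I_r | (p.1 <= p.2)%N && E p.1 p.2]%SET.

Definition of_coords (t : #|upper_edges|.-tuple (measurableTypeR R)) :
    'M[R]_r :=
  \matrix_(i, j)
    if E i j then
      nth 0 t (index (if (i <= j)%N then (i, j) else (j, i)) (enum upper_edges))
    else 0.

Section Integrals.
Variables (Cs : seq {set 'I_r}).

Definition HG (alpha beta : {set 'I_r} -> R) x : R :=
  (\prod_(C in cliques E) (\det (submat C C x)) `^ alpha C)
  / \prod_(S in min_separators Cs) (\det (submat S S x)) `^ ((nu Cs S)%:R * beta S).

(* The density of mu_G with respect to dx on Q_G. *)
Definition muG_density x : R :=
  (\prod_(C in cliques E) (\det (submat C C x)) `^ (- (#|C|.+1%:R / 2)))
  * \prod_(S in min_separators Cs)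
      (\det (submat S S x)) `^ ((nu Cs S)%:R * (#|S|.+1%:R / 2)).

Definition integral_muG (f : 'M[R]_r -> R) : R :=
  \int[lebesgue_tuple R #|upper_edges|]_(t in of_coords @^-1` QG)
    (f (of_coords t) * muG_density (of_coords t)).

Definition integrable_muG (f : 'M[R]_r -> R) : Prop :=
  (lebesgue_tuple R #|upper_edges|).-integrable (of_coords @^-1` QG)
    (fun t => (f (of_coords t) * muG_density (of_coords t))%:E).

Definition integrand (alpha beta : {set 'I_r} -> R) y x : R :=
  expR (- pairing x y) * HG alpha beta x.

Definition calA : set (({set 'I_r} -> R) * ({set 'I_r} -> R)) :=
  [set ab |
    (forall y, PG y -> integrable_muG (integrand ab.1 ab.2 y)) /\
    exists c : R, forall y, PG y ->
      integral_muG (integrand ab.1 ab.2 y) / HG ab.1 ab.2 (phi y) = c].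

End Integrals.

End Cones.

(* Main.v *)
(** Order the vertices so that i precedes j whenever the closed neighbourhood of
    i contains that of j.  Then the earlier neighbours Par k of every vertex k
    form a complete set, and on Q_G the coordinates (x_kj), j in Par k, and x_kk
    can be replaced by the regression vector x_P^-1 x_Pk and the pivot
    d_k(x) = x_kk - x_kP x_P^-1 x_Pk, with P = Par k: x belongs to Q_G iff all
    pivots are positive, |x_A| is the product of the pivots over A for A a
      clique
    or a separator, and the elements of P_G are exactly the matrices
    M^T D^-1 M, where the rows of M are built from the regression vectors and D
    from the pivots of some sigma.  In these terms the integrand factors over
      the
    vertices.  Integrating out the vertices from the last to the first, x_kk
      gives
    a Gamma integral and the x_kj a Gaussian integral, whose determinant
    |x_P|^(1/2) raises by 1/2 the exponents of the pivots in P.  All integrands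
    being positive, Tonelli's theorem also shows that the integral converges
      only
    if every one-dimensional Gamma integral does. *)

(* What homogeneity adds to decomposability is that the parents of a parent of k are again parents
   of k. So the pivots of P = Par k involve nothing outside P and |x_P| is exactly their product;
   the power of |x_P| left by a Gaussian integral thus has the form of the integrand again, and the
   recursion closes. Exponents: in H_G times the density of mu_G the pivot of k carries rho_k -
   (|N(k)| + 1)/2, N(k) being the closed neighbourhood. Each later neighbour adds 1/2, and N(k)
   consists of k, its parents and its later neighbours, so x_kk meets a Gamma integral of parameter
   rho_k - |Par k|/2. Within a class the numbers |Par k| are consecutive, starting from the number
   of strict ancestors: this assembles Gamma_n and makes the last vertex of the class give the sharp
   condition. The computation takes place in the extended reals, where a divergent Gamma integral is
   +oo, so one identity, valid for all alpha and beta, gives both the domain and the value. Since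
   sigma enters it only through H_G(sigma), the constancy required in the definition of A comes with
   it. *)
Require Import Defs.
From mathcomp Require Import all_boot all_order all_algebra.
From mathcomp Require Import all_classical all_reals all_analysis.
From mathcomp Require Import measurable_realfun zify ring lra.

Set Implicit Arguments.
Unset Strict Implicit.
Unset Printing Implicit Defensive.

Import Order.TTheory GRing.Theory Num.Theory.
Import numFieldNormedType.Exports.

Local Open Scope ring_scope.

(** * One-dimensional integrals *)

Section OneVariable.
Local Open Scope classical_set_scope.
Variable R : realType.
Local Notation mR := (measurableTypeR R).
Local Notation mu := (@lebesgue_measure R).

Lemma measurable_affine (a b : R) :
  measurable_fun [set: mR] (fun x : mR => a * x + b : mR).
Proof. by apply: measurable_funD => //; exact: measurable_funM. Qed.

Lemma preimage_affine_itvoc (a b c d : R) : 0 < a ->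
  (fun x => a * x + b) @^-1` `]c, d] = `](c - b) / a, (d - b) / a]%classic.
Proof.
move=> a0; apply/seteqP; split=> x /=; rewrite !in_itv/=;
by rewrite ltr_pdivrMr// ler_pdivlMr// ltrBlDr lerBrDr (mulrC x).
Qed.

(** The right-hand side, as a measure in [A], gives every interval ]c, d] its length, and Lebesgue
    measure is determined by these values. *)
Lemma lebesgue_measure_affine (a b : R) (A : set mR) : 0 < a ->
  measurable A ->
  mu A = (a%:E * mu ((fun x => a * x + b)%R @^-1` A))%E.
Proof.
move=> a0 mA.
pose nu' : {measure set mR -> \bar R} :=
  mscale (NngNum (ltW a0))
   (measure_function_pushforward__canonical__measure_function_Measure mu
     (measurable_affine a b)).
rewrite (lebesgue_measure_unique (mu := nu'))// => X [[c d] _ <-] /=.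
rewrite /nu' /mscale /= /pushforward preimage_affine_itvoc//
  !lebesgue_measure_itv/= !lte_fin.
rewrite ltr_pM2r ?invr_gt0// ltrD2r; case: ifP => _; last by rewrite mule0.
by rewrite -!EFinD -EFinM; congr EFin; field; exact: lt0r_neq0.
Qed.

Lemma ge0_integral_affine (a b : R) (f : mR -> \bar R) : 0 < a ->
  measurable_fun setT f -> (forall x, 0 <= f x)%E ->
  (\int[mu]_x f x = a%:E * \int[mu]_x f (a * x + b)%R)%E.
Proof.
move=> a0 mf f0.
pose push : {measure set mR -> \bar R} :=
   (measure_function_pushforward__canonical__measure_function_Measure mu
     (measurable_affine a b)).
rewrite (@eq_measure_integral _ _ _ _ (mscale (NngNum (ltW a0)) push)); last
  first.
  by move=> A mA _; exact: lebesgue_measure_affine.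
rewrite ge0_integral_mscale//=; congr (_ * _)%E.
rewrite /push/= ge0_integral_pushforward//.
exact: measurable_affine.
Qed.

(** Extended-valued, so that divergence is visible as +oo; [Gamma] is its [fine] part and turns +oo
    into 0. *)
Definition eGamma (p : R) : \bar R :=
  (\int[mu]_(x in `]0%R, +oo[) (x `^ (p - 1) * expR (- x))%:E)%E.

Lemma GammaE (p : R) : Gamma p = fine (eGamma p).
Proof. by []. Qed.

Lemma measurable_powR_expRN (p : R) (D : set mR) :
  measurable_fun D (fun x : mR => (x `^ p * expR (- x))%:E).
Proof.
apply: (measurable_funS (E := setT)) => //.
apply/measurable_EFinP; apply: measurable_funM => //.
by apply: measurableT_comp => //; exact: measurable_funN.
Qed.

Lemma powR_expRN_ge0 (p x : R) : (0 <= (x `^ p * expR (- x))%:E)%E.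
Proof. by rewrite lee_fin mulr_ge0 ?powR_ge0 ?expR_ge0. Qed.

Lemma eGamma_ge0 (p : R) : (0 <= eGamma p)%E.
Proof. by apply: integral_ge0 => x _; exact: powR_expRN_ge0. Qed.

Lemma ge0_integral_ge_cst (D A : set mR) (f : mR -> R) (c : R) :
  measurable D -> measurable A -> A `<=` D -> measurable_fun D (EFin \o f) ->
  (forall x, D x -> 0 <= f x) -> (forall x, A x -> c <= f x) -> 0 <= c ->
  (c%:E * mu A <= \int[mu]_(x in D) (f x)%:E)%E.
Proof.
move=> mD mA AD mf f0 cf c0.
rewrite -integral_cst//; apply: (@le_trans _ _ (\int[mu]_(x in A) (f x)%:E)%E).
  apply: ge0_le_integral => //.
  - exact: measurable_funS mf.
by apply: ge0_subset_integral => // x Dx; rewrite lee_fin f0.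
Qed.

(** Strict positivity for every real [p] keeps a divergent factor of a product from being cancelled
    by a zero one. *)
Lemma eGamma_gt0 (p : R) : (0 < eGamma p)%E.
Proof.
have [c c0 hc] : exists2 c : R, 0 < c &
    forall x : R, `[1, 2]%classic x -> c <= x `^ (p - 1) * expR (- x).
  (* The power is monotone on [1, 2], in a direction given by the sign of p - 1, so its minimum is
     at an endpoint. *)
  exists (Num.min (1 `^ (p - 1)) (2 `^ (p - 1)) * expR (- 2)).
    by rewrite mulr_gt0 ?expR_gt0// lt_min !powR_gt0.
  move=> x /=; rewrite in_itv/= => /andP[x1 x2].
  have x0 : 0 < x by lra.
  rewrite ler_pM ?expR_ge0 ?ler_expR ?lerN2//.
  rewrite ge_min; have [p0|p0] := leP 0 (p - 1).
    by rewrite ge0_ler_powR// nnegrE//; lra.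
  apply/orP; right; rewrite -(opprK (p - 1)) !(powRN _ (- (p - 1))).
  rewrite lef_pV2 ?posrE ?powR_gt0// ge0_ler_powR// ?nnegrE; lra.
apply: lt_le_trans (ge0_integral_ge_cst (D := `]0, +oo[) (A := `[1, 2]) _ _ _ _
  _ hc (ltW c0)) => //.
- by rewrite lebesgue_measure_itv/= lte_fin ltr1n -EFinD mule_gt0 ?lte_fin//;
  lra.
- by move=> x /=; rewrite !in_itv/= => /andP[x1 _]; rewrite andbT; lra.
- exact: measurable_powR_expRN.
- by move=> x _; rewrite mulr_ge0 ?powR_ge0 ?expR_ge0.
Qed.

Lemma ge0_integral_scale_itvoc (f : mR -> \bar R) (a c d : R) : 0 < a ->
  measurable_fun setT f -> (forall x, 0 <= f x)%E ->
  (\int[mu]_(x in `](a * c)%R, (a * d)%R]) f x =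
   a%:E * \int[mu]_(x in `]c, d]) f (a * x)%R)%E.
Proof.
move=> a0 mf f0.
rewrite integral_mkcond [X in (_ * X)%E]integral_mkcond.
rewrite (ge0_integral_affine 0 a0)//; last 2 first.
- by apply/(measurable_restrictT _ _).1 => //; exact: measurable_funS mf.
- by move=> x; rewrite erestrict_ge0.
congr (_ * _)%E; apply: eq_integral => x _; rewrite addr0 !patchE.
have -> // : ((a * x)%R \in `](a * c)%R, (a * d)%R]%classic) = (x \in `]c,
  d]%classic).
by apply/idP/idP; rewrite !inE/= !in_itv/= ltr_pM2l// ler_pM2l.
Qed.

(* Scaling by 1/2 shows that the integral I satisfies I = I + c with c >= 1/2. *)
Lemma integral_inv_itv01 : (\int[mu]_(x in `]0%R, 1%R]) (x^-1)%:E = +oo)%E.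
Proof.
have mi : measurable_fun [set: mR] (fun x : mR => (`|x|^-1)%:E).
  apply/measurable_EFinP.
  rewrite (_ : (fun x => _) = (fun x : mR => `|x| `^ (-1))); last first.
    by apply/funext => x; rewrite powR_inv1.
  exact: (measurableT_comp (measurable_powR _)).
have i0 (x : mR) : (0 <= (`|x|^-1)%:E)%E by rewrite lee_fin invr_ge0.
set I := (LHS).
have IE : I = (\int[mu]_(x in `]0%R, 1%R]) (`|x|^-1)%:E)%E.
  by apply: eq_integral => x; rewrite inE/= in_itv/= => /andP[x0 _]; rewrite
    gtr0_norm.
have II : (I = I + \int[mu]_(x in `](2^-1)%R, 1%R]) (`|x|^-1)%:E)%E.
  rewrite {1}IE (_ : `]0%R, 1%R]%classic = `]0%R, 2^-1%R] `|` `]2^-1%R, 1%R]);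
    last first.
    apply/seteqP; split=> x /=; rewrite !in_itv/=.
      by move=> /andP[x0 x1]; have [|] := leP x 2^-1; [left|right]; apply/andP;
        split.
    by move=> [/andP[? ?]|/andP[? ?]]; apply/andP; split => //; lra.
  rewrite ge0_integral_setU//; last 2 first.
  - exact: measurable_funS mi.
  - apply/disj_setPS => x /=; rewrite !in_itv/= => -[/andP[_ h1] /andP[h2 _]].
    by move: (lt_le_trans h2 h1); rewrite ltxx.
  congr (_ + _)%E.
  have := @ge0_integral_scale_itvoc (fun x => (`|x|^-1)%:E) 2^-1 0 1.
  rewrite mulr0 mulr1 => -> //; rewrite -ge0_integralZl//; last first.
    apply: (measurable_funS (E := setT)) => //.
    exact: (measurableT_comp mi (mulrl_measurable 2^-1)).
  rewrite IE; apply: eq_integral => x _; rewrite -EFinM normrM ger0_norm//.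
  by rewrite invfM invrK mulrA mulVf ?mul1r.
have J : (1%:E * mu `](2^-1)%R, 1%R] <= \int[mu]_(x in `](2^-1)%R, 1%R])
  (`|x|^-1)%:E)%E.
  apply: ge0_integral_ge_cst => //; first exact: measurable_funS mi.
  move=> x /=; rewrite in_itv/= => /andP[x2 x1].
  by rewrite gtr0_norm; [rewrite invf_ge1//; lra|lra].
rewrite lebesgue_measure_itv/= lte_fin invf_lt1// ltr1n -EFinD mul1e in J.
have I0 : (0 <= I)%E by rewrite IE integral_ge0.
move: (I) (\int[mu]_(x in _) _)%E I0 II J => [i||] [j||] //= _.
by rewrite lee_fin => -[] ? ?; clear I IE; exfalso; lra.
Qed.

(** For p <= 0 the integrand is at least exp(-1) / x on ]0, 1]. *)
Lemma eGamma_pinfty (p : R) : p <= 0 -> eGamma p = +oo%E.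
Proof.
move=> p0; apply/eqP; rewrite eq_le leey/=.
have mi : measurable_fun (`]0%R, 1%R] : set mR) (fun x : mR => (x^-1)%:E).
  apply/measurable_EFinP; apply: (eq_measurable_fun (fun x : mR => x `^ (-1))).
    by move=> x; rewrite inE/= in_itv/= => /andP[x0 _]; rewrite powR_inv1// ltW.
  exact: measurable_funS (measurable_powR _).
apply: (@le_trans _ _ (\int[mu]_(x in `]0%R, 1%R]) ((expR (-1))%:E *
  (x^-1)%:E))%E).
  rewrite ge0_integralZl ?integral_inv_itv01 ?gt0_muley ?lte_fin ?expR_gt0//.
  - by move=> x /=; rewrite in_itv/= => /andP[x0 _]; rewrite lee_fin invr_ge0
    ltW.
apply: (@le_trans _ _ (\int[mu]_(x in `]0%R, 1%R]) (x `^ (p - 1) * expR (-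
  x))%:E)%E).
  apply: ge0_le_integral => //.
  - move=> x /=; rewrite in_itv/= => /andP[x0 _].
    by rewrite -EFinM lee_fin mulr_ge0 ?expR_ge0 ?invr_ge0 ?ltW.
  - exact: measurable_funeM.
  - exact: measurable_powR_expRN.
  - move=> x /=; rewrite in_itv/= => /andP[x0 x1].
    rewrite -EFinM lee_fin mulrC ler_pM ?expR_ge0 ?ler_expR ?lerN2// ?invr_ge0
      ?(ltW x0)//.
    by rewrite -powR_inv1 ?(ltW x0)// ger_powR ?x0//; lra.
apply: ge0_subset_integral => //.
- exact: measurable_powR_expRN.
- by move=> x _; exact: powR_expRN_ge0.
- by move=> x /=; rewrite !in_itv/= => /andP[->].
Qed.

(* Scaling by 1/2 shows that I(n + 1) <= 2^-p I(n) + 1. *)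
Lemma integral_powR_itv_half_1_le (p : R) (n : nat) : 0 < p ->
  (\int[mu]_(x in `](2^-1 ^+ n)%R, 1%R]) (x `^ (p - 1))%:E
    <= ((1 - 2^-1 `^ p)^-1)%:E)%E.
Proof.
move=> p0; set q := 2^-1 `^ p; set f := fun x : mR => (x `^ (p - 1))%:E.
have q1 : q < 1.
  have := @gt0_ltr_powR R p p0 2^-1 1; rewrite powR1 !nnegrE => -> //; lra.
have q0 : 0 < q by rewrite powR_gt0.
have mf : measurable_fun [set: mR] f by apply/measurable_EFinP.
have f0 x : (0 <= f x)%E by rewrite lee_fin powR_ge0.
elim: n => [|n IHn].
  by rewrite expr0 set_itv_ge -?leNgt ?bnd_simp// integral_set0 lee_fin
    invr_ge0; lra.
rewrite (_ : `](2^-1 ^+ n.+1)%R, 1%R]%classic =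
    `](2^-1 * 2^-1 ^+ n)%R, (2^-1 * 1)%R] `|` `]2^-1%R, 1%R]); last first.
  rewrite exprS mulr1; have hn : 2^-1 * 2^-1 ^+ n <= 2^-1 :> R.
    by rewrite ger_pMr ?exprn_ile1 ?invf_le1 ?ler1n// invr_ge0.
  apply/seteqP; split=> x /=; rewrite !in_itv/=.
    by move=> /andP[x0 x1]; have [|] := leP x 2^-1; [left|right]; apply/andP;
      split.
  by move=> [/andP[? ?]|/andP[? ?]]; apply/andP; split => //; lra.
rewrite ge0_integral_setU//; last 3 first.
- exact: measurable_funS mf.
- by move=> x _; exact: f0.
- apply/disj_setPS => x /=; rewrite !in_itv/= mulr1 => -[/andP[_ h1] /andP[h2
  _]].
  by move: (lt_le_trans h2 h1); rewrite ltxx.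
rewrite ge0_integral_scale_itvoc//.
have -> : (2^-1%:E * \int[mu]_(x in `](2^-1 ^+ n)%R, 1%R]) f (2^-1 * x)%R =
    q%:E * \int[mu]_(x in `](2^-1 ^+ n)%R, 1%R]) f x)%E.
  rewrite -[RHS]ge0_integralZl//; last 2 first.
  - exact: measurable_funS mf.
  - by rewrite lee_fin ltW.
  rewrite -[LHS]ge0_integralZl; last 4 first.
  - exact: measurable_itv.
  - apply: (measurable_funS (E := setT)) => //.
    exact: (measurableT_comp mf (mulrl_measurable 2^-1)).
  - by move=> x _; exact: f0.
  - by rewrite lee_fin invr_ge0.
  apply: eq_integral => x; rewrite inE/= in_itv/= => /andP[x0 _].
  rewrite -!EFinM; congr EFin; rewrite powRM ?invr_ge0//; last first.
    by apply: ltW; apply: le_lt_trans x0; rewrite exprn_ge0// invr_ge0.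
  by rewrite mulrA; congr (_ * _); rewrite mulr_powRB1 ?invr_ge0.
have A1 : (\int[mu]_(x in `]2^-1%R, 1%R]) f x <= 1)%E.
  apply: (@le_trans _ _ (\int[mu]_(x in `]2^-1%R, 1%R]) (cst 2%:E x))%E).
    apply: ge0_le_integral => //; first exact: measurable_funS mf.
    move=> x /=; rewrite in_itv/= => /andP[x2 x1]; rewrite lee_fin.
    have x0 : 0 < x by apply: lt_trans x2; rewrite invr_gt0.
    apply: (@le_trans _ _ (x `^ (-1))); first by rewrite ger_powR ?x0//; lra.
    by rewrite powR_inv1 ?(ltW x0)// invf_ple ?posrE// ltW.
  rewrite integral_cst//= lebesgue_measure_itv/= lte_fin invf_lt1 ?ltr1n//
    -EFinD -EFinM lee_fin; lra.
apply: (@le_trans _ _ (q%:E * ((1 - q)^-1)%:E + 1)%E).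
  by apply: leeD => //; apply: lee_pmul => //; rewrite ?lee_fin ?(ltW q0)//
    integral_ge0.
by rewrite -EFinM -EFinD lee_fin le_eqVlt; apply/orP; left; apply/eqP; field;
  lra.
Qed.

(** The bound (1 - 2^-p)^-1 on the integrals over ]2^-n, 1] is the fixed point of c = 2^-p c + 1,
    hence independent of n, and monotone convergence reaches ]0, 1]. *)
Lemma integral_powR_itv01_lty (p : R) : 0 < p ->
  (\int[mu]_(x in `]0%R, 1%R]) (x `^ (p - 1))%:E < +oo)%E.
Proof.
move=> p0; set f := fun x : mR => (x `^ (p - 1))%:E.
have mf : measurable_fun [set: mR] f by apply/measurable_EFinP.
have UE : \bigcup_n `](2^-1 ^+ n)%R, 1%R]%classic = `]0, 1]%classic :> set mR.
  apply/seteqP; split=> x /=.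
    move=> [n _ /=]; rewrite !in_itv/= => /andP[x0 ->]; rewrite andbT.
    by apply: le_lt_trans x0; rewrite exprn_ge0// invr_ge0.
  rewrite in_itv/= => /andP[x0 x1].
  have [n hn] : exists n, x^-1 < n%:R by exists (Num.bound x^-1); rewrite
    archi_boundP// invr_ge0 ltW.
  exists n => //=; rewrite in_itv/= x1 andbT exprVn invf_plt ?posrE
    ?exprn_gt0//.
  by apply: lt_trans hn _; rewrite -natrX ltr_nat ltn_expl.
have ndF : nondecreasing_seq (fun n => `](2^-1 ^+ n)%R, 1%R]%classic : set mR).
  move=> m n mn; apply/subsetPset => x /=; rewrite !in_itv/= => /andP[x0 ->];
    rewrite andbT.
  by apply: le_lt_trans x0; apply: ler_wiXn2l => //; rewrite invf_le1// ler1n.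
have := @ge0_nondecreasing_set_cvg_integral _ mR R (fun n => `](2^-1 ^+ n)%R,
  1%R]%classic) f mu ndF.
rewrite UE => h.
have {h}h := h (fun=> measurable_itv _) (fun n => measurable_funS measurableT
  (@subsetT _ _) mf).
have {h}h := h (fun n x _ => powR_ge0 x (p - 1)).
rewrite -(cvg_lim _ h)//; apply: (@le_lt_trans _ _ ((1 - 2^-1 `^ p)^-1)%:E);
  last exact: ltry.
apply: lime_le; first by apply/cvg_ex; eexists; exact: h.
by near=> n; exact: integral_powR_itv_half_1_le.
Unshelve. all: by end_near. Qed.

(** Half of the exponential decay absorbs the power, because expR (x / 2) dominates (x / 2)^(n+1) /
    (n+1)!; what remains is a multiple of the exponential density of rate 1/2, whose integral is
    finite. *)
Lemma powR_expRN_le (p : R) : exists2 C : R, 0 <= C &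
  forall x, 1 <= x -> x `^ p * expR (- x) <= C * exponential_pdf 2^-1 x.
Proof.
pose n := Num.bound `|p|.
exists (2 * 2 ^+ n.+1 * n.+1`!%:R) => [|x x1].
  by apply: mulr_ge0 => //; apply: mulr_ge0 => //; exact: exprn_ge0.
rewrite exponential_pdfE ?(le_trans ler01)//.
have xn : x `^ p <= x ^+ n.+1.
  rewrite -powR_mulrn ?(le_trans ler01)// ler_powR//.
  apply: (le_trans (ler_norm p)); apply: ltW.
  by apply: (lt_le_trans (archi_boundP (normr_ge0 p))); rewrite ler_nat.
have en : x ^+ n.+1 <= 2 ^+ n.+1 * n.+1`!%:R * expR (x / 2).
  have := @expR_ge1Dxn R (x / 2) n; rewrite divr_ge0//; last by rewrite
    (le_trans ler01).
  move=> /(_ isT) h.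
  have : (x / 2) ^+ n.+1 / n.+1`!%:R <= expR (x / 2) by lra.
  rewrite ler_pdivrMr ?ltr0n ?fact_gt0// exprMn exprVn ler_pdivrMr ?exprn_gt0//.
  by rewrite mulrC [X in _ <= _ * X]mulrC mulrA.
have -> : 2 * 2 ^+ n.+1 * n.+1`!%:R * (2^-1 * expR (- 2^-1 * x)) =
   2 ^+ n.+1 * n.+1`!%:R * expR (x / 2) * expR (- x) :> R.
  by rewrite -(mulrA _ (expR _) (expR _)) -expRD (_ : x / 2 - x = - 2^-1 * x);
    [field|field].
by rewrite ler_wpM2r ?expR_ge0//; apply: le_trans en.
Qed.

Lemma eGamma_lty (p : R) : 0 < p -> (eGamma p < +oo)%E.
Proof.
move=> p0; rewrite /eGamma.
rewrite (_ : `]0%R, +oo[%classic = `]0%R, 1%R] `|` `]1%R, +oo[); last first.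
  apply/seteqP; split=> x /=; rewrite !in_itv/= ?andbT.
    by move=> x0; have [|] := leP x 1; [left|right]; rewrite ?x0.
  by move=> [/andP[]//|]; apply: lt_trans.
rewrite ge0_integral_setU//; last 3 first.
- exact: measurable_powR_expRN.
- by move=> x _; exact: powR_expRN_ge0.
- apply/disj_setPS => x /=; rewrite !in_itv/= andbT => -[/andP[_ h1] h2].
  by move: (lt_le_trans h2 h1); rewrite ltxx.
rewrite lte_add_pinfty//.
  apply: le_lt_trans (integral_powR_itv01_lty p0).
  apply: ge0_le_integral => //.
  - by move=> x _; exact: powR_expRN_ge0.
  - exact: measurable_powR_expRN.
  - by apply: (measurable_funS (E := setT)) => //; apply/measurable_EFinP.
  - move=> x /=; rewrite in_itv/= => /andP[x0 _]; rewrite lee_fin.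
    by rewrite ler_piMr ?powR_ge0// -expR0 ler_expR oppr_le0 ltW.
have [C C0 hC] := powR_expRN_le (p - 1).
have mpdf : measurable_fun [set: mR] (fun x : mR => (C * exponential_pdf 2^-1
  x)%:E).
  apply/measurable_EFinP; apply: measurable_funM => //.
  exact: measurable_exponential_pdf.
apply: (@le_lt_trans _ _ (\int[mu]_x (C * exponential_pdf 2^-1 x)%:E)%E).
  apply: (@le_trans _ _ (\int[mu]_(x in `]1%R, +oo[) (C * exponential_pdf 2^-1
    x)%:E)%E).
    apply: ge0_le_integral => //.
    - by move=> x _; exact: powR_expRN_ge0.
    - exact: measurable_powR_expRN.
    - exact: measurable_funS mpdf.
    - by move=> x /=; rewrite in_itv/= andbT => x1; rewrite lee_fin hC// ltW.
  apply: ge0_subset_integral => // x _.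
  by rewrite lee_fin mulr_ge0 ?exponential_pdf_ge0.
under eq_integral do rewrite EFinM.
rewrite ge0_integralZl_EFin//; last 2 first.
- by move=> x _; rewrite lee_fin exponential_pdf_ge0.
- by apply/measurable_EFinP; exact: measurable_exponential_pdf.
by rewrite integral_exponential_pdf// mule1 ltry.
Qed.

(** The integral over a diagonal entry z = x_kk: [c] is x_kP x_P^-1 x_Pk, so that z - c is the
    pivot, and [s] is the pivot of sigma. For lam + 1 <= 0 both sides are +oo. *)
Lemma integral_shifted_gamma (c s lam : R) : 0 < s ->
  (\int[mu]_z (if 0 < z - c then expR (- ((z - c) / s)) * (z - c) `^ lam else
    0)%:E
   = (s `^ (lam + 1))%:E * eGamma (lam + 1))%E.
Proof.
move=> s0.
pose g := fun z : mR => (if 0 < z then expR (- (z / s)) * z `^ lam else 0)%:E.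
have mg : measurable_fun [set: mR] g.
  apply/measurable_EFinP; apply: measurable_fun_ifT => //.
  - by apply: measurable_fun_ltr.
  - apply: measurable_funM => //; apply: measurableT_comp => //.
    by apply: measurable_funN; exact: measurable_funM.
have g0 z : (0 <= g z)%E.
  by rewrite lee_fin; case: ifP => // _; rewrite mulr_ge0 ?expR_ge0 ?powR_ge0.
transitivity (\int[mu]_x g (1 * x + - c)%R)%E.
  by apply: eq_integral => x _; rewrite mul1r.
rewrite -[LHS]mul1e -(ge0_integral_affine (- c) ltr01 mg g0).
rewrite (ge0_integral_affine 0 s0 mg g0) /eGamma.
rewrite [in RHS]integral_mkcond -[LHS]ge0_integralZl//; last 2 first.
- by apply: (measurableT_comp mg); exact: measurable_affine.
- by rewrite lee_fin ltW.
rewrite -[RHS]ge0_integralZl//; last 3 first.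
- apply/(measurable_restrictT _ _).1 => //; exact: measurable_powR_expRN.
- by move=> x _; rewrite erestrict_ge0// => y _; exact: powR_expRN_ge0.
- by rewrite lee_fin powR_ge0.
apply: eq_integral => z _; rewrite /g addr0 patchE pmulr_rgt0//.
have -> : (z \in `]0, +oo[%classic) = (0 < z).
  by apply/idP/idP; rewrite inE/= in_itv/= andbT.
case: ifP => z0; last by rewrite !mule0.
rewrite -!EFinM; congr EFin; rewrite powRM ?ltW// addrK.
have -> : s `^ (lam + 1) = s * s `^ lam.
  by rewrite powRD ?(gt_eqF s0) ?implybT// powRr1 ?ltW// mulrC.
by rewrite mulrC (_ : s * z / s = z); [ring|rewrite mulrAC divff ?mul1r//
  gt_eqF].
Qed.

Lemma integral_shifted_gauss (a b : R) : 0 < a ->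
  (\int[mu]_x (expR (- (a * (x - b) ^+ 2)))%:E = ((pi / a) `^ 2^-1)%:E)%E.
Proof.
move=> a0.
have mg : measurable_fun [set: mR] (fun x : mR => (gauss_fun x)%:E).
  by apply/measurable_EFinP; exact: measurable_gauss_fun.
have g0 (x : mR) : (0 <= (gauss_fun x)%:E)%E by rewrite lee_fin gauss_fun_ge0.
have sa : 0 < Num.sqrt a by rewrite sqrtr_gt0.
have := ge0_integral_affine (- (Num.sqrt a * b)) sa mg g0.
rewrite integralT_gauss => h.
rewrite powR12_sqrt; last by rewrite divr_ge0 ?pi_ge0 ?ltW.
rewrite sqrtrM ?pi_ge0// sqrtrV ?ltW// EFinM h muleC muleA -EFinM mulVf
  ?gt_eqF// mul1e.
apply: eq_integral => x _; congr (expR _)%:E.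
by rewrite -mulrBr exprMn sqr_sqrtr ?ltW.
Qed.

End OneVariable.

(** * Iterated Lebesgue integrals *)

Section IteratedIntegrals.
Local Open Scope classical_set_scope.
Variable R : realType.
Local Notation mR := (measurableTypeR R).
Local Notation mu := (@lebesgue_measure R).

Definition upd n (t : n.-tuple mR) (i : 'I_n) (x : mR) : n.-tuple mR :=
  [tuple if j == i then x else tnth t j | j < n].

(** The result is again a function of the full tuple, constant in coordinate [i], so integrals over
    any list of coordinates compose without reindexing. In [iter_int] the last coordinate of the
    list is integrated first. *)
Definition coord_int n (i : 'I_n) (F : n.-tuple mR -> \bar R) t : \bar R :=
  (\int[mu]_x F (upd t i x))%E.

Definition iter_int n (s : seq 'I_n) (F : n.-tuple mR -> \bar R) :=
  foldr (@coord_int n) F s.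

Lemma tnth_upd n (t : n.-tuple mR) i x j :
  tnth (upd t i x) j = if j == i then x else tnth t j.
Proof. by rewrite tnth_mktuple. Qed.

Lemma updC n (t : n.-tuple mR) i j x y : i != j ->
  upd (upd t i x) j y = upd (upd t j y) i x.
Proof.
move=> ij; apply: eq_from_tnth => k; rewrite !tnth_upd.
by case: (eqVneq k j) => [->|//]; rewrite eq_sym (negbTE ij).
Qed.

Lemma iter_int_cat n (s1 s2 : seq 'I_n) F :
  iter_int (s1 ++ s2) F = iter_int s1 (iter_int s2 F).
Proof. exact: foldr_cat. Qed.

Lemma measurable_upd n (i : 'I_n) :
  measurable_fun setT (fun p : mR * n.-tuple mR => upd p.2 i p.1).
Proof.
apply/measurable_fun_tnthP => j.
rewrite (_ : _ \o _ = fun p : mR * n.-tuple mR => if j == i then p.1 else tnth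
  p.2 j).
  case: (j == i); first exact: measurable_fst.
  by apply: (measurableT_comp (measurable_tnth j)); exact: measurable_snd.
by apply/funext => p /=; rewrite tnth_upd.
Qed.

Lemma coord_int_ge0 n (i : 'I_n) F t : (forall t, 0 <= F t)%E ->
  (0 <= coord_int i F t)%E.
Proof. by move=> F0; apply: integral_ge0. Qed.

Lemma measurable_coord_int n (i : 'I_n) F :
  measurable_fun setT F -> (forall t, 0 <= F t)%E ->
  measurable_fun setT (coord_int i F).
Proof.
move=> mF F0.
apply: (@measurable_fun_fubini_tonelli_G _ _ mR (n.-tuple mR) R mu
  (fun p => F (upd p.2 i p.1))) => //.
exact: (measurableT_comp mF (measurable_upd i)).
Qed.

Lemma iter_int_ge0 n (s : seq 'I_n) F t : (forall t, 0 <= F t)%E ->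
  (0 <= iter_int s F t)%E.
Proof. by move=> F0; elim: s t => [|i s IHs] t //=; exact: coord_int_ge0. Qed.

Lemma measurable_iter_int n (s : seq 'I_n) F :
  measurable_fun setT F -> (forall t, 0 <= F t)%E ->
  measurable_fun setT (iter_int s F).
Proof.
move=> mF F0; elim: s => [|i s IHs] //=; apply: measurable_coord_int => // t.
exact: iter_int_ge0.
Qed.

Lemma coord_intC n (i j : 'I_n) F :
  measurable_fun setT F -> (forall t, 0 <= F t)%E ->
  coord_int i (coord_int j F) = coord_int j (coord_int i F).
Proof.
move=> mF F0; have [->//|ij] := eqVneq i j; apply/funext => t.
rewrite /coord_int.
under [RHS]eq_integral do under eq_integral do rewrite updC 1?eq_sym//.
pose f (p : mR * mR) := F (upd (upd t i p.1) j p.2).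
apply: (@fubini_tonelli _ _ mR mR R mu mu f) => //; last by move=> p; exact: F0.
apply: (measurableT_comp mF).
apply: (measurableT_comp (measurable_upd j) (g := fun p : mR * mR => (p.2, upd t
  i p.1))).
apply: measurable_fun_pair => //.
by apply: (measurableT_comp (measurable_upd i) (g := fun p : mR * mR => (p.1,
  t))); exact: measurable_fun_pair.
Qed.

Lemma iter_int_head n (s1 s2 : seq 'I_n) i F :
  measurable_fun setT F -> (forall t, 0 <= F t)%E ->
  iter_int (s1 ++ i :: s2) F = iter_int (i :: s1 ++ s2) F.
Proof.
move=> mF F0; elim: s1 => [|j s1 IHs]//=; rewrite IHs/= coord_intC//.
- exact: measurable_iter_int.
- by move=> t; exact: iter_int_ge0.
Qed.

Lemma perm_iter_int n (s1 s2 : seq 'I_n) F :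
  measurable_fun setT F -> (forall t, 0 <= F t)%E ->
  perm_eq s1 s2 -> iter_int s1 F = iter_int s2 F.
Proof.
move=> mF F0; elim: s1 s2 => [|i s1 IHs] s2; first by rewrite perm_sym =>
  /perm_nilP->.
move=> s12; have : i \in s2 by rewrite -(perm_mem s12) mem_head.
move=> i2; case/splitPr: i2 s12 => s3 s4 s12.
rewrite iter_int_head//=; congr coord_int; apply: IHs.
by move: s12; rewrite perm_sym perm_catC/= perm_cons perm_catC perm_sym.
Qed.

Lemma eq_iter_int n (s : seq 'I_n) (F G : n.-tuple mR -> \bar R) t :
  (forall t', (forall i, i \notin s -> tnth t' i = tnth t i) -> F t' = G t') ->
  iter_int s F t = iter_int s G t.
Proof.
elim: s t => [|i s IHs] t FG /=; first exact: FG.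
apply: eq_integral => x _; apply: IHs => t' tt'; apply: FG => j.
rewrite inE negb_or => /andP[ji js].
by rewrite tt'// tnth_upd (negbTE ji).
Qed.

Lemma iter_int0 n (s : seq 'I_n) t : iter_int s (fun _ : n.-tuple mR => 0%E) t =
  0%E.
Proof. by elim: s t => [|i s IHs] t //=; apply: integral0_eq => x _; exact: IHs.
  Qed.

Lemma iter_intZ n (s : seq 'I_n) (F : n.-tuple mR -> \bar R) (c : \bar R) t :
  measurable_fun setT F -> (forall t, 0 <= F t)%E -> (0 <= c)%E ->
  iter_int s (fun t => c * F t)%E t = (c * iter_int s F t)%E.
Proof.
move=> mF F0 c0; elim: s t => [|i s IHs] t //=; rewrite /coord_int.
under eq_integral do rewrite IHs.
rewrite ge0_integralZl//; last by move=> x _; exact: iter_int_ge0.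
apply: (measurableT_comp (measurable_iter_int s mF F0)).
apply: (measurableT_comp (measurable_upd i) (g := fun x : mR => (x, t))).
exact: measurable_pair2.
Qed.

Lemma upd_cons0 n (x y : mR) (t : n.-tuple mR) :
  upd [tuple of x :: t] ord0 y = [tuple of y :: t].
Proof.
apply: eq_from_tnth => k; rewrite tnth_upd; case: (unliftP ord0 k) => [j|] ->/=.
  by rewrite !tnthS.
by rewrite !tnth0.
Qed.

Lemma upd_cons_lift n (x y : mR) (t : n.-tuple mR) i :
  upd [tuple of x :: t] (lift ord0 i) y = [tuple of x :: upd t i y].
Proof.
apply: eq_from_tnth => k; rewrite tnth_upd; case: (unliftP ord0 k) => [j|] ->/=.
  by rewrite !tnthS tnth_upd (inj_eq lift_inj).
by rewrite !tnth0.
Qed.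

Lemma iter_int_map_lift n (s : seq 'I_n) F (x : mR) (t : n.-tuple mR) :
  iter_int (map (lift ord0) s) F [tuple of x :: t] =
  iter_int s (fun t => F [tuple of x :: t]) t.
Proof.
elim: s t => [|i s IHs] t //=; apply: eq_integral => y _.
by rewrite upd_cons_lift IHs.
Qed.

(** The base point [t] is arbitrary: each of its coordinates gets overwritten. *)
Lemma integral_lebesgue_tuple n (F : n.-tuple mR -> \bar R) t :
  measurable_fun setT F -> (forall t, 0 <= F t)%E ->
  (\int[lebesgue_tuple R n]_t F t)%E = iter_int (enum 'I_n) F t.
Proof.
elim: n F t => [|n IHn] F t mF F0.
  rewrite (_ : enum 'I_0 = [::]) /=; last by apply: size0nil; rewrite
    size_enum_ord.
  by rewrite integral_dirac// diracT mul1e [t]tuple0.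
have mF' x : measurable_fun setT (fun t : n.-tuple mR => F [tuple of x :: t]).
  by apply: (measurableT_comp mF); exact: measurable_cons.
have mFc := measurableT_comp mF (@measurable_tcons R n).
transitivity (\int[lebesgue_measure \x lebesgue_tuple R n]_p F (tcons p))%E.
  by rewrite [LHS](ge0_integral_pushforward (@measurable_tcons R n)).
rewrite fubini_tonelli1// enum_ordSl/= /coord_int; apply: eq_integral => x _.
case/tupleP: t => y t.
rewrite upd_cons0 iter_int_map_lift -IHn//.
Qed.

End IteratedIntegrals.

(** * Positive definite matrices and Gaussian integrals *)

Section SchurComplement.
Variables (F : fieldType) (m n : nat).
Implicit Types (A : 'M[F]_m) (B : 'M[F]_(m, n)) (C : 'M[F]_(n, m)) (D :
  'M[F]_n).

Lemma block_mx_schur A B C D : D \in unitmx ->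
  block_mx A B C D = block_mx 1%:M (B *m invmx D) 0 1%:M
    *m block_mx (A - B *m invmx D *m C) 0 0 D
    *m block_mx 1%:M 0 (invmx D *m C) 1%:M.
Proof.
move=> uD; rewrite !mulmx_block !(mul0mx, mul1mx, mulmx1, mulmx0, addr0, add0r).
by rewrite mulKVmx// -(mulmxA B (invmx D) D) mulVmx// mulmx1 mulmxA subrK.
Qed.

Lemma det_block_schur A B C D : D \in unitmx ->
  \det (block_mx A B C D) = \det (A - B *m invmx D *m C) * \det D.
Proof.
move=> uD; rewrite block_mx_schur// !det_mulmx !det_ublock det_lblock.
by rewrite !det1 !mul1r mulr1.
Qed.

End SchurComplement.

Section PositiveDefinite.
Variable R : realType.

Definition qf n (A : 'M[R]_n) (v : 'cV[R]_n) : R := (v^T *m A *m v) 0 0.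

Lemma qf_block m n (A : 'M[R]_m) (B : 'M[R]_(m, n)) (D : 'M[R]_n) x y :
  D \in unitmx -> D^T = D ->
  qf (block_mx A B B^T D) (col_mx x y) =
  qf (A - B *m invmx D *m B^T) x + qf D (y + invmx D *m B^T *m x).
Proof.
move=> uD sD; rewrite /qf block_mx_schur//.
set L := block_mx 1%:M 0 _ _.
have -> : block_mx 1%:M (B *m invmx D) 0 1%:M = L^T.
  by rewrite /L tr_block_mx !trmx1 trmx0 trmx_mul trmxK trmx_inv sD.
rewrite !mulmxA -trmx_mul -(mulmxA _ L) /L mul_block_col.
rewrite !mul1mx mul0mx addr0 [_ + y]addrC.
by rewrite tr_col_mx mul_row_block !mulmx0 addr0 add0r mul_row_col mxE.
Qed.

Lemma qf_gt0 n (A : 'M[R]_n) v : posdef A -> v != 0 -> 0 < qf A v.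
Proof. by case=> _; exact. Qed.

Lemma qf_ge0 n (A : 'M[R]_n) v : posdef A -> 0 <= qf A v.
Proof.
move=> pA; have [->|v0] := eqVneq v 0; last exact/ltW/qf_gt0.
by rewrite /qf mulmx0 mxE.
Qed.

Lemma posdef_unitmx n (A : 'M[R]_n) : posdef A -> A \in unitmx.
Proof.
move=> pA; rewrite -row_free_unit -kermx_eq0; apply/eqP/row_matrixP => i.
rewrite row0; apply/eqP/negPn/negP => v0.
have := qf_gt0 pA (v := (row i (kermx A))^T).
have -> : (row i (kermx A))^T != 0.
  by apply: contraNneq v0 => e; rewrite -[row _ _]trmxK e trmx0.
by move=> /(_ isT); rewrite /qf trmxK -row_mul mulmx_ker row0 mul0mx mxE ltxx.
Qed.

Lemma posdef_inv n (A : 'M[R]_n) : posdef A -> posdef (invmx A).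
Proof.
move=> pA; have uA := posdef_unitmx pA; have [sA _] := pA; split.
  by rewrite trmx_inv sA.
move=> v v0; have : 0 < qf A (invmx A *m v).
  apply: qf_gt0 => //; apply: contraNneq v0 => /(congr1 (mulmx A)).
  by rewrite mulKVmx// mulmx0 => ->.
by rewrite /qf trmx_mul trmx_inv sA !mulmxA mulmxKV.
Qed.

Lemma posdef_dr m n (A : 'M[R]_m) (B : 'M[R]_(m, n)) C (D : 'M[R]_n) :
  posdef (block_mx A B C D) -> posdef D.
Proof.
case=> sA pA; move: sA; rewrite tr_block_mx => /eq_block_mx[_ _ _ sD]; split=>
  // v v0.
have := pA (col_mx 0 v); rewrite col_mx_eq0 eqxx v0 => /(_ isT).
by rewrite tr_col_mx trmx0 mul_row_block !mul0mx !add0r mul_row_col mulmx0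
  add0r.
Qed.

Lemma posdef_block_sym m n (A : 'M[R]_m) (B : 'M[R]_(m, n)) C (D : 'M[R]_n) :
  posdef (block_mx A B C D) -> C = B^T.
Proof. by case; rewrite tr_block_mx => /eq_block_mx[_ _ ->]. Qed.

Lemma posdef_block_schur m n (A : 'M[R]_m) (B : 'M[R]_(m, n)) (D : 'M[R]_n) :
  posdef (block_mx A B B^T D) -> posdef (A - B *m invmx D *m B^T).
Proof.
move=> pA; have pD := posdef_dr pA; have [sD _] := pD; have uD := posdef_unitmx
  pD.
have [] := pA; rewrite tr_block_mx => /eq_block_mx[sA _ _ _] _; split.
  by rewrite linearB/= sA !trmx_mul trmxK trmx_inv sD mulmxA.
(* This lower part annihilates the square in [qf_block] and leaves the form of the Schur complement
   alone. *)
move=> v v0; have := @qf_gt0 _ _ (col_mx v (- (invmx D *m B^T *m v))) pA.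
rewrite col_mx_eq0 (negbTE v0) => /(_ isT).
by rewrite qf_block// addNr /qf !mulmx0 [X in _ + X]mxE addr0.
Qed.

Lemma posdef_det_gt0 n (A : 'M[R]_n) : posdef A -> 0 < \det A.
Proof.
elim: n A => [|n IHn] A pA; first by rewrite det_mx00.
rewrite -(@submxK _ 1 n 1 n A) in pA *; have sB := @posdef_block_sym 1 n _ _ _ _
  pA.
rewrite sB in pA *; have pD := @posdef_dr 1 n _ _ _ _ pA.
rewrite (@det_block_schur _ 1 n) ?posdef_unitmx// mulr_gt0 ?IHn//.
have [_ /(_ 1%:M)] := @posdef_block_schur 1 n _ _ _ pA.
by rewrite trmx1 mul1mx mulmx1 det_mx11; apply; exact: oner_neq0.
Qed.

Lemma posdef_scale n (A : 'M[R]_n) a : 0 < a -> posdef A -> posdef (a *: A).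
Proof.
move=> a0 [sA pA]; split; first by rewrite linearZ/= sA.
by move=> v v0; rewrite -scalemxAr -scalemxAl mxE mulr_gt0// pA.
Qed.

(** Passes from a quadratic form in the regression vector p^-1 v to a Gaussian exponent in the
    coordinates v themselves, centred at p b. *)
Lemma qf_invmx n (p : 'M[R]_n) (v b : 'cV[R]_n) : p^T = p -> p \in unitmx ->
  qf p (invmx p *m v - b) = qf (invmx p) (v - p *m b).
Proof.
move=> sp up; have -> : invmx p *m v - b = invmx p *m (v - p *m b).
  by rewrite mulmxBr mulKmx.
by rewrite /qf trmx_mul trmx_inv sp !mulmxA mulmxKV.
Qed.

Lemma qfZ n (a : R) (p : 'M[R]_n) (v : 'cV[R]_n) : qf (a *: p) v = a * qf p v.
Proof. by rewrite /qf -scalemxAr -scalemxAl mxE. Qed.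

End PositiveDefinite.

Section GaussianIntegral.
Local Open Scope classical_set_scope.
Variable R : realType.
Local Notation mR := (measurableTypeR R).
Local Notation mu := (@lebesgue_measure R).

(** Peels off the first entry, in step with the 1 + n block decomposition of the matrix of a
    quadratic form. *)
Fixpoint vec_int n : ('cV[R]_n -> \bar R) -> \bar R :=
  match n with
  | 0 => fun h => h 0
  | n'.+1 => fun h =>
      (\int[mu]_x vec_int (fun v : 'cV_n' => h (col_mx (x : R)%:M v)))%E
  end.

Lemma eq_vec_int n (h1 h2 : 'cV[R]_n -> \bar R) : h1 =1 h2 ->
  vec_int h1 = vec_int h2.
Proof. by move=> h12; congr vec_int; exact/funext. Qed.

(** Completing the square in the last n variables makes the inner integral Gaussian with matrix [D]
    and leaves a one-dimensional Gaussian with the Schur complement as coefficient. The exponent has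
    no factor 1/2, whence pi in place of 2 pi; [K] may be +oo, because it will contain a Gamma
    integral. *)
Lemma vec_int_gauss n (A : 'M[R]_n) (b : 'cV[R]_n) (K : \bar R) :
  posdef A -> (0 <= K)%E ->
  vec_int (fun v => K * (expR (- qf A (v - b)))%:E)%E =
  (K * ((pi ^+ n / \det A) `^ 2^-1)%:E)%E.
Proof.
elim: n A b K => [|n IHn] A b K pA K0 /=.
  by rewrite /qf mxE big_ord0 oppr0 expR0 det_mx00 divr1 powR1.
rewrite -(@submxK _ 1 n 1 n A) in pA *; have sB := @posdef_block_sym _ 1 n _ _ _
  _ pA.
rewrite sB in pA *.
move: (ulsubmx _) (ursubmx _) (drsubmx _) pA => {A sB} a B D pA.
have pD := @posdef_dr _ 1 n _ _ _ _ pA; have [sD _] := pD; have uD :=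
  posdef_unitmx pD.
have pS := @posdef_block_schur _ 1 n _ _ _ pA; set S := a - _ in pS *.
have S0 : 0 < S 0 0 by have := posdef_det_gt0 pS; rewrite det_mx11.
rewrite -[b](@vsubmxK _ 1 n 1 b); move: (@usubmx _ 1 n 1 b) (@dsubmx _ 1 n 1 b)
  => b0 b1.
have inner (x : mR) : vec_int (fun v : 'cV_n => K *
   (expR (- qf (block_mx a B B^T D) (col_mx (x : R)%:M v - col_mx b0 b1)))%:E)%E
     =
   (K * ((pi ^+ n / \det D) `^ 2^-1)%:E * (expR (- (S 0 0 * (x - b0 0 0) ^+
     2)))%:E)%E.
  set w := (x : R)%:M - b0.
  (* Given the first entry, the others are centred at b1 - D^-1 B^T w. *)
  rewrite -muleA [X in (K * X)%E]muleC muleA -(IHn D (b1 - invmx D *m B^T *m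
    w))//; last first.
    by rewrite mule_ge0// lee_fin expR_ge0.
  apply: eq_vec_int => v; rewrite -muleA -EFinM -expRD; congr (_ * (expR
    _)%:E)%E.
  rewrite opp_col_mx add_col_mx qf_block// -/S -/w opprD.
  congr (_ + _); last by congr (- qf _ _); rewrite opprB addrA addrAC.
  rewrite /qf [w]mx11_scalar tr_scalar_mx mul_scalar_mx mul_mx_scalar !mxE eqxx
    mulr1n.
  congr (- _); exact: (etrans (mulrA _ _ _) (mulrC _ _)).
under eq_integral do rewrite inner.
rewrite ge0_integralZl//; last 2 first.
- apply/measurable_EFinP; apply: measurableT_comp => //; apply: measurable_funN.
  apply: measurable_funM => //; apply: measurable_funX.
  exact: measurable_funB.
- by rewrite mule_ge0// lee_fin powR_ge0.
rewrite integral_shifted_gauss// -muleA -EFinM; congr (_ * _%:E)%E.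
rewrite -powRM ?divr_ge0 ?exprn_ge0 ?pi_ge0 ?(ltW S0) ?(ltW (posdef_det_gt0
  pD))//.
rewrite (@det_block_schur _ 1 n)// det_mx11 -/S; congr (_ `^ _).
by rewrite invfM exprS; ring.
Qed.

(** [F] has to agree with [h] only where the coordinates outside the image of [idx] have their
    values in [t], so [h] may contain those values as parameters. *)
Lemma iter_int_vec_int N n (idx : 'I_n -> 'I_N) (F : N.-tuple mR -> \bar R) t
    (h : 'cV[R]_n -> \bar R) :
  injective idx ->
  (forall t', (forall i, i \notin codom idx -> tnth t' i = tnth t i) ->
    F t' = h (\col_k tnth t' (idx k))) ->
  iter_int (codom idx) F t = vec_int h.
Proof.
elim: n idx F t h => [|n IHn] idx F t h iidx Fh.
  rewrite /= codomE (_ : enum _ = [::]); last by apply: size0nil; rewrite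
    size_enum_ord.
  by rewrite /= Fh//; congr h; apply/matrixP => -[].
rewrite codomE enum_ordSl/= -map_comp; apply: eq_integral => x _.
rewrite -codomE; apply: IHn; first by apply: inj_comp => //; exact: lift_inj.
have idx0 : idx ord0 \notin codom (idx \o lift ord0).
  by apply/negP => /codomP[j] /iidx/eqP; rewrite (negbTE (neq_lift _ _)).
move=> t' tt'; rewrite Fh.
  congr h; apply/matrixP => k l; rewrite [LHS]mxE; case: (@split_ordP 1 n k) =>
    j ->.
    rewrite (@col_mxEu _ 1 n 1) !ord1 mxE eqxx mulr1n (_ : lshift n 0 = ord0);
      last exact: val_inj.
    by rewrite tt'// tnth_upd eqxx.
  by rewrite (@col_mxEd _ 1 n 1) mxE/= (_ : rshift 1 j = lift ord0 j)//; exact: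
    val_inj.
move=> i hi; rewrite tt'; last first.
  by apply: contra hi => /codomP[j ->]; exact: codom_f.
rewrite tnth_upd; case: eqP => // E; case/negP: hi; rewrite E; exact: codom_f.
Qed.

End GaussianIntegral.

(** * Homogeneous graphs *)

Section HomogeneousGraph.
Import fintype boot.finset.
Local Open Scope set_scope.
Variables (r : nat) (E : rel 'I_r).
Hypotheses (rE : reflexive E) (sE : symmetric E).
Implicit Types (i j k : 'I_r) (A B C S u v : {set 'I_r}).

Definition cnb i : {set 'I_r} := i |: nb E i.

Lemma in_cnb i j : (j \in cnb i) = E i j.
Proof.
rewrite !inE /adj sE; case: eqVneq => [->|] /=; first by rewrite rE.
by [].
Qed.

Lemma arrowP i j : reflect (forall k, E j k -> E i k) (arrow E i j).
Proof.
apply: (iffP subsetP) => h k; first by rewrite -!in_cnb; exact: h.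
by rewrite !in_cnb; exact: h.
Qed.

Lemma arrow_refl : reflexive (arrow E). Proof. by move=> i; exact: subxx. Qed.

Lemma arrow_trans : transitive (arrow E).
Proof. by move=> j i k ij jk; exact: subset_trans jk ij. Qed.

Lemma arrow_edge i j : arrow E i j -> E i j.
Proof. by move/arrowP; apply. Qed.

Lemma arrow_complete A k : k \in A -> complete E A -> forall j, j \in A -> E j
  k.
Proof. by move=> kA /forall_inP cA j /cA/forall_inP; apply. Qed.

Hypothesis hE : homogeneous E.

(** Otherwise i has a neighbour a not adjacent to j, and j a neighbour b not adjacent to i; then a,
    i, j, b induce a 4-cycle if a and b are adjacent, and a path if not. *)
Lemma edge_arrow i j : E i j -> arrow E i j || arrow E j i.
Proof.
move=> ij; apply/negPn/negP; rewrite negb_or => /andP[/subsetPn[b]].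
rewrite -/(cnb _) in_cnb => jb; rewrite -/(cnb _) in_cnb => nib.
move=> /subsetPn[a]; rewrite -/(cnb _) in_cnb => ia; rewrite -/(cnb _) in_cnb =>
  nja.
have neq x y z : E x y -> ~~ E x z -> y != z.
  by move=> xy; apply: contraNneq => <-.
have ai : a != i by apply: contraNneq nja => ->; rewrite sE.
have aj : a != j by apply: contraNneq nja => ->.
have bi : b != i by apply: contraNneq nib => ->.
have bj : b != j by apply: contraNneq nib => ->.
have ab : a != b := neq _ _ _ ia nib.
have ij' : i != j by apply: contraNneq nib => ->.
have [[_ noC] noP] := hE.
have un : uniq [:: a; i; j; b].
  by rewrite /= !inE !negb_or ai aj ab ij' (eq_sym i b) bi (eq_sym j b) bj.
have nai : E a i by rewrite sE. have nbj : E b j by rewrite sE.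
have naj : E a j = false by rewrite sE (negbTE nja).
have nbi : E b i = false by rewrite sE (negbTE nib).
have [Eab|nab] := boolP (E a b); last first.
  apply: (noP a i j b); split => //.
    by rewrite /adj ai nai ij' ij eq_sym bj jb.
  by rewrite /adj naj (negbTE nib) (negbTE nab) !andbF.
apply: (noC [:: a; i; j; b]) => //; split=> //.
have Eba : E b a by rewrite sE.
have ji : E j i by rewrite sE.
have [ia' ja' ba'] : [/\ i != a, j != a & b != a] by rewrite ![_ == a]eq_sym.
have [ib' jb' ji'] : [/\ i != b, j != b & j != i] by split; rewrite eq_sym.
move: (negbTE ai) (negbTE aj) (negbTE ab) (negbTE ij') (negbTE bi) (negbTE bj).
move: (negbTE ia') (negbTE ja') (negbTE ba') (negbTE ji') (negbTE ib') (negbTE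
  jb').
move=> e1 e2 e3 e4 e5 e6 e7 e8 e9 e10 e11 e12.
move=> x y; rewrite !inE.
move=> /or4P[]/eqP-> /or4P[]/eqP->; rewrite /adj /=;
by rewrite !(eqxx, e1, e2, e3, e4, e5, e6, e7, e8, e9, e10, e11, e12) /=
  ?(eqxx, e1, e2, e3, e4, e5, e6, e7, e8, e9, e10, e11, e12) /=
  ?(nai, ia, naj, negbTE nja, Eab, Eba, ij, ji, negbTE nib, nbi, jb, nbj).
Qed.

(** The vertex i lies in the neighbourhood of k, hence in that of j, so i and j are adjacent. This
    is the tree property of [T]: ancestors form a chain. *)
Lemma arrow_comparable i j k : arrow E i k -> arrow E j k ->
  arrow E i j || arrow E j i.
Proof.
move=> /arrow_edge ik /arrowP jk; apply: edge_arrow.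
by rewrite sE; apply: jk; rewrite sE.
Qed.

(* A linear extension of [arrow], hence a perfect elimination order. *)
Definition prec i j :=
  (#|cnb j| < #|cnb i|)%N || ((#|cnb j| == #|cnb i|) && (i < j)%N).

Definition Par k : {set 'I_r} := [set j | E j k && prec j k].
Definition fam k : {set 'I_r} := k |: Par k.

Lemma prec_irr i : prec i i = false.
Proof. by rewrite /prec !ltnn andbF. Qed.

Lemma prec_trans : transitive prec.
Proof. by rewrite /prec => j i k; lia. Qed.

Lemma prec_total i j : i != j -> prec i j || prec j i.
Proof. by move=> ij; have : (i != j :> nat) by []; rewrite /prec; lia. Qed.

Lemma precNsym i j : prec i j -> prec j i = false.
Proof. by rewrite /prec; lia. Qed.

(** Closed neighbourhoods of adjacent vertices are nested, and that of the earlier vertex has at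
    least as many elements, so it is the larger one or equal. *)
Lemma prec_arrow i j : E i j -> prec i j -> arrow E i j.
Proof.
move=> /edge_arrow/orP[//|ji] pij; have le : (#|cnb i| <= #|cnb j|)%N :=
  subset_leq_card ji.
have /eqP eij : cnb i == cnb j.
  have sij : cnb i \subset cnb j by [].
  by rewrite eqEcard sij/=; move: pij; rewrite /prec; case/orP =>
    [/ltnW//|/andP[/eqP->]].
by rewrite /arrow -!/(cnb _) eij.
Qed.

Lemma in_Par j k : (j \in Par k) = E j k && prec j k.
Proof. by rewrite inE. Qed.

Lemma Par_irr k : k \notin Par k.
Proof. by rewrite in_Par prec_irr andbF. Qed.

Lemma complete_fam k : complete E (fam k).
Proof.
have h j : j \in fam k -> arrow E j k.
  by rewrite !inE => /predU1P[->|/andP[/prec_arrow]]; [exact: arrow_refl|exact].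
apply/forall_inP => i /h ik; apply/forall_inP => j /h jk.
by have [/arrow_edge//|/arrow_edge] := orP (arrow_comparable ik jk); rewrite sE.
Qed.

(** Says that the pivots of the vertices of [A] are those of x_A taken alone, eliminated along
    [prec]; parent sets, cliques, separators and sets of ancestors all qualify. *)
Definition initial A := [forall k in A, Par k == [set j in A | prec j k]].

Lemma initialP A : reflect {in A, forall k, Par k = [set j in A | prec j k]}
  (initial A).
Proof. exact: 'forall_in_eqP. Qed.

Lemma complete_initial A : complete E A ->
  {in A, forall k, Par k \subset A} -> initial A.
Proof.
move=> cA sA; apply/initialP => k kA; apply/setP => j; rewrite inE.
apply/idP/andP => [jk|[jA pjk]].
  by split; [exact: (subsetP (sA _ kA))|move: jk; rewrite in_Par => /andP[]].
by rewrite in_Par pjk (arrow_complete kA cA).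
Qed.

(** If j is a parent of a parent i of k, the neighbourhood of j contains that of i, hence k, so j is
    a parent of k. A perfect elimination order of a decomposable graph can fail this, as the path on
    four vertices shows. *)
Lemma initial_Par k : initial (Par k).
Proof.
apply: complete_initial.
  apply/forall_inP => i ik; apply/forall_inP => j jk.
  by have /forall_inP/(_ i) := complete_fam k; rewrite setU1r// => /(_
    isT)/forall_inP; apply; rewrite setU1r.
move=> i; rewrite in_Par => /andP[ik pik]; apply/subsetP => j.
rewrite !in_Par => /andP[ji pji]; rewrite (prec_trans pji)// andbT.
by move/arrowP: (prec_arrow ji pji); apply.
Qed.

Lemma prec_last A : A != finset.set0 ->
  exists2 k, k \in A & {in A, forall j, j != k -> prec j k}.
Proof.
move=> A0; have [n leA] := ubnP #|A|; elim: n A A0 leA => // n IHn A /set0Pn[i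
  iA] leA.
have [A1|A1] := eqVneq (A :\ i) finset.set0.
  by exists i => // j jA ji; move/setP: A1 => /(_ j); rewrite !inE ji jA.
have [] := IHn _ A1; first by move: leA; rewrite (cardsD1 i) iA; lia.
move=> k; rewrite !inE => /andP[ki kA] hk.
have [pik|pki] := orP (prec_total ki).
  exists i => // j jA ji; have [->//|jk] := eqVneq j k.
  by apply: prec_trans pik; apply: hk => //; rewrite !inE ji.
exists k => // j jA jk; have [->//|ji] := eqVneq j i.
by apply: hk => //; rewrite !inE ji.
Qed.

Lemma initial_last A : initial A -> A != finset.set0 -> exists2 k, k \in A & A =
  fam k.
Proof.
move=> /initialP iA /prec_last[k kA hk]; exists k => //.
apply/setP => j; rewrite inE (iA _ kA) !inE; have [->//|jk] := eqVneq j k.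
by case: (boolP (j \in A)) => //= jA; rewrite hk.
Qed.

(** A nonempty initial set is [fam k] for its last vertex k, and what remains without k is the
    smaller initial set [Par k]. *)
Lemma initial_ind (P : {set 'I_r} -> Prop) : P finset.set0 ->
  (forall k, P (Par k) -> P (fam k)) -> forall A, initial A -> P A.
Proof.
move=> P0 Pf A; have [n leA] := ubnP #|A|; elim: n A leA => // n IHn A leA iA.
have [->//|A0] := eqVneq A finset.set0.
have [k kA Ak] := initial_last iA A0; rewrite Ak; apply: Pf; apply: IHn
  (initial_Par k).
by move: leA; rewrite Ak /fam cardsU1 Par_irr; lia.
Qed.

(** A property of cliques that survives intersection, so that separators inherit it. *)
Definition arrow_closed S := complete E S && [forall k in S, forall j, arrow E j
  k ==> (j \in S)].

Lemma arrow_closedP S : reflect (complete E S /\ forall k j, k \in S -> arrow E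
  j k -> j \in S)
  (arrow_closed S).
Proof.
apply: (iffP andP) => -[cS aS]; split => //.
  by move=> k j kS jk; move/forall_inP: aS => /(_ _ kS)/forallP/(_ j); rewrite
    jk.
by apply/forall_inP => k kS; apply/forallP => j; apply/implyP; exact: aS.
Qed.

Lemma arrow_closed_initial S : arrow_closed S -> initial S.
Proof.
move=> /arrow_closedP[cS aS]; apply: complete_initial => // k kS; apply/subsetP
  => j.
by rewrite in_Par => /andP[/prec_arrow h /h]; exact: aS.
Qed.

Lemma complete_sub A B : A \subset B -> complete E B -> complete E A.
Proof.
move=> AB /forall_inP cB; apply/forall_inP => i iA; apply/forall_inP => j jA.
by have /forall_inP := cB _ (subsetP AB _ iA); apply; exact: (subsetP AB).
Qed.

Lemma completeU1 A i : complete E A -> {in A, forall j, E i j} -> complete E (i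
  |: A).
Proof.
move=> /forall_inP cA iA; apply/forall_inP => j /setU1P[->|jA]; apply/forall_inP
  => k /setU1P[->|kA].
- exact: rE.
- exact: iA.
- by rewrite sE; exact: iA.
- by have /forall_inP := cA _ jA; apply.
Qed.

Lemma complete_clique A : complete E A -> exists2 C, C \in cliques E & A \subset
  C.
Proof. by move=> /maxset_exists[C mC AC]; exists C => //; rewrite inE. Qed.

Lemma cliqueP C : reflect (complete E C /\ forall B, complete E B -> C \subset B
  -> B = C)
  (C \in cliques E).
Proof. by rewrite inE; exact: maxsetP. Qed.

(** If the neighbourhood of j contains that of some k in C, it contains C, and maximality puts j
    into C. *)
Lemma clique_arrow_closed C : C \in cliques E -> arrow_closed C.
Proof.
move=> /cliqueP[cC mC]; apply/arrow_closedP; split => // k j kC /arrowP jk.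
have cjC : complete E (j |: C).
  by apply: completeU1 => // i iC; apply: jk; rewrite sE; exact: arrow_complete
    iC.
by rewrite -(mC _ cjC (subsetUr _ _)) setU11.
Qed.

Lemma arrow_closedI A B : arrow_closed A -> arrow_closed B -> arrow_closed (A
  :&: B).
Proof.
move=> /arrow_closedP[cA aA] /arrow_closedP[_ aB]; apply/arrow_closedP; split.
  by apply: complete_sub cA; exact: subsetIl.
by move=> k j /setIP[kA kB] jk; rewrite inE (aA k)// (aB k).
Qed.

Definition cl i : {set 'I_r} := [set j | arrow E i j && arrow E j i].

Lemma cl_equivalence : {in [set: 'I_r] & &, equivalence_rel (fun i j => arrow E
  i j && arrow E j i)}.
Proof.
move=> i j k _ _ _; split; first by rewrite !arrow_refl.
move=> /andP[ij ji]; apply/andP/andP => -[h1 h2]; split.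
- exact: arrow_trans h1.
- exact: arrow_trans ij.
- exact: arrow_trans h1.
- exact: arrow_trans ji.
Qed.

Lemma T_partition : partition (T E) [set: 'I_r].
Proof. exact/equivalence_partitionP/cl_equivalence. Qed.

Lemma mem_cl i : i \in cl i. Proof. by rewrite inE arrow_refl. Qed.

Lemma cl_T i : cl i \in T E.
Proof.
apply/imsetP; exists i => //; apply/setP => j; by rewrite !inE.
Qed.

Lemma TP u : reflect (exists i, u = cl i) (u \in T E).
Proof.
apply: (iffP imsetP) => [[i _ ->]|[i ->]]; exists i => //; by apply/setP => j;
  rewrite !inE.
Qed.

Lemma T_cl u i : u \in T E -> i \in u -> u = cl i.
Proof.
move=> /TP[j ->]; rewrite inE => /andP[ji ij]; apply/setP => k; rewrite !inE.
apply/andP/andP => -[h1 h2]; split.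
- exact: arrow_trans h1.
- exact: arrow_trans ji.
- exact: arrow_trans h1.
- exact: arrow_trans ij.
Qed.

Lemma tle_cl i j : tle E (cl i) (cl j) = arrow E i j.
Proof.
apply/forall_inP/idP => [/(_ i (mem_cl i))/forall_inP/(_ j (mem_cl j))//|ij k].
rewrite inE => /andP[ik ki]; apply/forall_inP => l; rewrite inE => /andP[jl lj].
exact: arrow_trans (arrow_trans ki ij) jl.
Qed.

Lemma cl_eq i j : (cl i == cl j) = arrow E i j && arrow E j i.
Proof.
apply/eqP/idP => [ij|ij]; first by have := mem_cl j; rewrite -ij inE.
by rewrite (T_cl (cl_T i) (i := j))// inE.
Qed.

Lemma tlt_cl i j : tlt E (cl i) (cl j) = arrow E i j && ~~ arrow E j i.
Proof. by rewrite /tlt tle_cl cl_eq; case: (arrow E i j); rewrite ?andbT ?andbF.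
  Qed.

Lemma in_Vset i j : (j \in Vset E (cl i)) = arrow E j i.
Proof.
apply/bigcupP/idP => [[v /andP[/TP[k ->]]]|ji].
  by rewrite tle_cl inE => ki /andP[_ jk]; exact: arrow_trans jk ki.
by exists (cl j); rewrite ?cl_T ?tle_cl ?mem_cl.
Qed.

Lemma in_anc i j : (j \in anc E (cl i)) = arrow E j i && ~~ arrow E i j.
Proof.
apply/bigcupP/andP => [[v /andP[/TP[k ->]]]|[ji ij]].
  rewrite tlt_cl inE => /andP[ki ik] /andP[kj jk]; split; first exact:
    arrow_trans jk ki.
  by apply: contra ik => ij; exact: arrow_trans jk.
by exists (cl j); rewrite ?cl_T ?tlt_cl ?mem_cl ?ji ?ij.
Qed.

Lemma Vset_arrow_closed i : arrow_closed (Vset E (cl i)).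
Proof.
apply/arrow_closedP; split; last first.
  by move=> k j; rewrite !in_Vset => ki jk; exact: arrow_trans ki.
apply/forall_inP => j; rewrite in_Vset => ji; apply/forall_inP => k; rewrite
  in_Vset => ki.
by have [/arrow_edge//|/arrow_edge] := orP (arrow_comparable ji ki); rewrite sE.
Qed.

Lemma anc_arrow_closed i : arrow_closed (anc E (cl i)).
Proof.
have [cV aV] := arrow_closedP _ (Vset_arrow_closed i).
apply/arrow_closedP; split.
  by apply: complete_sub cV; apply/subsetP => j; rewrite in_anc in_Vset =>
    /andP[].
move=> k j; rewrite !in_anc => /andP[ki ik] jk; rewrite (arrow_trans jk ki)/=.
by apply: contra ik => ij; exact: arrow_trans jk.
Qed.

(** Take for k the last vertex of [S]: the others are adjacent to it and precede it, hence have an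
    arrow to k. *)
Lemma arrow_closed_Vset S : arrow_closed S -> S != finset.set0 ->
  exists2 k, k \in S & S = Vset E (cl k).
Proof.
move=> aS S0; have [k kS Sk] := initial_last (arrow_closed_initial aS) S0.
have [cS acS] := arrow_closedP _ aS.
exists k => //; apply/setP => j; rewrite in_Vset; apply/idP/idP; last exact:
  acS.
by rewrite Sk !inE => /predU1P[->|/andP[/prec_arrow]]; [exact:
  arrow_refl|exact].
Qed.

Lemma Vset_inj : {in T E &, injective (Vset E)}.
Proof.
move=> _ _ /TP[i ->] /TP[j ->] /setP ij; apply/eqP; rewrite cl_eq.
by rewrite -in_Vset -ij in_Vset arrow_refl -in_Vset ij in_Vset arrow_refl.
Qed.

Lemma endpoint_clique i : endpoint E (cl i) = (Vset E (cl i) \in cliques E).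
Proof.
apply/idP/idP => [/forallP ep|/cliqueP[_ mV]].
  have max j : arrow E i j -> arrow E j i.
    move=> ij; apply/negPn/negP => ji; suff [v cv] : exists v, child E (cl i) v.
      by have := ep v; rewrite cv.
    (* A child exists: as long as a class k lies strictly between those of i and j, replacing j by k
       shrinks V_j minus V_i. *)
    have [n len] := ubnP #|Vset E (cl j) :\: Vset E (cl i)|.
    elim: n j ij ji len => // n IHn j ij ji len.
    have [cij|] := boolP (child E (cl i) (cl j)); first by exists (cl j).
    rewrite /child cl_T tlt_cl ij ji/= negb_forall => /existsP[w].
    rewrite negb_imply negbK => /andP[/TP[k ->]]; rewrite !tlt_cl =>
      /andP[/andP[ik ki] /andP[kj jk]].
    apply: (IHn k) => //; rewrite -ltnS; apply: leq_trans len; rewrite ltnS;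
      apply: proper_card.
    apply/properP; split.
      by apply/subsetP => l; rewrite !inE !in_Vset => /andP[-> lk]; rewrite
        (arrow_trans lk kj).
    by exists j; rewrite !inE !in_Vset ?ji ?arrow_refl ?jk.
  have [cV aV] := arrow_closedP _ (Vset_arrow_closed i).
  apply/cliqueP; split => // B cB VB; apply/eqP; rewrite eqEsubset VB andbT.
  have iB : i \in B by rewrite (subsetP VB)// in_Vset arrow_refl.
  apply/subsetP => j jB; rewrite in_Vset.
  by have [//|/max] := orP (edge_arrow (arrow_complete iB cB jB)).
apply/forallP => v; apply/negP => /and3P[/TP[j ->]]; rewrite tlt_cl => /andP[ij
  ji] _.
have [cV _] := arrow_closedP _ (Vset_arrow_closed j).
have VV : Vset E (cl i) \subset Vset E (cl j).
  by apply/subsetP => k; rewrite !in_Vset => ki; exact: arrow_trans ij.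
by move/setP: (mV _ cV VV) => /(_ j); rewrite !in_Vset arrow_refl (negbTE ji).
Qed.


Lemma T_ind (P : {set 'I_r} -> Prop) : (forall i, P (cl i)) -> forall u, u \in T
  E -> P u.
Proof. by move=> Pc _ /TP[i ->]. Qed.

Lemma sum_T_card (p : pred {set 'I_r}) :
  (\sum_(v in T E | p v) #|v| = #|[set i | p (cl i)]|)%N.
Proof.
transitivity (\sum_(i in [set: 'I_r]) (i \in [set i | p (cl i)] : nat))%N; last
  first.
  by rewrite -sum1_card [RHS]big_mkcond/=; apply: eq_big => i; rewrite
    ?in_setT//; case: (_ \in _).
rewrite (set_partition_big _ T_partition)/= big_mkcondr/=.
apply: eq_bigr => v vT.
rewrite -sum1_card; case: ifP => pv; last first.
  by rewrite big1// => i iv; rewrite inE -(T_cl vT iv) pv.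
by apply: eq_bigr => i iv; rewrite inE -(T_cl vT iv) pv.
Qed.

Lemma sum_T_Vset u : u \in T E -> (\sum_(v in T E | tle E v u) #|v| = #|Vset E
  u|)%N.
Proof.
move: u; apply: T_ind => i; rewrite sum_T_card; apply: eq_card => j.
by rewrite inE tle_cl in_Vset.
Qed.

Lemma sum_T_anc u : u \in T E -> (\sum_(v in T E | tlt E v u) #|v| = #|anc E
  u|)%N.
Proof.
move: u; apply: T_ind => i; rewrite sum_T_card; apply: eq_card => j.
by rewrite inE tlt_cl in_anc.
Qed.

Lemma ancU_cl i : anc E (cl i) :|: cl i = Vset E (cl i).
Proof.
apply/setP => j; rewrite inE in_anc in_Vset inE.
by case: (arrow E j i); case: (arrow E i j).
Qed.

Lemma anc_cl_disjoint i : [disjoint anc E (cl i) & cl i].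
Proof.
by apply/pred0P => j /=; rewrite in_anc inE; case: (arrow E j i); case: (arrow E
  i j).
Qed.

(** Strict ancestors of k are adjacent to it and precede it, strict descendants follow it; only
    within the class of k does [prec] decide. The rank in the class becomes the shift j / 2 in
    Gamma_n. *)
Lemma card_Par k : #|Par k| = (#|anc E (cl k)| + #|[set j in cl k | prec j
  k]|)%N.
Proof.
rewrite -cardsUI (_ : _ :&: _ = finset.set0) ?cards0 ?addn0; last first.
  apply/disjoint_setI0; apply: disjointWr (anc_cl_disjoint k); apply/subsetP =>
    j; by rewrite inE => /andP[].
apply: eq_card => j; rewrite in_setU in_anc !inE; apply/andP/idP.
  move=> [ejk pjk]; rewrite pjk (prec_arrow ejk pjk) andbT/=.
  by case: (arrow E k j).
case/orP => [/andP[jk kj]|/andP[/andP[kj jk] ->]]; last by rewrite (arrow_edge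
  jk).
rewrite (arrow_edge jk); split => //; have jnk : j != k by apply: contraNneq kj
  => ->; exact: arrow_refl.
have [//|pkj] := orP (prec_total jnk); case/negP: kj; apply: prec_arrow => //.
by rewrite sE arrow_edge.
Qed.

(** Since [prec] is a strict linear order, the ranks of the elements of [A] are 0, ..., |A| - 1. *)
Lemma big_prec_rank (S : Type) (idx : S) (op : Monoid.com_law idx) A (f : nat ->
  S) :
  \big[op/idx]_(k in A) f #|[set j in A | prec j k]| = \big[op/idx]_(j < #|A|) f
    j.
Proof.
have [n leA] := ubnP #|A|; elim: n A leA => // n IHn A leA.
have [->|A0] := eqVneq A finset.set0; first by rewrite cards0 big_ord0 big_set0.
have [k kA hk] := prec_last A0.
have cA : #|A| = #|A :\ k|.+1 by rewrite (cardsD1 k) kA.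
rewrite cA big_ord_recr/= (big_setD1 k kA)/= Monoid.mulmC; congr (op _ (f _));
  last first.
  apply: eq_card => j; rewrite !inE; have [->|jk] := eqVneq j k; first by
    rewrite prec_irr andbF.
  by case: (boolP (j \in A)) => //= jA; rewrite hk.
rewrite -IHn; last by move: leA; rewrite cA.
apply: eq_bigr => i; rewrite !inE => /andP[ik iA]; congr f; apply: eq_card => j;
  rewrite !inE.
by have [->|//] := eqVneq j k; rewrite kA/= (precNsym (hk _ iA ik)).
Qed.

Lemma big_class (S : Type) (idx : S) (op : Monoid.com_law idx) (f : {set 'I_r}
  -> nat -> S) :
  \big[op/idx]_k f (cl k) #|Par k| =
  \big[op/idx]_(u in T E) \big[op/idx]_(j < #|u|) f u (#|anc E u| + j)%N.
Proof.
rewrite (eq_bigl (mem [set: 'I_r])); last by move=> i; rewrite /= in_setT.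
rewrite (set_partition_big _ T_partition)/=; apply: eq_bigr => u uT.
rewrite -(big_prec_rank op u (fun j : nat => f u (#|anc E u| + j)%N)).
by apply: eq_bigr => k ku; rewrite -(T_cl uT ku) card_Par -(T_cl uT ku).
Qed.

(** Splits the closed neighbourhood into k, its parents and its later neighbours; the latter are the
    vertices whose elimination raises the exponent of the pivot of k. *)
Lemma card_cnb k : #|cnb k| = (#|Par k| + #|[set i | k \in Par i]|).+1.
Proof.
rewrite (cardsD1 k (cnb k)) in_cnb rE add1n; congr S.
rewrite -cardsUI (_ : _ :&: _ = finset.set0) ?cards0 ?addn0; last first.
  apply/setP => j; rewrite !inE; apply/negP => /andP[/andP[_ h] /andP[_]].
  by rewrite (precNsym h).
apply: eq_card => j; rewrite in_setD1 in_cnb !inE (sE j k).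
have [->|jk] := eqVneq j k; first by rewrite prec_irr andbF.
by case: (E k j) => //=; rewrite prec_total.
Qed.

End HomogeneousGraph.

(** * Cliques and separators *)

Section Separators.
Import fintype boot.finset.
Local Open Scope set_scope.

Lemma has_take (X : Type) (p : pred X) k (s : seq X) : has p (take k s) -> has p
  s.
Proof. by rewrite -{2}(cat_take_drop k s) has_cat => ->. Qed.

(** Among the elements satisfying [p] exactly one, the first, has no predecessor satisfying [p].
    Index 0 can be left out of the count because nothing precedes it. *)
Lemma count_nth_take (X : eqType) (x0 : X) (p : pred X) (s : seq X) : has p s ->
  count p s =
  (count (fun k => p (nth x0 s k) && has p (take k s)) (iota 1 (size s).-1)).+1.
Proof.
elim/last_ind: s => // s x IHs; rewrite has_rcons size_rcons/=.
have tail (m : nat) : (m <= size s)%N ->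
  count (fun k => p (nth x0 (rcons s x) k) && has p (take k (rcons s x))) (iota
    1 m.-1) =
  count (fun k => p (nth x0 s k) && has p (take k s)) (iota 1 m.-1).
  move=> ms; apply: eq_in_count => k; rewrite mem_iota => /andP[k0 km].
  have ks : (k < size s)%N by lia.
  by rewrite nth_rcons ks -cats1 takel_cat// ltnW.
case: (posnP (size s)) => [/size0nil -> /=|s0]; first by rewrite orbF => ->.
have -> : iota 1 (size s) = rcons (iota 1 (size s).-1) (size s).
  by case: (size s) s0 => // n _; rewrite -{1}[n.+1]addn1 iotaD -cats1/= addnC
    addn1.
rewrite -!cats1 !count_cat !cats1 tail//= nth_rcons ltnn eqxx.
rewrite -cats1 take_size_cat// !addn0.
have [ps|nps] := boolP (has p s).
  by rewrite orbT => _; rewrite (IHs ps) andbT addSn.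
rewrite orbF andbF addn0 => px; rewrite px addn1; congr S.
have -> : count p s = 0%N by apply/eqP; rewrite -leqn0 leqNgt -has_count.
apply/esym/eqP; rewrite -leqn0 leqNgt -has_count; apply/hasPn => k _.
by apply/negP => /andP[_ /has_take]; apply/negP.
Qed.

Lemma sub_bigcup_seq (I : finType) (A : {set I}) (s : seq {set I}) :
  A \in s -> A \subset \bigcup_(B <- s) B.
Proof.
elim: s => // B s IHs; rewrite inE big_cons => /predU1P[->|/IHs As]; first
  exact: subsetUl.
by apply: subset_trans As _; exact: subsetUr.
Qed.

Variables (r : nat) (E : rel 'I_r) (Cs : seq {set 'I_r}).
Hypotheses (rE : reflexive E) (sE : symmetric E) (hE : homogeneous E).
Hypothesis pCs : perfect_order E Cs.
Implicit Types (i j k : 'I_r) (A B C S u v : {set 'I_r}).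

Lemma perfect_uniq : uniq Cs. Proof. by case: pCs. Qed.

Lemma mem_perfect C : (C \in Cs) = (C \in cliques E).
Proof. by case: pCs => _ h _; exact: h. Qed.

(** The perfect order puts the separator inside one earlier clique, which replaces the union in
    [sep] by a single intersection. *)
Lemma sepE (k : nat) : (0 < k < size Cs)%N ->
  exists2 l, (l < k)%N & sep Cs k = nth finset.set0 Cs l :&: nth finset.set0 Cs
    k.
Proof.
case: pCs => _ _ h ks; have [l lk sub] := h _ ks; exists l => //.
apply/eqP; rewrite eqEsubset; apply/andP; split.
  by rewrite subsetI sub subsetIr.
apply: setSI; rewrite -(nth_take _ lk).
have : nth finset.set0 (take k Cs) l \in take k Cs.
  by apply: mem_nth; rewrite size_takel//; case/andP: ks => _ /ltnW.
exact: sub_bigcup_seq.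
Qed.

Lemma sub_sep A (k : nat) : (0 < k < size Cs)%N -> (A \subset sep Cs k) =
  (A \subset nth finset.set0 Cs k) && has (fun C => A \subset C) (take k Cs).
Proof.
move=> ks; have [l lk E0] := sepE ks; apply/idP/andP.
  rewrite E0 subsetI => /andP[Al Ak]; split => //; apply/hasP.
  exists (nth finset.set0 Cs l) => //; rewrite -(nth_take _ lk); apply: mem_nth.
  by rewrite size_takel//; case/andP: ks => _ /ltnW.
move=> [Ak /hasP[C Ck AC]]; rewrite /sep subsetI Ak andbT.
by apply: subset_trans AC _; exact: sub_bigcup_seq.
Qed.

Lemma count_clique_sep A : complete E A ->
  count (fun C => A \subset C) Cs = (count (fun S => A \subset S) (separators
    Cs)).+1.
Proof.
move=> /complete_clique[C CE AC]; rewrite (count_nth_take finset.set0); last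
  first.
  by apply/hasP; exists C => //; rewrite mem_perfect.
congr S; rewrite /separators count_map; apply: eq_in_count => k; rewrite
  mem_iota => ks.
have {}ks : (0 < k < size Cs)%N by move: ks; case: (size Cs) => [|m] /=; lia.
by rewrite /= sub_sep.
Qed.

Lemma separators_cliques S : S \in separators Cs ->
  exists C D, [/\ C \in cliques E, D \in cliques E, C != D & S = C :&: D].
Proof.
move=> /mapP[k]; rewrite mem_iota => ks ->; have {}ks : (0 < k < size Cs)%N by
  lia.
have [l lk ->] := sepE ks; exists (nth finset.set0 Cs l), (nth finset.set0 Cs
  k).
have ls : (l < size Cs)%N by apply: ltn_trans lk _; case/andP: ks.
have ks' : (k < size Cs)%N by case/andP: ks.
rewrite -!mem_perfect !mem_nth// nth_uniq ?perfect_uniq//; split => //.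
by rewrite neq_ltn lk.
Qed.

Lemma separator_arrow_closed S : S \in separators Cs -> arrow_closed E S.
Proof.
move=> /separators_cliques[C [D [hC hD _ ->]]].
by apply: arrow_closedI; exact: clique_arrow_closed.
Qed.

Lemma separatorN_clique S : S \in separators Cs -> S \notin cliques E.
Proof.
move=> /separators_cliques[C [D [/cliqueP[cC mC] /cliqueP[cD mD] CD SCD]]].
apply/negP => /cliqueP[cS mS]; case/eqP: CD.
have EC : C = S by apply: mS => //; rewrite SCD subsetIl.
have ED : D = S by apply: mS => //; rewrite SCD subsetIr.
by rewrite EC ED.
Qed.

Lemma sum_min_separators (R : pzSemiRingType) (f : {set 'I_r} -> R) :
  \sum_(S in min_separators Cs) (nu Cs S)%:R * f S = \sum_(S <- separators Cs) f
    S.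
Proof.
rewrite /min_separators /nu; elim: (separators Cs) => [|S s IHs].
  by rewrite big_nil big1// => S; rewrite inE.
rewrite big_cons -IHs.
have ext (s' : seq {set 'I_r}) : \sum_(S' in [set S0 in s']) (count_mem S' s)%:R
  * f S' =
   \sum_(S' : {set 'I_r}) (if S' \in s' then (count_mem S' s)%:R * f S' else 0).
  by rewrite big_mkcond; apply: eq_bigr => S' _; rewrite inE.
have full (s' t : seq {set 'I_r}) : {subset t <= s'} ->
   \sum_(S' in [set S0 in s']) (count_mem S' t)%:R * f S' =
   \sum_(S' : {set 'I_r}) (count_mem S' t)%:R * f S'.
  move=> ts; rewrite big_mkcond; apply: eq_bigr => S' _; rewrite inE.
  case: ifPn => // S's; rewrite (_ : count_mem S' t = 0%N) ?mul0r//.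
  by apply/count_memPn; apply: contra S's; exact: ts.
rewrite full// full// (bigD1 S)//= [in RHS](bigD1 S)//= eqxx.
rewrite natrD mulrDl mul1r addrA; congr (_ + _).
by apply: eq_bigr => S' S'S; rewrite eq_sym (negbTE S'S).
Qed.

Lemma sum_cliques (R : pzSemiRingType) (f : {set 'I_r} -> R) :
  \sum_(C in cliques E) f C = \sum_(C <- Cs) f C.
Proof.
rewrite (big_uniq _ perfect_uniq)/=; apply: eq_bigl => C; by rewrite
  mem_perfect.
Qed.

(* Each clique of the perfect order that contains A, except the first one, has
   its separator containing A. *)
Lemma sum_clique_sep_complete (R : pzRingType) A : complete E A ->
  \sum_(C in cliques E) (A \subset C)%:R -
  \sum_(S in min_separators Cs) (nu Cs S)%:R * (A \subset S)%:R = 1 :> R.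
Proof.
move=> cA; rewrite sum_min_separators sum_cliques.
have toc (s : seq {set 'I_r}) : \sum_(S <- s) (A \subset S)%:R = (count (fun S
  => A \subset S) s)%:R :> R.
  by rewrite -sum1_count natr_sum [RHS]big_mkcond/=; apply: eq_bigr => S _;
    case: (A \subset S).
by rewrite !toc count_clique_sep// -addn1 natrD addrAC subrr add0r.
Qed.

(** If [E k j], this is the count for the complete set {k, j}; otherwise no clique or separator
    contains both vertices. *)
Lemma sum_clique_sep_pair (R : pzRingType) j k :
  \sum_(C in cliques E) (k \in C)%:R * (j \in C)%:R -
  \sum_(S in min_separators Cs) (nu Cs S)%:R * ((k \in S)%:R * (j \in S)%:R) =
    (E k j)%:R :> R.
Proof.
have sub2 A : [set k; j] \subset A = (k \in A) && (j \in A) by rewrite subUset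
  !sub1set.
have mulb A : (k \in A)%:R * (j \in A)%:R = ([set k; j] \subset A)%:R :> R.
  by rewrite sub2; case: (k \in A); rewrite ?mul1r ?mul0r.
under eq_bigr do rewrite mulb. under [X in _ - X]eq_bigr do rewrite mulb.
have [kj|nkj] := boolP (E k j).
  apply: sum_clique_sep_complete; apply/forall_inP => a; rewrite !inE =>
    /pred2P[]->;
  by apply/forall_inP => b; rewrite !inE => /pred2P[]->; rewrite // sE.
rewrite big1 => [|C /cliqueP[cC _]]; last first.
  rewrite sub2; case: (boolP (k \in C)) => //= kC; case: (boolP (j \in C)) =>
    //= jC.
  by rewrite (arrow_complete jC cC kC) in nkj.
rewrite big1 ?subrr// => S; rewrite inE =>
  /separator_arrow_closed/arrow_closedP[cS _].
rewrite sub2; case: (boolP (k \in S)) => //= kS; last by rewrite mulr0.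
case: (boolP (j \in S)) => //= jS; last by rewrite mulr0.
by rewrite (arrow_complete jS cS kS) in nkj.
Qed.

(** With |C| and |S| written as sums of indicators over j, each j contributes 1 if it is k or a
    neighbour of k, and 0 otherwise. *)
Lemma sum_clique_sep_card (R : pzRingType) k :
  \sum_(C in cliques E) (k \in C)%:R * #|C|%:R -
  \sum_(S in min_separators Cs) (nu Cs S)%:R * ((k \in S)%:R * #|S|%:R) = #|cnb
    E k|%:R :> R.
Proof.
have card A : #|A|%:R = \sum_j (j \in A)%:R :> R.
  by rewrite -sum1_card natr_sum big_mkcond/=; apply: eq_bigr => j _; case: (j
    \in A).
rewrite (card (cnb E k)).
under eq_bigr do rewrite card mulr_sumr.
under [X in _ - X]eq_bigr do rewrite card mulr_sumr mulr_sumr.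
rewrite exchange_big/= [X in _ - X]exchange_big/= -sumrB; apply: eq_bigr => j _.
by rewrite sum_clique_sep_pair in_cnb.
Qed.

(** The map u -> V_u matches endpoints with cliques, and cl k <= u means that k lies in V_u. On the
    other side, every listed separator containing k is V_q for a non-endpoint q above cl k, and a
    V_q that is not listed contributes 0 because its [nu] is 0. *)
Lemma rhoE (R : realType) (alpha beta : {set 'I_r} -> R) k :
  rho E Cs alpha beta (cl E k) =
  \sum_(C in cliques E) (k \in C)%:R * alpha C -
  \sum_(S in min_separators Cs) (nu Cs S)%:R * ((k \in S)%:R * beta S).
Proof.
rewrite /rho; congr (_ - _).
  transitivity (\sum_(C in Vset E @: [set t in T E | endpoint E t && tle E (cl E
    k) t]) alpha C).
    rewrite big_imset/=; first by apply: eq_bigl => t; rewrite inE.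
    by move=> t t'; rewrite !inE => /andP[tT _] /andP[tT' _]; exact: Vset_inj.
  rewrite big_mkcond [RHS]big_mkcond/=; apply: eq_bigr => C _.
  have -> : (C \in Vset E @: [set t in T E | endpoint E t && tle E (cl E k) t])
    =
      (C \in cliques E) && (k \in C).
    apply/imsetP/andP => [[t]|[CE kC]].
      rewrite inE => /and3P[/TP[i ->]]; rewrite endpoint_clique// tle_cl => Vi
        ki ->.
      by rewrite Vi in_Vset.
    have [|i iC Ci] := arrow_closed_Vset rE sE hE (clique_arrow_closed rE sE
      CE).
      by apply/set0Pn; exists k.
    exists (cl E i) => //; rewrite inE cl_T endpoint_clique// -Ci CE/= tle_cl.
    by rewrite -in_Vset -Ci.
  by case: (C \in cliques E); case: (k \in C); rewrite ?mul1r ?mul0r.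
pose Q := [set q in T E | ~~ endpoint E q && tle E (cl E k) q].
transitivity (\sum_(S in Vset E @: Q) (nu Cs S)%:R * beta S).
  rewrite big_imset/=; first by apply: eq_bigl => t; rewrite inE.
  by move=> t t'; rewrite !inE => /andP[tT _] /andP[tT' _]; exact: Vset_inj.
rewrite big_mkcond [RHS]big_mkcond/=; apply: eq_bigr => S _; rewrite inE.
case: (boolP (S \in separators Cs)) => SCs; last first.
  by rewrite /nu (count_memPn SCs) mul0r if_same.
case: ifPn => [/imsetP[q]|SQ].
  by rewrite inE => /and3P[/TP[i ->] _]; rewrite tle_cl -in_Vset => kS ->;
    rewrite kS mul1r.
case: (boolP (k \in S)) => kS; last by rewrite mul0r mulr0.
have [|i iS Si] := arrow_closed_Vset rE sE hE (separator_arrow_closed SCs).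
  by apply/set0Pn; exists k.
case/imsetP: SQ; exists (cl E i) => //; rewrite inE cl_T endpoint_clique// -Si.
by rewrite separatorN_clique//= tle_cl -in_Vset -Si.
Qed.

End Separators.

(** * Determinants and positivity of principal submatrices *)

Section Submatrices.
Import fintype boot.finset fingroup.perm.
Local Open Scope set_scope.
Variables (R : realType) (r : nat).
Implicit Types (x : 'M[R]_r) (A B : {set 'I_r}).

Lemma posdef_perm n (s : 'S_n) (x : 'M[R]_n) :
  posdef x -> posdef (\matrix_(i, j) x (s i) (s j)).
Proof.
case=> sx px; have -> : (\matrix_(i, j) x (s i) (s j)) = perm_mx s *m x *m
  (perm_mx s)^T.
  rewrite -row_permE tr_perm_mx -col_permE; by apply/matrixP => i j; rewrite
    !mxE.
split; first by rewrite !trmx_mul trmxK sx mulmxA.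
move=> v v0; have := px ((perm_mx s)^T *m v); rewrite trmx_mul trmxK !mulmxA;
  apply.
apply: contraNneq v0 => /(congr1 (mulmx (perm_mx s))).
by rewrite tr_perm_mx mulmxA -perm_mxM mulgV perm_mx1 mul1mx mulmx0 => ->.
Qed.

Lemma det_perm_conj n (s : 'S_n) (x : 'M[R]_n) :
  \det (\matrix_(i, j) x (s i) (s j)) = \det x.
Proof.
have -> : (\matrix_(i, j) x (s i) (s j)) = row_perm s (col_perm s x).
  by apply/matrixP => i j; rewrite !mxE.
rewrite row_permE col_permE !det_mulmx !det_perm odd_permV.
by rewrite mulrC -mulrA -signr_addb addbb mulr1.
Qed.

(** [submat] lists [A] in the order of [enum_val]; any other listing differs from it by a
    permutation, under which determinant and positivity are invariant. *)
Lemma submat_reindex n (f : 'I_n -> 'I_r) A x : injective f -> A =i codom f ->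
  \det (submat A A x) = \det (\matrix_(i < n, j < n) x (f i) (f j)) /\
  (posdef (submat A A x) <-> posdef (\matrix_(i < n, j < n) x (f i) (f j))).
Proof.
move=> fi Af; have fA a : f a \in A by rewrite Af codom_f.
have nA : n = #|A| by rewrite (eq_card Af) card_codom// card_ord.
pose g a := enum_rank_in (fA a) (f a).
have gE a : enum_val (g a) = f a by exact: enum_rankK_in.
have gi : injective g by move=> a b gab; apply: fi; rewrite -!gE gab.
clearbody g; have -> : (\matrix_(i < n, j < n) x (f i) (f j)) =
  \matrix_(i, j) submat A A x (g i) (g j).
  by apply/matrixP => i j; rewrite !mxE !gE.
move: (submat A A x) => y; move: g gi {gE}; clear fA Af; move: nA y; move: #|A|
  => m nm.
subst m => y g gi; pose s := perm gi.
have sE : (\matrix_(i, j) y (g i) (g j)) = \matrix_(i, j) y (s i) (s j).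
  by apply/matrixP => i j; rewrite !mxE !permE.
rewrite sE det_perm_conj; split=> //; split; first exact: posdef_perm.
move=> /(posdef_perm s^-1%g); congr (posdef _).
by apply/matrixP => i j; rewrite !mxE !permKV.
Qed.

Lemma submat_split m n (f1 : 'I_m -> 'I_r) (f2 : 'I_n -> 'I_r) A x :
  injective f1 -> injective f2 -> (forall a b, f1 a != f2 b) ->
  (forall i, (i \in A) = (i \in codom f1) || (i \in codom f2)) ->
  let M := block_mx (\matrix_(i, j) x (f1 i) (f1 j)) (\matrix_(i, j) x (f1 i)
    (f2 j))
    (\matrix_(i, j) x (f2 i) (f1 j)) (\matrix_(i, j) x (f2 i) (f2 j)) in
  \det (submat A A x) = \det M /\ (posdef (submat A A x) <-> posdef M).
Proof.
move=> f1i f2i f12 Af M.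
pose f i := match fintype.split i with inl a => f1 a | inr b => f2 b end.
have fl a : f (lshift n a) = f1 a by rewrite /f; case: split_ordP => b /eqP;
  rewrite ?eq_shift// => /eqP->.
have fr b : f (rshift m b) = f2 b by rewrite /f; case: split_ordP => a /eqP;
  rewrite ?eq_shift// => /eqP->.
have fi : injective f.
  move=> i j; case: (split_ordP i) => a ->; case: (split_ordP j) => b ->;
    rewrite ?fl ?fr.
  - by move/f1i->.
  - by move/eqP; rewrite (negbTE (f12 _ _)).
  - by move/eqP; rewrite eq_sym (negbTE (f12 _ _)).
  - by move/f2i->.
have Acod : A =i codom f.
  move=> i; rewrite Af; apply/orP/codomP => [[/codomP[a ->]|/codomP[b ->]]|[j
    ->]].
  - by exists (lshift n a); rewrite fl.
  - by exists (rshift m b); rewrite fr.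
  - by case: (split_ordP j) => a ->; rewrite ?fl ?fr codom_f; [left|right].
have <- : \matrix_(i, j) x (f i) (f j) = M; last exact: submat_reindex.
apply/matrixP => i j; rewrite mxE /M;
  case: (split_ordP i) => a ->; case: (split_ordP j) => b ->;
  by rewrite ?fl ?fr ?block_mxEul ?block_mxEur ?block_mxEdl ?block_mxEdr mxE.
Qed.

(** Rows of the identity matrix indexed by [A]: a submatrix becomes a product, and its quadratic
    form the restriction of that of x to vectors supported on [A]. *)
Definition sel A : 'M[R]_(#|A|, r) := \matrix_(a, i) (enum_val a == i)%:R.

Lemma mul_selE A n (x : 'M[R]_(r, n)) a j : (sel A *m x) a j = x (enum_val a) j.
Proof.
rewrite mxE (bigD1 (enum_val a))//= mxE eqxx mul1r big1 ?addr0// => i ia.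
by rewrite mxE eq_sym (negbTE ia) mul0r.
Qed.

Lemma mul_tr_selE A n (x : 'M[R]_(n, r)) a j : (x *m (sel A)^T) j a = x j
  (enum_val a).
Proof. by rewrite -[x]trmxK -trmx_mul mxE mul_selE mxE trmxK. Qed.

Lemma submatE A B x : submat A B x = sel A *m x *m (sel B)^T.
Proof. by apply/matrixP => a b; rewrite mul_tr_selE mul_selE mxE. Qed.

Lemma sel_trK A : sel A *m (sel A)^T = 1%:M.
Proof.
apply/matrixP => a b; rewrite mul_tr_selE !mxE; congr (_%:R).
by rewrite (inj_eq enum_val_inj).
Qed.

Lemma tr_selE A (w : 'cV[R]_#|A|) i (iA : i \in A) :
  ((sel A)^T *m w) i 0 = w (enum_rank_in iA i) 0.
Proof.
rewrite mxE (bigD1 (enum_rank_in iA i))//= !mxE enum_rankK_in// eqxx mul1r big1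
  ?addr0// => a ai.
rewrite !mxE; case: eqP => [E|]; last by rewrite mul0r.
by move: ai; rewrite -[a](enum_valK_in iA) E eqxx.
Qed.

Lemma tr_sel0 A (w : 'cV[R]_#|A|) i : i \notin A -> ((sel A)^T *m w) i 0 = 0.
Proof.
move=> iA; rewrite mxE big1// => a _; rewrite !mxE; case: eqP => [E|]; last by
  rewrite mul0r.
by rewrite -E enum_valP in iA.
Qed.

Lemma sel_supported A (v : 'cV[R]_r) : (forall i, i \notin A -> v i 0 = 0) ->
  (sel A)^T *m (sel A *m v) = v.
Proof.
move=> v0; apply/matrixP => i j; rewrite ord1; have [iA|iA] := boolP (i \in A).
  by rewrite (tr_selE _ iA) mul_selE enum_rankK_in.
by rewrite tr_sel0// v0.
Qed.

Lemma qf_submat A x w : qf (submat A A x) w = qf x ((sel A)^T *m w).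
Proof. by rewrite /qf submatE trmx_mul trmxK !mulmxA. Qed.

Lemma tr_sel_inj A (w : 'cV[R]_#|A|) : (sel A)^T *m w = 0 -> w = 0.
Proof. by move=> /(congr1 (mulmx (sel A))); rewrite mulmxA sel_trK mul1mx
  mulmx0. Qed.

Lemma submat_sym A x : x^T = x -> (submat A A x)^T = submat A A x.
Proof. by move=> sx; rewrite submatE !trmx_mul trmxK sx mulmxA. Qed.

Lemma posdef_submat_sub A B x : x^T = x -> B \subset A ->
  posdef (submat A A x) -> posdef (submat B B x).
Proof.
move=> sx BA pA; split; first exact: submat_sym.
move=> w w0; have sv : (sel A)^T *m (sel A *m ((sel B)^T *m w)) = (sel B)^T *m
  w.
  by apply: sel_supported => i iA; rewrite tr_sel0//; apply: contra iA; exact: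
    subsetP.
rewrite -/(qf _ _) qf_submat -sv -qf_submat; apply: qf_gt0 => //.
by apply: contraNneq w0 => E0; apply/eqP; apply: tr_sel_inj; rewrite -sv E0
  mulmx0.
Qed.

Lemma posdef_submat A x : posdef x -> posdef (submat A A x).
Proof.
move=> px; have [sx _] := px; split; first exact: submat_sym.
move=> w w0; rewrite -/(qf _ _) qf_submat; apply: qf_gt0 => //.
by apply: contraNneq w0 => /tr_sel_inj ->.
Qed.

End Submatrices.

(** * Pivots *)

Section Elimination.
Import fintype boot.finset.
Local Open Scope set_scope.
Variables (R : realType) (r : nat) (E : rel 'I_r).
Implicit Types (x : 'M[R]_r) (i j k : 'I_r) (A : {set 'I_r}).

Definition parent_row k x : 'rV[R]_#|Par E k| := \row_b x k (enum_val b).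
Definition parent_block k x : 'M[R]_#|Par E k| := submat (Par E k) (Par E k) x.
Definition pivot k x : R :=
  x k k - (parent_row k x *m invmx (parent_block k x) *m (parent_row k x)^T) 0
    0.
Definition regr k x : 'cV[R]_#|Par E k| := invmx (parent_block k x) *m
  (parent_row k x)^T.
(** Supported on [fam E k] with entry 1 at k, which makes [elim_mx] unitriangular for [prec]. *)
Definition elim_vec k x : 'cV[R]_r := delta_mx k 0 - (sel R (Par E k))^T *m regr
  k x.
Definition elim_mx x : 'M[R]_r := \matrix_(k, i) elim_vec k x i 0.

Lemma pivot_local k x x' :
  {in fam E k &, forall i j, x i j = x' i j} ->
  [/\ parent_row k x = parent_row k x', parent_block k x = parent_block k x',
     pivot k x = pivot k x' & regr k x = regr k x'].
Proof.
move=> xx'; have kk : k \in fam E k by rewrite setU11.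
have Pf (b : 'I_#|Par E k|) : enum_val b \in fam E k by rewrite setU1r//
  enum_valP.
have e1 : parent_row k x = parent_row k x' by apply/rowP => b; rewrite !mxE xx'.
have e2 : parent_block k x = parent_block k x'.
  by apply/matrixP => a b; rewrite !mxE xx'.
by rewrite /regr /pivot e1 e2 xx'.
Qed.

Definition fam_block k x : 'M[R]_(1 + #|Par E k|) :=
  block_mx (x k k)%:M (parent_row k x) (parent_row k x)^T (parent_block k x).

Lemma submat_fam k x : x^T = x ->
  \det (submat (fam E k) (fam E k) x) = \det (fam_block k x) /\
  (posdef (submat (fam E k) (fam E k) x) <-> posdef (fam_block k x)).
Proof.
move=> sx; have := @submat_split _ _ 1 _ (fun=> k) (fun b : 'I_#|Par E k| =>
  enum_val b) (fam E k) x.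
have -> : block_mx (\matrix_(i, j) x k k) (\matrix_(i, j) x k (enum_val j))
   (\matrix_(i, j) x (enum_val i) k) (\matrix_(i, j) x (enum_val i) (enum_val
     j)) = fam_block k x.
  rewrite /fam_block; congr block_mx; apply/matrixP => a b; rewrite !mxE//.
    by rewrite !ord1 eqxx.
  by rewrite -[in LHS]sx mxE.
apply.
- by move=> a b _; rewrite !ord1.
- exact: enum_val_inj.
- by move=> _ b; apply: contraTneq (enum_valP b) => <-; exact: Par_irr.
- move=> i; rewrite in_setU1; congr (_ || _).
    by apply/eqP/codomP => [->|[_ ->]//]; exists 0.
  apply/idP/codomP => [iP|[b ->]]; last exact: enum_valP.
  by exists (enum_rank_in iP i); rewrite enum_rankK_in.
Qed.

Lemma parent_block_sym k x : x^T = x -> (parent_block k x)^T = parent_block k x.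
Proof. exact: submat_sym. Qed.

Lemma pivotE k x : pivot k x =
  ((x k k)%:M - parent_row k x *m invmx (parent_block k x) *m (parent_row k
    x)^T) 0 0.
Proof. by rewrite /pivot [RHS]mxE [_%:M 0 0]mxE eqxx mulr1n; congr (_ + _);
  rewrite [RHS]mxE. Qed.

Lemma det_submat_fam k x : x^T = x -> parent_block k x \in unitmx ->
  \det (submat (fam E k) (fam E k) x) = pivot k x * \det (parent_block k x).
Proof.
move=> sx up; rewrite (submat_fam k sx).1 /fam_block det_block_schur// pivotE.
by rewrite det_mx11.
Qed.

Lemma posdef_submat_fam k x : x^T = x -> 
  posdef (submat (fam E k) (fam E k) x) <-> posdef (parent_block k x) /\ 0 <
    pivot k x.
Proof.
move=> sx; rewrite (submat_fam k sx).2 /fam_block; split=> [pf|[pp d0]].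
  split; first exact: posdef_dr pf.
  rewrite pivotE -det_mx11; exact/posdef_det_gt0/posdef_block_schur.
have [sp _] := pp; have up := posdef_unitmx pp; split.
  by rewrite tr_block_mx trmxK sp tr_scalar_mx.
move=> v v0; rewrite -/(qf _ _) -[v]vsubmxK; move: v0; rewrite -[v]vsubmxK
  col_mx_eq0 negb_and.
move: (usubmx v) (dsubmx v) => a w aw0; rewrite !col_mxKu !col_mxKd in aw0 *.
rewrite qf_block//; set s := _ - _.
have -> : qf s a = pivot k x * a 0 0 ^+ 2.
  rewrite pivotE -/s /qf [s]mx11_scalar [a in LHS]mx11_scalar tr_scalar_mx
    mul_scalar_mx mul_mx_scalar.
  by rewrite !mxE eqxx mulr1n expr2; ring.
have [a0|a0] := eqVneq a 0.
  by rewrite a0 mulmx0 addr0 mxE expr0n mulr0 add0r; apply: qf_gt0 => //;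
    rewrite a0 eqxx in aw0.
apply: ltr_pwDl; last exact: qf_ge0.
rewrite mulr_gt0// exprn_even_gt0//=; apply: contraNneq a0 => a00.
by rewrite [a]mx11_scalar a00 raddf0.
Qed.

Lemma elim_vec_diag k x : elim_vec k x k 0 = 1.
Proof. by rewrite /elim_vec 2!mxE !eqxx mxE tr_sel0 ?subr0// Par_irr. Qed.

Lemma elim_vec_support k x i : i \notin fam E k -> elim_vec k x i 0 = 0.
Proof.
rewrite !inE negb_or => /andP[ik iP]; rewrite 2!mxE (negbTE ik)/= mxE tr_sel0
  ?subr0//.
by rewrite in_Par.
Qed.

(* Completing the square in the entries x_kj, j in Par k. *)
Lemma qf_elim_vec k x y : x^T = x -> parent_block k x \in unitmx ->
  qf x (elim_vec k y) = pivot k x + qf (parent_block k x) (regr k x - regr k y).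
Proof.
move=> sx up; rewrite /elim_vec; set w := regr k y.
have := @qf_block _ 1 _ (x k k)%:M (parent_row k x) (parent_block k x) 1%:M (-
  w) up (parent_block_sym k sx).
have -> : - w + invmx (parent_block k x) *m (parent_row k x)^T *m 1%:M = regr k
  x - w.
  by rewrite mulmx1 addrC.
have -> (A : 'M[R]_1) : qf A 1%:M = A 0 0 by rewrite /qf trmx1 mul1mx mulmx1.
rewrite -pivotE => <-; rewrite /qf -/(fam_block _ _).
pose S := col_mx (delta_mx 0 k : 'rV_r) (sel R (Par E k)).
have -> : delta_mx k 0 - (sel R (Par E k))^T *m w = S^T *m col_mx 1%:M (- w).
  by rewrite /S tr_col_mx mul_row_col mulmx1 trmx_delta mulmxN.
suff -> : fam_block k x = S *m x *m S^T by rewrite trmx_mul trmxK !mulmxA.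
rewrite /S tr_col_mx mul_col_mx mul_col_row /fam_block; congr block_mx.
- by rewrite trmx_delta -colE -rowE [RHS]mx11_scalar !mxE.
- by apply/rowP => b; rewrite mul_tr_selE -rowE !mxE.
- by apply/colP => b; rewrite trmx_delta -colE [RHS]mxE mul_selE 2![LHS]mxE
  -{1}sx mxE.
- by rewrite /parent_block submatE.
Qed.

(** The normal equations of the regression of k on its parents. For j in [fam E k] only entries of x
    inside [fam E k] enter, and an incomplete matrix has them all. *)
Lemma mul_elim_mx x k j : x^T = x -> parent_block k x \in unitmx -> j \in fam E
  k ->
  (elim_mx x *m x) k j = if j == k then pivot k x else 0.
Proof.
move=> sx up jf.
have -> : (elim_mx x *m x) k j = (x *m elim_vec k x) j 0.
  rewrite !mxE; apply: eq_bigr => i _; rewrite [elim_mx _ _ _]mxE mulrC -{1}sx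
    mxE.
  by [].
have xw i : (x *m ((sel R (Par E k))^T *m regr k x)) i 0 =
    \sum_(b < #|Par E k|) x i (enum_val b) * regr k x b 0.
  by rewrite mulmxA mxE; apply: eq_bigr => b _; rewrite mul_tr_selE.
rewrite /elim_vec mulmxBr -colE mxE [X in _ + X]mxE xw [X in X - _]mxE.
case: eqP => [->|/eqP jk].
  rewrite /pivot -mulmxA -/(regr k x) [X in _ = _ - X]mxE; congr (_ - _).
  by apply: eq_bigr => b _; rewrite [parent_row _ _ _ _]mxE.
have jP : j \in Par E k by move: jf; rewrite in_setU1 (negbTE jk).
have -> : \sum_(b < #|Par E k|) x j (enum_val b) * regr k x b 0 =
    (parent_block k x *m regr k x) (enum_rank_in jP j) 0.
  by rewrite mxE; apply: eq_bigr => b _; rewrite /parent_block [submat _ _ _ _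
    _]mxE enum_rankK_in.
by rewrite /regr mulKVmx// !mxE enum_rankK_in// -{1}sx mxE subrr.
Qed.

Section InitialBlocks.
Hypotheses (rE : reflexive E) (sE : symmetric E) (hE : homogeneous E).

(** For A = fam k the pivot of k is the Schur complement of x_P in x_A, so both claims pass from P =
    Par k to A. *)
Lemma initial_block x A : x^T = x -> initial E A ->
  (forall k, k \in A -> 0 < pivot k x) ->
  posdef (submat A A x) /\ \det (submat A A x) = \prod_(k in A) pivot k x.
Proof.
move=> sx iA; move: A iA; apply: (initial_ind rE sE hE) => [_|k IHk pk].
  have empty n (M : 'M[R]_n) : n = 0%N -> posdef M /\ \det M = 1.
    move=> n0; subst n; split; last exact: det_mx00.
    by split=> [|v]; [apply/matrixP => -[]|rewrite [v]flatmx0 eqxx].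
  by rewrite big_set0; apply: empty; exact: cards0.
have [pP dP] := IHk (fun j jP => pk j (setU1r _ jP)).
split; first by apply/posdef_submat_fam => //; split => //; apply: pk; rewrite
  setU11.
rewrite det_submat_fam// ?posdef_unitmx// /parent_block dP.
by rewrite /fam big_setU1 ?Par_irr.
Qed.

Lemma posdef_parent_block x k : x^T = x -> (forall k, 0 < pivot k x) ->
  posdef (parent_block k x).
Proof. by move=> sx px; have [] := initial_block sx (initial_Par rE sE hE k)
  (fun k _ => px k). Qed.

(** Each [fam E k] is complete, hence inside a clique, which makes the pivots positive; conversely
    cliques are initial sets. *)
Lemma QG_pivot x : QG E x <-> IG E x /\ forall k, 0 < pivot k x.
Proof.
split=> [[Ix pC]|[Ix px]]; split => //; have [sx _] := Ix.
  move=> k; have [C CE fC] := complete_clique (complete_fam rE sE hE k).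
  by have /(posdef_submat_fam k sx)[] := posdef_submat_sub sx fC (pC _ CE).
move=> C CE; have [] // := initial_block sx _ (fun k _ => px k) (A := C).
exact/arrow_closed_initial/clique_arrow_closed.
Qed.

Lemma prec_ind (P : 'I_r -> Prop) :
  (forall k, (forall j, prec E j k -> P j) -> P k) -> forall k, P k.
Proof.
move=> Pk k; have [n len] := ubnP #|[set j | prec E j k]|; elim: n k len => // n
  IHn k len.
apply: Pk => j jk; apply: IHn; rewrite -ltnS; apply: leq_trans len; rewrite
  ltnS.
apply: proper_card; apply/properP; split.
  by apply/subsetP => i; rewrite !inE => ij; exact: prec_trans jk.
by exists j; rewrite inE ?prec_irr.
Qed.

(** By unitriangularity, the entries of a kernel vector vanish one after another along [prec]. *)
Lemma elim_mx_unit x : elim_mx x \in unitmx.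
Proof.
rewrite -unitmx_tr -row_free_unit -kermx_eq0; apply/eqP/row_matrixP => l;
  rewrite row0.
set v := row l _; have vM : v *m (elim_mx x)^T = 0 by rewrite /v -row_mul
  mulmx_ker row0.
clearbody v; apply/rowP => k; rewrite [RHS]mxE; move: k; apply: prec_ind => k
  IHk.
move/rowP: vM => /(_ k); rewrite [LHS]mxE [RHS]mxE (bigD1 k)//= [(elim_mx x)^T _
  _]mxE [elim_mx x _ _]mxE elim_vec_diag mulr1.
rewrite big1 ?addr0// => i ik; rewrite [(elim_mx x)^T _ _]mxE [elim_mx x _
  _]mxE.
have [iP|iP] := boolP (i \in Par E k); last first.
  by rewrite elim_vec_support ?mulr0// !inE negb_or ik -in_Par.
by rewrite IHk ?mul0r//; move: iP; rewrite in_Par => /andP[].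
Qed.

(** The candidate for the inverse of the completion, written down from the pivots and regression
    vectors of x alone. *)
Definition inv_completion x : 'M[R]_r :=
  (elim_mx x)^T *m diag_mx (\row_k (pivot k x)^-1) *m elim_mx x.

Lemma inv_completion_sym x : (inv_completion x)^T = inv_completion x.
Proof. by rewrite /inv_completion !trmx_mul trmxK tr_diag_mx mulmxA. Qed.

Lemma inv_completionE x i j : inv_completion x i j =
  \sum_k elim_vec k x i 0 * (pivot k x)^-1 * elim_vec k x j 0.
Proof.
rewrite /inv_completion mxE; apply: eq_bigr => k _.
by rewrite mul_mx_diag mxE [(elim_mx x)^T _ _]mxE ![elim_mx x _ _]mxE [(\row_ _
  _) _ _]mxE.
Qed.

Lemma inv_completion_PG x : (forall k, 0 < pivot k x) -> PG E (inv_completion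
  x).
Proof.
move=> px; split; first split; first exact: inv_completion_sym.
  move=> i j nij; rewrite inv_completionE big1// => k _.
  (* A term is nonzero only if i and j both lie in [fam E k], which is complete. *)
  have [ik|ik] := boolP (i \in fam E k); last by rewrite elim_vec_support//
    !mul0r.
  have [jk|jk] := boolP (j \in fam E k); last by rewrite (elim_vec_support _ jk)
    mulr0.
  by rewrite (arrow_complete jk (complete_fam rE sE hE k) ik) in nij.
split; first exact: inv_completion_sym.
move=> v v0; set w := elim_mx x *m v.
have w0 : w != 0.
  apply: contraNneq v0 => /(congr1 (mulmx (invmx (elim_mx x)))).
  by rewrite mulKmx ?elim_mx_unit// mulmx0 => ->.
have -> : (v^T *m inv_completion x *m v) 0 0 = \sum_k (pivot k x)^-1 * w k 0 ^+
  2.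
  rewrite /inv_completion !mulmxA -trmx_mul -mulmxA -/w mxE; apply: eq_bigr => k
    _.
  by rewrite mul_mx_diag !mxE expr2; ring.
rewrite lt_neqAle sumr_ge0 ?andbT => [|k _]; last by rewrite mulr_ge0 ?invr_ge0
  ?sqr_ge0 ?ltW.
rewrite eq_sym; apply: contraNneq w0 => /eqP.
rewrite psumr_eq0 => [/allP h|k _]; last by rewrite mulr_ge0 ?invr_ge0 ?sqr_ge0
  ?ltW.
apply/eqP/colP => k; rewrite [RHS]mxE; apply/eqP.
by have := h k (mem_index_enum k); rewrite /= mulf_eq0 invr_eq0 gt_eqF//=
  sqrf_eq0.
Qed.

(** With z the inverse, M z M^T is the diagonal matrix of the pivots, so M z is triangular and its
    row k agrees with that of M x on [fam E k]. These equations determine the entries of z on the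
    edges, vertex by vertex. *)
Lemma inv_completionK x i j : x^T = x -> (forall k, 0 < pivot k x) -> E i j ->
  invmx (inv_completion x) i j = x i j.
Proof.
move=> sx px; set z := invmx _; set M := elim_mx x.
have uY : inv_completion x \in unitmx by apply: posdef_unitmx; case:
  (inv_completion_PG px).
have sz : z^T = z by rewrite /z trmx_inv inv_completion_sym.
pose D : 'M[R]_r := diag_mx (\row_k pivot k x).
have DD : D *m diag_mx (\row_k (pivot k x)^-1) = 1%:M.
  rewrite mulmx_diag; apply/matrixP => a b; rewrite !mxE; case: eqP => //= _.
  by rewrite divff// gt_eqF.
have MzM : M *m z *m M^T = D.
  have e : (M^T *m diag_mx (\row_k (pivot k x)^-1)) *m (M *m z) = 1%:M.
    by rewrite mulmxA mulmxV.
  have := mulmx1C e; rewrite mulmxA => /(congr1 (mulmx^~ D)); rewrite mul1mx =>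
    <-.
  by rewrite -(mulmxA _ _ D) (mulmx1C DD) mulmx1.
have Nrec k l : (M *m z) k l + \sum_(a in Par E l) (M *m z) k a * elim_vec l x a
  0 =
    D k l.
  rewrite -MzM [RHS]mxE [in RHS](bigD1 l)//= [M^T _ _]mxE [M _ _]mxE
    elim_vec_diag mulr1; congr (_ + _).
  rewrite [RHS](bigID (mem (Par E l)))/= [X in _ = _ + X]big1 ?addr0; last
    first.
    move=> a /andP[al aP]; rewrite [M^T _ _]mxE [M _ _]mxE elim_vec_support
      ?mulr0//.
    by rewrite !inE negb_or al -in_Par.
  apply: eq_big => a; last by move=> _; rewrite [M^T _ _]mxE [M _ _]mxE.
  by case: eqVneq => [->|]; rewrite ?(negbTE (Par_irr E l))// andbT.
(* Since M z = D M^-T, row k of M z vanishes at the vertices before k. *)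
have Nlow k : forall l, prec E l k -> (M *m z) k l = 0.
  apply: prec_ind => l IHl lk; have := Nrec k l; rewrite big1 ?addr0 => [->|a].
    by rewrite /D !mxE; case: eqP lk => [->|_]; rewrite ?prec_irr.
  rewrite in_Par => /andP[_ al]; rewrite IHl ?mul0r//; exact: prec_trans lk.
have Nk k l : l \in fam E k -> (M *m z) k l = (M *m x) k l.
  have pk := posdef_parent_block k sx px.
  move=> lf; rewrite mul_elim_mx ?posdef_unitmx//; case: eqP lf => [-> _|/eqP
    lk].
    have := Nrec k k; rewrite big1 ?addr0 => [->|a]; first by rewrite /D !mxE
      eqxx mulr1n.
    by rewrite in_Par => /andP[_ al]; rewrite Nlow ?mul0r.
  by rewrite in_setU1 (negbTE lk) in_Par => /andP[_ /Nlow].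
have expand k l (y : 'M[R]_r) : (M *m y) k l =
    y k l + \sum_(a in Par E k) elim_vec k x a 0 * y a l.
  rewrite [LHS]mxE (bigD1 k)//= [M _ _]mxE elim_vec_diag mul1r; congr (_ + _).
  rewrite (bigID (mem (Par E k)))/= [X in _ + X = _]big1 ?addr0; last first.
    move=> a /andP[al aP]; rewrite [M _ _]mxE elim_vec_support ?mul0r//.
    by rewrite !inE negb_or al -in_Par.
  apply: eq_big => a; last by move=> _; rewrite [M _ _]mxE.
  by case: eqVneq => [->|]; rewrite ?(negbTE (Par_irr E k))// andbT.
(* Row k of M expresses z_kl through the z_al with a in Par k. Entries between two parents are known
   by induction, which yields z_kl for parents l; the diagonal entry then follows by symmetry. *)
have main k : forall l, l \in fam E k -> z k l = x k l.
  move: k; apply: prec_ind => k IHk.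
  have step l : l \in fam E k -> {in Par E k, forall a, z a l = x a l} -> z k l
    = x k l.
    move=> lf al; have := Nk _ _ lf; rewrite !expand => /eqP.
    rewrite (eq_bigr (fun a => elim_vec k x a 0 * x a l)); last by move=> a aP;
      rewrite al.
    by move=> /eqP/addIr.
  have zP l : l \in Par E k -> z k l = x k l.
    move=> lP; apply: step; first by rewrite setU1r.
    move=> a aP; have eal : E a l.
      by apply: (arrow_complete (A := fam E k)) => //; rewrite ?setU1r//; exact:
        complete_fam.
    move: lP aP; rewrite !in_Par => /andP[_ lk] /andP[_ ak].
    have [->|al] := eqVneq a l; first by apply: IHk => //; rewrite setU11.
    have [al'|la] := orP (prec_total E al).
      by rewrite -[z]sz -[x]sx mxE [RHS]mxE; apply: IHk => //; rewrite setU1r//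
        in_Par eal.
    by apply: IHk => //; rewrite setU1r// in_Par sE eal.
  move=> l lf; move: (lf); rewrite in_setU1 => /predU1P[->|/zP//].
  apply: step; first by rewrite setU11.
  by move=> a aP; rewrite -[z]sz -[x]sx mxE [RHS]mxE zP.
move=> ij; have [->|nij] := eqVneq i j; first by apply: main; rewrite setU11.
have [pij|pji] := orP (prec_total E nij).
  by rewrite -[z]sz -[x]sx mxE [RHS]mxE; apply: main; rewrite setU1r// in_Par
    ij.
by apply: main; rewrite setU1r// in_Par sE ij.
Qed.

End InitialBlocks.

End Elimination.

(** * Completions *)

Section Completion.
Import fintype boot.finset.
Local Open Scope set_scope.
Variables (R : realType) (r : nat) (E : rel 'I_r).
Hypotheses (rE : reflexive E) (sE : symmetric E) (hE : homogeneous E).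
Implicit Types (x y z sigma : 'M[R]_r) (i j k : 'I_r) (A : {set 'I_r}).

Lemma QG_sym sigma : QG E sigma -> sigma^T = sigma. Proof. by case=> -[]. Qed.

Lemma QG_pivot_gt0 sigma k : QG E sigma -> 0 < pivot E k sigma.
Proof. by move=> /(QG_pivot rE sE hE)[_]. Qed.

Lemma inv_completion_unit sigma : QG E sigma -> inv_completion E sigma \in
  unitmx.
Proof.
move=> Qs; apply: posdef_unitmx.
by have [] := inv_completion_PG rE sE hE (fun k => QG_pivot_gt0 k Qs).
Qed.

Lemma completion_inv_completion sigma : QG E sigma ->
  completion E sigma (invmx (inv_completion E sigma)).
Proof.
move=> Qs; have ps k := QG_pivot_gt0 k Qs; have PY := inv_completion_PG rE sE hE
  ps.
split; [|by move=> i j ij; exact: inv_completionK (QG_sym Qs) ps ij|by rewrite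
  invmxK].
by apply: posdef_inv; case: PY.
Qed.

(* Two completions z, z' satisfy tr((z - z') (z^-1 - z'^-1)) = 0, whereas this
   trace is minus the trace of (z - z') z^-1 (z - z') z'^-1. *)
Lemma completion_unique sigma z : QG E sigma -> completion E sigma z ->
  z = invmx (inv_completion E sigma).
Proof.
move=> Qs [pz zs [[_ zG] py]]; set Y := inv_completion E sigma; set z' := invmx
  Y.
have ps k := QG_pivot_gt0 k Qs.
have [_ z's _] := completion_inv_completion Qs.
have [[_ YG] _] := inv_completion_PG rE sE hE ps.
have uY := inv_completion_unit Qs; have uz := posdef_unitmx pz; have [sz _] :=
  pz.
have sz' : z'^T = z' by rewrite /z' trmx_inv inv_completion_sym.
set y := invmx z in zG py *; set D := z - z'.
have sD : D^T = D by rewrite /D linearB/= sz sz'.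
have yY : y - Y = - (y *m D *m Y).
  by rewrite /D mulmxBr mulmxBl mulVmx// mul1mx -mulmxA mulVmx// mulmx1 opprB.
have tr0 : \tr (D *m (y - Y)) = 0.
  rewrite /mxtrace big1// => i _; rewrite mxE big1// => j _.
  have [ij|ij] := boolP (E i j).
    by rewrite mxE [X in _ + X]mxE zs// z's// subrr mul0r.
  by rewrite [(y - Y) _ _]mxE [(- Y) _ _]mxE zG ?YG ?subrr ?mulr0// sE.
pose W := elim_mx E sigma *m D.
have tW : \tr (D *m (y *m D *m Y)) = \sum_k qf y (row k W)^T * (pivot E k
  sigma)^-1.
  rewrite /Y /inv_completion !mulmxA mxtrace_mulC !mulmxA.
  rewrite -(mulmxA _ D) -{2}sD -trmx_mul -/W.
  rewrite /mxtrace; apply: eq_bigr => k _; rewrite mul_mx_diag mxE [(\row_ _ _)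
    _ _]mxE; congr (_ * _).
  rewrite /qf trmxK -row_mul mxE [RHS]mxE; apply: eq_bigr => j _.
  by rewrite [row k (W *m y) _ _]mxE [W^T _ _]mxE [(row k W)^T _ _]mxE [row k W
    _ _]mxE.
have W0 : W = 0.
  apply/row_matrixP => k; rewrite row0; apply/eqP/negPn/negP => Wk.
  have := tr0; rewrite yY mulmxN linearN/= tW => /eqP; rewrite oppr_eq0
    psumr_eq0; last first.
    by move=> l _; rewrite mulr_ge0 ?qf_ge0// invr_ge0 ltW.
  move=> /allP/(_ k (mem_index_enum k)); rewrite /= mulf_eq0 invr_eq0 (gt_eqF
    (ps k)) orbF.
  rewrite gt_eqF// qf_gt0//; apply: contraNneq Wk => e.
  by rewrite -[row _ _]trmxK e trmx0.
apply/eqP; rewrite -subr_eq0 -/D; apply/eqP.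
by rewrite -[D](mulKmx (elim_mx_unit E sigma)) -/W W0 mulmx0.
Qed.

Lemma hatE sigma : QG E sigma -> hat E sigma = invmx (inv_completion E sigma).
Proof.
move=> Qs; apply: completion_unique => //; apply: xgetPex.
by exists (invmx (inv_completion E sigma)); exact: completion_inv_completion.
Qed.

Lemma inv_hat sigma : QG E sigma -> invmx (hat E sigma) = inv_completion E
  sigma.
Proof. by move=> Qs; rewrite hatE// invmxK. Qed.

Lemma inv_completion_inj sigma tau : QG E sigma -> QG E tau ->
  inv_completion E sigma = inv_completion E tau -> sigma = tau.
Proof.
move=> Qs Qt st; apply/matrixP => i j; have [ij|ij] := boolP (E i j).
  have [_ hs _] := completion_inv_completion Qs.
  have [_ ht _] := completion_inv_completion Qt.
  by rewrite -(hs _ _ ij) st (ht _ _ ij).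
by case: Qs => -[_ ->//] _; case: Qt => -[_ ->].
Qed.

Lemma phiE sigma : QG E sigma -> phi E (inv_completion E sigma) = sigma.
Proof.
move=> Qs; have [Qp] : QG E (phi E (inv_completion E sigma)) /\
    invmx (hat E (phi E (inv_completion E sigma))) = inv_completion E sigma.
  apply: (@xgetPex _ _ [set x | QG E x /\ invmx (hat E x) = inv_completion E
    sigma]%classic).
  by exists sigma; split => //; exact: inv_hat.
by rewrite inv_hat// => /inv_completion_inj; exact.
Qed.

(** Take for sigma the matrix y^-1 cut down to the edges: then y^-1 is a completion of sigma, hence
    the one built from the pivots of sigma. *)
Lemma PG_inv_completion y : PG E y -> exists2 sigma, QG E sigma & y =
  inv_completion E sigma.
Proof.
move=> [[sy yG] py]; set z := invmx y; have pz : posdef z := posdef_inv py.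
have [sz _] := pz.
pose sigma : 'M[R]_r := \matrix_(i, j) if E i j then z i j else 0.
have Qs : QG E sigma.
  split; first split.
  - by apply/matrixP => i j; rewrite !mxE sE; case: ifP => // _; rewrite -[in
    LHS]sz mxE.
  - by move=> i j nij; rewrite mxE (negbTE nij).
  move=> C /cliqueP[cC _]; have -> : submat C C sigma = submat C C z.
    apply/matrixP => a b; rewrite !mxE (arrow_complete _ cC)//; exact:
      enum_valP.
  exact: posdef_submat.
exists sigma => //; have e : z = invmx (inv_completion E sigma).
  apply: completion_unique => //; split=> //; last by rewrite /z invmxK.
  by move=> i j ij; rewrite mxE ij.
by rewrite -[y]invmxK -/z e invmxK.
Qed.

(** As x vanishes off the edges, the pairing is a full trace, and [inv_completion] is the sum of the
    rank-one matrices w_k w_k^T divided by the pivots. *)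
Lemma pairing_inv_completion x sigma : IG E x ->
  pairing E x (inv_completion E sigma) =
  \sum_k (pivot E k sigma)^-1 * qf x (elim_vec E k sigma).
Proof.
move=> [sx xG]; rewrite /pairing big_mkcond/=.
transitivity (\sum_(p : 'I_r * 'I_r) x p.1 p.2 * inv_completion E sigma p.1
  p.2).
  by apply: eq_bigr => p _; case: ifPn => // np; rewrite xG// mul0r.
rewrite -(pair_bigA _ (fun i j => x i j * inv_completion E sigma i j))/=.
under eq_bigr do under eq_bigr do rewrite inv_completionE mulr_sumr.
under eq_bigr do rewrite exchange_big/=.
rewrite exchange_big/=; apply: eq_bigr => k _.
rewrite /qf mxE mulr_sumr exchange_big/=; apply: eq_bigr => j _.
rewrite [((elim_vec E k sigma)^T *m x) _ _]mxE mulr_suml mulr_sumr; apply: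
  eq_bigr => i _.
by rewrite [(elim_vec _ _ _)^T _ _]mxE; ring.
Qed.

End Completion.

(** * Powers of determinants as powers of pivots *)

Lemma powR_prodr (R : realType) (I : finType) (P : pred I) (f : I -> R) (a : R)
  :
  (forall i, P i -> 0 < f i) -> (\prod_(i | P i) f i) `^ a = \prod_(i | P i) f i
    `^ a.
Proof.
move=> f0; have [] // : 0 < \prod_(i | P i) f i /\
   (\prod_(i | P i) f i) `^ a = \prod_(i | P i) f i `^ a.
apply: (big_ind2 (fun x y : R => 0 < x /\ x `^ a = y)) => [|x1 x2 y1 y2 [? <-]
  [? <-]|i /f0//].
  by rewrite powR1.
by rewrite mulr_gt0// powRM// ltW.
Qed.

Section PivotProducts.
Import fintype boot.finset.
Local Open Scope set_scope.
Variables (R : realType) (r : nat) (E : rel 'I_r) (Cs : seq {set 'I_r}).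
Hypotheses (rE : reflexive E) (sE : symmetric E) (hE : homogeneous E).
Hypothesis pCs : perfect_order E Cs.
Implicit Types (x y z sigma : 'M[R]_r) (i j k : 'I_r) (A : {set 'I_r}).

Lemma powR_expR (a b : R) : expR a `^ b = expR (b * a).
Proof. by rewrite -expRM mulrC. Qed.

Lemma det_initial_expR x A : x^T = x -> (forall k, 0 < pivot E k x) -> initial E
  A ->
  \det (submat A A x) = expR (\sum_k (k \in A)%:R * ln (pivot E k x)).
Proof.
move=> sx px iA; have [_ ->] := initial_block rE sE hE sx iA (fun k _ => px k).
rewrite expR_sum big_mkcond/=; apply: eq_bigr => k _.
by case: (k \in A); rewrite ?mul1r ?mul0r ?expR0// lnK// posrE.
Qed.

(** Stated for general exponents to cover both H_G and the density of mu_G. Written with logarithms,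
    it is an exchange of the sums over sets and over vertices. *)
Lemma prod_powR_pivot (a b : {set 'I_r} -> R) x : x^T = x -> (forall k, 0 <
  pivot E k x) ->
  (\prod_(C in cliques E) (\det (submat C C x)) `^ a C)
  / \prod_(S in min_separators Cs) (\det (submat S S x)) `^ ((nu Cs S)%:R * b S)
    =
  \prod_k pivot E k x `^ (\sum_(C in cliques E) (k \in C)%:R * a C -
     \sum_(S in min_separators Cs) (nu Cs S)%:R * ((k \in S)%:R * b S)).
Proof.
move=> sx px.
transitivity (expR (\sum_(C in cliques E) a C * (\sum_k (k \in C)%:R * ln (pivot
  E k x))
   - \sum_(S in min_separators Cs) (nu Cs S)%:R * b S * (\sum_k (k \in S)%:R *
     ln (pivot E k x)))).
  rewrite expRD expRN !expR_sum; congr (_ / _); apply: eq_bigr => A AE.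
    by rewrite det_initial_expR ?powR_expR//;
      exact/arrow_closed_initial/clique_arrow_closed.
  rewrite det_initial_expR ?powR_expR//; apply: arrow_closed_initial => //.
  by move: AE; rewrite inE; exact: separator_arrow_closed.
have e (P : pred {set 'I_r}) (c : {set 'I_r} -> R) :
    \sum_(A | P A) c A * (\sum_k (k \in A)%:R * ln (pivot E k x)) =
    \sum_k (\sum_(A | P A) (k \in A)%:R * c A) * ln (pivot E k x).
  under [RHS]eq_bigr do rewrite mulr_suml.
  rewrite [RHS]exchange_big/=; apply: eq_bigr => A _.
  by rewrite mulr_sumr; apply: eq_bigr => k _; ring.
rewrite !e -sumrB expR_sum; apply: eq_bigr => k _.
rewrite -mulrBl -powR_expR lnK ?posrE//; congr (_ `^ (_ - _)).
by apply: eq_bigr => S _; ring.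
Qed.

Lemma HG_pivot (alpha beta : {set 'I_r} -> R) x : QG E x ->
  HG E Cs alpha beta x = \prod_k pivot E k x `^ rho E Cs alpha beta (cl E k).
Proof.
move=> Qx; rewrite /HG prod_powR_pivot ?(QG_sym Qx)// => [|k]; last exact:
  QG_pivot_gt0.
by apply: eq_bigr => k _; rewrite (rhoE rE sE hE pCs).
Qed.

Lemma HG_gt0 (alpha beta : {set 'I_r} -> R) x : QG E x -> 0 < HG E Cs alpha beta
  x.
Proof.
move=> Qx; rewrite HG_pivot//; apply: prodr_gt0 => k _.
by rewrite powR_gt0// QG_pivot_gt0.
Qed.

Lemma muG_density_pivot x : QG E x ->
  muG_density E Cs x = \prod_k pivot E k x `^ (- (#|cnb E k|.+1%:R / 2)).
Proof.
move=> Qx; have px k := QG_pivot_gt0 rE sE hE k Qx.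
transitivity (\prod_k pivot E k x `^ (\sum_(C in cliques E) (k \in C)%:R * (-
  (#|C|.+1%:R / 2)) -
     \sum_(S in min_separators Cs) (nu Cs S)%:R * ((k \in S)%:R * (- (#|S|.+1%:R
       / 2))))).
  rewrite -prod_powR_pivot ?(QG_sym Qx)// /muG_density -prodfV; congr (_ * _).
  by apply: eq_bigr => S _; rewrite -powRN mulrN opprK.
apply: eq_bigr => k _; congr (_ `^ _).
(* [e1] yields the size of the closed neighbourhood, and the pair identity for j = k the extra 1. *)
have e1 := sum_clique_sep_card rE sE pCs R k.
have := sum_clique_sep_pair rE sE pCs R k k; rewrite rE => e2.
rewrite -[#|cnb E k|.+1%:R]natr1 -e1.
have bb (A : {set 'I_r}) : (k \in A)%:R * (k \in A)%:R = (k \in A)%:R :> R.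
  by case: (k \in A); rewrite ?mul1r ?mul0r.
transitivity (- 2^-1 * ((\sum_(C in cliques E) (k \in C)%:R * #|C|%:R -
  \sum_(S in min_separators Cs) (nu Cs S)%:R * ((k \in S)%:R * #|S|%:R)) +
  (\sum_(C in cliques E) (k \in C)%:R * (k \in C)%:R -
  \sum_(S in min_separators Cs) (nu Cs S)%:R * ((k \in S)%:R * (k \in S)%:R)) :
    R)); last first.
  by rewrite e2 mulNr mulrC.
rewrite addrACA -big_split/= -opprD -big_split/= mulrBr !mulr_sumr; congr (_ -
  _).
  by apply: eq_bigr => C _; rewrite bb -natr1; field.
by apply: eq_bigr => S _; rewrite bb -natr1; field.
Qed.

Lemma HG_muG_pivot (alpha beta : {set 'I_r} -> R) x : QG E x ->
  HG E Cs alpha beta x * muG_density E Cs x =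
  \prod_k pivot E k x `^ (rho E Cs alpha beta (cl E k) - #|cnb E k|.+1%:R / 2).
Proof.
move=> Qx; rewrite HG_pivot// muG_density_pivot// -big_split/=; apply: eq_bigr
  => k _.
by rewrite [RHS]powRD// (gt_eqF (QG_pivot_gt0 rE sE hE k Qx)) implybT.
Qed.

(** V_u and the set of strict ancestors of u are both initial, so the quotient of their determinants
    is the product of the pivots of the class; block elimination identifies this quotient with the
    determinant of the Schur complement. *)
Lemma det_schur_block sigma k : QG E sigma ->
  \det (schur_block E (cl E k) sigma) = \prod_(i in cl E k) pivot E i sigma.
Proof.
move=> Qs; have ss := QG_sym Qs; have ps i := QG_pivot_gt0 rE sE hE i Qs.
have [pA dA] := initial_block rE sE hE ss (arrow_closed_initial rE sE hE
  (anc_arrow_closed rE sE hE k)) (fun i _ => ps i).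
have [_ dV] := initial_block rE sE hE ss (arrow_closed_initial rE sE hE
  (Vset_arrow_closed rE sE hE k)) (fun i _ => ps i).
have dis : forall i, (i \in cl E k) && (i \in anc E (cl E k)) = false.
  by move=> i; have /pred0P/(_ i) := anc_cl_disjoint E k; rewrite /= andbC.
have VE i : (i \in Vset E (cl E k)) = (i \in cl E k) || (i \in anc E (cl E k)).
  by rewrite -ancU_cl in_setU orbC.
have := @submat_split R r _ _ (fun a : 'I_#|cl E k| => enum_val a) (fun a :
  'I_#|anc E (cl E k)| => enum_val a)
   (Vset E (cl E k)) sigma enum_val_inj enum_val_inj.
case=> [a b||].
- by apply: contraFneq (dis (enum_val a)) => e; rewrite {2}e !enum_valP.
- move=> i; rewrite VE; congr (_ || _); apply/idP/codomP => [ik|[a ->]]; try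
  exact: enum_valP;
  by exists (enum_rank_in ik i); rewrite enum_rankK_in.
move=> dV' _; move: dV; rewrite dV' det_block_schur; last exact: posdef_unitmx.
rewrite -/(submat (anc E (cl E k)) (anc E (cl E k)) sigma) dA.
have -> : \prod_(i in Vset E (cl E k)) pivot E i sigma =
   (\prod_(i in cl E k) pivot E i sigma) * (\prod_(i in anc E (cl E k)) pivot E
     i sigma).
  rewrite -bigU/=; first by apply: eq_bigl => i; rewrite inE VE.
  by rewrite disjoint_sym anc_cl_disjoint.
move/(mulIf _); rewrite gt_eqF; last by apply: prodr_gt0 => i _; exact: ps.
move=> /(_ isT) <-; rewrite /schur_block; congr (\det (_ - _ *m _ *m _)).
by apply/matrixP => a b; rewrite !mxE -[in LHS]ss mxE.
Qed.

End PivotProducts.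

(** * Measurability of matrix-valued functions *)

Section MeasurableMatrices.
Local Open Scope classical_set_scope.
Context d (T : measurableType d) (R : realType).

Lemma measurable_funV (f : T -> R) : measurable_fun setT f ->
  measurable_fun setT (fun t => (f t)^-1).
Proof.
move=> mf; rewrite (_ : (fun t => _) = (fun t => f t * (f t ^+ 2) `^ (-1))).
  apply: measurable_funM => //; apply: (measurableT_comp (measurable_powR _)).
  exact: measurable_funX.
apply/funext => t; rewrite powR_inv1 ?sqr_ge0//.
by have [->|f0] := eqVneq (f t) 0; [rewrite invr0 mul0r|field].
Qed.

Definition measurable_mx m n (X : T -> 'M[R]_(m, n)) :=
  forall i j, measurable_fun setT (fun t => X t i j).

Lemma measurable_mulmx m n p (X : T -> 'M[R]_(m, n)) (Y : T -> 'M[R]_(n, p)) :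
  measurable_mx X -> measurable_mx Y -> measurable_mx (fun t => X t *m Y t).
Proof.
move=> mX mY i j; under eq_fun do rewrite mxE.
by apply: measurable_sum => k; exact: measurable_funM.
Qed.

Lemma measurable_trmx m n (X : T -> 'M[R]_(m, n)) :
  measurable_mx X -> measurable_mx (fun t => (X t)^T).
Proof. by move=> mX i j; under eq_fun do rewrite mxE; exact: mX. Qed.

Lemma measurable_submx m n (X Y : T -> 'M[R]_(m, n)) :
  measurable_mx X -> measurable_mx Y -> measurable_mx (fun t => X t - Y t).
Proof.
move=> mX mY i j; under eq_fun do rewrite 2!mxE.
exact: measurable_funB.
Qed.

Lemma measurable_cst_mx m n (x : 'M[R]_(m, n)) : measurable_mx (cst x).
Proof. by move=> i j; exact: measurable_cst. Qed.

Lemma measurable_det n (X : T -> 'M[R]_n) :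
  measurable_mx X -> measurable_fun setT (fun t => \det (X t)).
Proof.
move=> mX; apply: measurable_sum => s; apply: measurable_funM => //.
by apply: measurable_prod => i _; exact: mX.
Qed.

Lemma measurable_invmx n (X : T -> 'M[R]_n) :
  measurable_mx X -> measurable_mx (fun t => invmx (X t)).
Proof.
move=> mX i j.
(* [invmx] returns its argument on singular matrices, whence the first branch. *)
rewrite (_ : (fun t => _) = (fun t => if \det (X t) == 0 then X t i j
    else (\det (X t))^-1 * cofactor (X t) j i)); last first.
  apply/funext => t; rewrite /invmx unitmxE unitfE; case: eqP => //= _.
  by rewrite 2!mxE.
apply: measurable_fun_ifT => //.
  by apply: measurable_fun_eqr => //; exact: measurable_det.
apply: measurable_funM; first by apply: measurable_funV; exact: measurable_det.
apply: measurable_funM => //; apply: measurable_det => a b.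
under eq_fun do rewrite 2!mxE.
exact: mX.
Qed.

Lemma measurable_qf n (X : T -> 'M[R]_n) (v : T -> 'cV[R]_n) :
  measurable_mx X -> measurable_mx v -> measurable_fun setT (fun t => qf (X t)
    (v t)).
Proof.
move=> mX mv; apply: measurable_mulmx => //; apply: measurable_mulmx => //.
exact: measurable_trmx.
Qed.

End MeasurableMatrices.

(** * Elimination of the vertices *)

Section Coordinates.
Import fintype boot.finset.
Local Open Scope set_scope.
Variables (R : realType) (r : nat) (E : rel 'I_r).
Hypotheses (rE : reflexive E) (sE : symmetric E) (hE : homogeneous E).
Local Notation mR := (measurableTypeR R).
Local Notation N := #|upper_edges E|.
Implicit Types (i j k : 'I_r) (t : N.-tuple mR).

Definition edge_key i j : 'I_r * 'I_r := if (i <= j)%N then (i, j) else (j, i).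

Lemma edge_keyC i j : edge_key i j = edge_key j i.
Proof. by rewrite /edge_key; case: ltngtP => // /val_inj ->. Qed.

Lemma edge_key_upper i j : E i j -> edge_key i j \in upper_edges E.
Proof.
move=> ij; rewrite inE /edge_key; case: (leqP i j) => h /=; rewrite ?h ?ij//.
by rewrite (ltnW h) sE ij.
Qed.

Lemma diag_upper k : (k, k) \in upper_edges E.
Proof. by rewrite inE leqnn rE. Qed.

(** Meaningful only if [E k j]; the diagonal pair merely shows that there is a coordinate at all. *)
Definition coord_index k j : 'I_N := enum_rank_in (diag_upper k) (edge_key k j).

Lemma enum_val_coord k j : E k j -> enum_val (coord_index k j) = edge_key k j.
Proof. by move=> kj; apply: enum_rankK_in; exact: edge_key_upper. Qed.

Lemma of_coordsE t i j : E i j -> of_coords t i j = tnth t (coord_index i j).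
Proof.
move=> ij; rewrite mxE ij (tnth_nth 0) -/(edge_key i j) -enum_val_coord//.
by congr nth; rewrite (enum_val_nth (i, j)) index_uniq ?enum_uniq// -cardE.
Qed.

Lemma of_coords_IG t : IG E (of_coords t).
Proof.
split; last by move=> i j nij; rewrite mxE (negbTE nij).
apply/matrixP => i j; rewrite mxE; have [ij|nij] := boolP (E i j).
  rewrite !of_coordsE// 1?sE// /coord_index; congr tnth; apply: enum_val_inj.
  by rewrite !enum_rankK_in ?edge_key_upper// 1?sE// edge_keyC.
by rewrite !mxE sE (negbTE nij).
Qed.

Lemma edge_key_eq i j i' j' : edge_key i j = edge_key i' j' ->
  (i = i' /\ j = j') \/ (i = j' /\ j = i').
Proof. by rewrite /edge_key; do 2 case: ifP => _; case=> -> ->; auto. Qed.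

Lemma coord_index_eq i j i' j' : E i j -> E i' j' ->
  coord_index i j = coord_index i' j' -> (i = i' /\ j = j') \/ (i = j' /\ j =
    i').
Proof.
move=> ij ij' e; apply: edge_key_eq; rewrite -enum_val_coord// e.
exact: enum_val_coord.
Qed.

Lemma Par_edge k j : j \in Par E k -> E k j.
Proof. by rewrite in_Par sE => /andP[]. Qed.

Lemma fam_edge k j : j \in fam E k -> E k j.
Proof. by rewrite in_setU1 => /predU1P[->|/Par_edge]; rewrite ?rE. Qed.

Definition parent_coord k (a : 'I_#|Par E k|) : 'I_N := coord_index k (enum_val
  a).

Lemma parent_coord_edge k (a : 'I_#|Par E k|) : E k (enum_val a).
Proof. by apply: Par_edge; exact: enum_valP. Qed.

Lemma parent_coord_neq k (a : 'I_#|Par E k|) : k != enum_val a.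
Proof. by apply: contraTneq (enum_valP a) => <-; exact: Par_irr. Qed.

Lemma parent_coord_inj k : injective (@parent_coord k).
Proof.
move=> a b /coord_index_eq -/(_ (parent_coord_edge a) (parent_coord_edge b)).
case=> [[_ /enum_val_inj//]|[e _]].
by have := parent_coord_neq b; rewrite -e eqxx.
Qed.

(** The diagonal entry comes last in the list and is therefore integrated first: the Gamma integral
    precedes the Gaussian one. *)
Definition vertex_coords k : seq 'I_N := codom (@parent_coord k) ++ [::
  coord_index k k].

Lemma diag_coord_notin k : coord_index k k \notin codom (@parent_coord k).
Proof.
apply/negP => /codomP[a] /coord_index_eq -/(_ (rE k) (parent_coord_edge a)) [[_
  e]|[e _]];
by have := parent_coord_neq a; rewrite -e eqxx.
Qed.

Lemma vertex_coords_uniq k : uniq (vertex_coords k).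
Proof.
rewrite cat_uniq /= orbF diag_coord_notin andbT /codom map_inj_uniq
  ?enum_uniq//.
exact: parent_coord_inj.
Qed.

Lemma vertex_coordsP k a : reflect (exists2 j, j \in fam E k & a = coord_index k
  j)
  (a \in vertex_coords k).
Proof.
rewrite mem_cat inE; apply: (iffP orP) => [[/codomP[b ->]|/eqP->]|[j]].
- by exists (enum_val b) => //; rewrite in_setU1 enum_valP orbT.
- by exists k => //; rewrite setU11.
rewrite in_setU1 => /predU1P[->->|jP ->]; first by right.
by left; apply/codomP; exists (enum_rank_in jP j); rewrite /parent_coord
  enum_rankK_in.
Qed.

(** The coordinate of an edge belongs to the later of its two ends. *)
Lemma vertex_coords_disjoint k l a : a \in vertex_coords k -> a \in
  vertex_coords l -> k = l.
Proof.
move=> /vertex_coordsP[j jk ->] /vertex_coordsP[i il] /coord_index_eq.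
move=> /(_ (fam_edge jk) (fam_edge il)) [[//]|[ki jl]]; subst i j.
move: jk il; rewrite !in_setU1 => /predU1P[//|lk] /predU1P[//|kl].
by move: lk kl; rewrite !in_Par => /andP[_ /precNsym ->] /andP[_].
Qed.

Definition all_coords (vs : seq 'I_r) : seq 'I_N := flatten (map vertex_coords
  vs).

Lemma all_coords_uniq vs : uniq vs -> uniq (all_coords vs).
Proof.
elim: vs => //= k vs IHvs /andP[kvs uvs]; rewrite /all_coords/= cat_uniq IHvs//
  andbT.
rewrite vertex_coords_uniq/=; apply/hasPn => a /flattenP[s /mapP[l lvs ->] al].
by apply: contra kvs => ak; rewrite (vertex_coords_disjoint ak al).
Qed.

Lemma all_coords_perm vs : uniq vs -> (forall k, k \in vs) ->
  perm_eq (enum 'I_N) (all_coords vs).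
Proof.
move=> uvs vsT; apply: uniq_perm; [exact: enum_uniq|exact: all_coords_uniq|].
move=> a; rewrite mem_enum; apply/esym/flattenP.
have mem k j : j \in fam E k -> enum_val a = edge_key k j ->
    exists2 s, s \in map vertex_coords vs & a \in s.
  move=> jk e; exists (vertex_coords k); first exact: map_f.
  apply/vertex_coordsP; exists j => //; apply: enum_val_inj.
  by rewrite enum_val_coord// fam_edge.
have := enum_valP a; case e: (enum_val a) => [i j]; rewrite inE/= => /andP[ij
  Eij].
have ke : edge_key i j = (i, j) by rewrite /edge_key ij.
have [ij'|nij] := eqVneq i j; first by apply: (@mem i j); rewrite ?ke// ij'
  setU11.
have [pij|pji] := orP (prec_total E nij).
  by apply: (@mem j i); rewrite 1?edge_keyC ?ke// setU1r// in_Par Eij.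
by apply: (@mem i j); rewrite ?ke// setU1r// in_Par sE Eij.
Qed.

Lemma measurable_of_coords : measurable_mx (fun t => of_coords t : 'M[R]_r).
Proof.
move=> i j; have [ij|nij] := boolP (E i j).
  under eq_fun do rewrite of_coordsE//.
  exact: measurable_tnth.
by under eq_fun do rewrite mxE (negbTE nij); exact: measurable_cst.
Qed.

Lemma measurable_parent_row k : measurable_mx (fun t => parent_row E k
  (of_coords t)).
Proof. by move=> i j; under eq_fun do rewrite mxE; exact: measurable_of_coords.
  Qed.

Lemma measurable_parent_block k : measurable_mx (fun t => parent_block E k
  (of_coords t)).
Proof. by move=> i j; under eq_fun do rewrite mxE; exact: measurable_of_coords.
  Qed.

Lemma measurable_regr k : measurable_mx (fun t => regr E k (of_coords t)).
Proof.
apply: measurable_mulmx.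
  by apply: measurable_invmx; exact: measurable_parent_block.
by apply: measurable_trmx; exact: measurable_parent_row.
Qed.

Lemma measurable_pivot k :
  measurable_fun classical_sets.setT (fun t => pivot E k (of_coords t)).
Proof.
apply: measurable_funB; first exact: measurable_of_coords.
apply: (measurable_mulmx _ _ 0 0); last by apply: measurable_trmx; exact:
  measurable_parent_row.
apply: measurable_mulmx; first exact: measurable_parent_row.
by apply: measurable_invmx; exact: measurable_parent_block.
Qed.

Section EliminationIntegral.
Variables (s : 'I_r -> R) (b : forall k, 'cV[R]_#|Par E k|).
Hypothesis s0 : forall k, 0 < s k.
Local Notation x_ t := (of_coords t : 'M[R]_r).

(** [s] and [b] stand for the pivots and regression vectors of sigma. The value 0 at nonpositive
    pivots builds the indicator of Q_G into the product, so that the integrals run over the whole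
    space. *)
Definition vertex_factor k (lam : R) t : R :=
  if 0 < pivot E k (x_ t) then
    expR (- ((pivot E k (x_ t) + qf (parent_block E k (x_ t)) (regr E k (x_ t) -
      b k)) / s k))
    * pivot E k (x_ t) `^ lam
  else 0.

Definition vertex_product (lam : 'I_r -> R) (vs : seq 'I_r) t : R :=
  \prod_(k <- vs) vertex_factor k (lam k) t.

Lemma vertex_factor_ge0 k lam t : 0 <= vertex_factor k lam t.
Proof. by rewrite /vertex_factor; case: ifP => // _; rewrite mulr_ge0 ?expR_ge0
  ?powR_ge0. Qed.

Lemma vertex_product_ge0 lam vs t : 0 <= vertex_product lam vs t.
Proof. by apply: prodr_ge0 => k _; exact: vertex_factor_ge0. Qed.

Lemma measurable_vertex_product lam vs :
  measurable_fun classical_sets.setT (fun t => (vertex_product lam vs t)%:E).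
Proof.
apply/measurable_EFinP; apply: measurable_prod => k _.
apply: measurable_fun_ifT => //.
  by apply: measurable_fun_ltr => //; exact: measurable_pivot.
apply: measurable_funM; last first.
  by apply: (measurableT_comp (measurable_powR _)); exact: measurable_pivot.
apply: measurableT_comp => //; apply: measurable_funN; apply: measurable_funM =>
  //.
apply: measurable_funD; first exact: measurable_pivot.
apply: measurable_qf; first exact: measurable_parent_block.
apply: measurable_submx; first exact: measurable_regr.
exact: measurable_cst_mx.
Qed.

(** The power of pi s_k is the Gaussian integral over the x_kj, j in Par k, without its factor
    |x_P|^(1/2); the rest is the Gamma integral over x_kk. *)
Definition vertex_const k (lam : R) : \bar R :=
  (((pi * s k) `^ (#|Par E k|%:R / 2) * s k `^ (lam + 1))%:E * eGamma (lam +
    1))%E.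

Lemma vertex_const_ge0 k lam : (0 <= vertex_const k lam)%E.
Proof. by rewrite mule_ge0 ?eGamma_ge0// lee_fin mulr_ge0 ?powR_ge0. Qed.

Lemma coord_index_notin k i j : E i j -> i != k -> j != k ->
  coord_index i j \notin vertex_coords k.
Proof.
move=> ij ik jk; apply/negP => /vertex_coordsP[l lk] /(coord_index_eq ij).
move=> /(_ (fam_edge lk)) [[e _]|[_ e]]; first by rewrite e eqxx in ik.
by rewrite e eqxx in jk.
Qed.

(** The factor of j reads only entries inside [fam E j], and k, being later than j, is not in that
    set. *)
Lemma vertex_product_local lam (vs : seq 'I_r) k t t' : {in vs, forall j, prec E
  j k} ->
  (forall a, a \notin vertex_coords k -> tnth t' a = tnth t a) ->
  vertex_product lam vs t' = vertex_product lam vs t.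
Proof.
move=> vk tt'; apply: eq_big_seq => j jvs; have jk := vk _ jvs.
have ne i : i \in fam E j -> i != k.
  rewrite in_setU1 => /predU1P[->|].
    by apply: contraTneq jk => ->; rewrite prec_irr.
  rewrite in_Par => /andP[_ pij].
  by apply: contraTneq (prec_trans pij jk) => ->; rewrite prec_irr.
have loc : {in fam E j &, forall i l, x_ t' i l = x_ t i l}.
  move=> i l ij lj; have il : E i l.
    by apply: (arrow_complete (A := fam E j)) => //; exact: complete_fam.
  by rewrite !of_coordsE// tt'// coord_index_notin// ne.
have [_ e1 e2 e3] := pivot_local loc.
by rewrite /vertex_factor e1 e2 e3.
Qed.

Lemma measurable_shifted_gamma (c a lam : R) :
  measurable_fun classical_sets.setT (fun z : mR =>
    (if 0 < z - c then expR (- ((z - c) / a)) * (z - c) `^ lam else 0)%:E).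
Proof.
have mz : measurable_fun classical_sets.setT (fun z : mR => z - c).
  by apply: measurable_funB.
apply/measurable_EFinP; apply: measurable_fun_ifT => //.
  by apply: measurable_fun_ltr.
apply: measurable_funM; last exact: (measurableT_comp (measurable_powR _) mz).
by apply: measurableT_comp => //; apply: measurable_funN; exact:
  measurable_funM.
Qed.

(** The block x_P involves only edges between parents of k, none of which meets k, so it stays fixed
    while x_kP and x_kk vary. *)
Lemma vertex_coords_data k t t' (z : mR) :
  (forall a, a \notin codom (@parent_coord k) -> tnth t' a = tnth t a) ->
  let v := \col_a tnth t' (@parent_coord k a) in
  let y := x_ (upd t' (coord_index k k) z) in
  [/\ parent_block E k y = parent_block E k (x_ t), parent_row E k y = v^T & y k
    k = z].
Proof.
move=> tt' v y.
have Ek := parent_coord_edge.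
split.
- apply/matrixP => a c; rewrite [LHS]mxE [RHS]mxE.
  have ac : E (enum_val a) (enum_val c).
    by apply: (arrow_complete (A := fam E k)); rewrite ?setU1r ?enum_valP//;
      exact: complete_fam.
  have nin := coord_index_notin ac (k := k).
  rewrite !(eq_sym (enum_val _) k) in nin.
  have {}nin := nin (parent_coord_neq a) (parent_coord_neq c).
  rewrite mem_cat inE negb_or in nin; case/andP: nin => n1 n2.
  by rewrite !of_coordsE// tnth_upd (negbTE n2) tt'.
- apply/rowP => a; rewrite [LHS]mxE 2![RHS]mxE of_coordsE ?Ek// tnth_upd
  -/(parent_coord a).
  by rewrite (negbTE (contraNneq _ (diag_coord_notin k))) // => <-; exact:
    codom_f.
- by rewrite of_coordsE// tnth_upd eqxx.
Qed.

Lemma vertex_product_rcons lam (vs : seq 'I_r) k t : vertex_product lam (rcons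
  vs k) t =
  vertex_product lam vs t * vertex_factor k (lam k) t.
Proof. by rewrite /vertex_product -cats1 big_cat big_seq1. Qed.

Lemma int_diag_coord lam (vs : seq 'I_r) k t t' : {in vs, forall j, prec E j k}
  ->
  posdef (parent_block E k (x_ t)) ->
  (forall a, a \notin codom (@parent_coord k) -> tnth t' a = tnth t a) ->
  coord_int (coord_index k k) (fun t => (vertex_product lam (rcons vs k) t)%:E)
    t' =
  ((vertex_product lam vs t)%:E * (s k `^ (lam k + 1))%:E * eGamma (lam k + 1) *
   (expR (- qf ((s k)^-1 *: invmx (parent_block E k (x_ t)))
      (\col_a tnth t' (@parent_coord k a) - parent_block E k (x_ t) *m b
        k)))%:E)%E.
Proof.
move=> vk pp tt'; set p := parent_block E k (x_ t) in pp *; set v := \col_a _.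
have up := posdef_unitmx pp; have [sp _] := pp.
(* This is x_kP x_P^-1 x_Pk: at x_kk = z the pivot of k is z - c, while the quadratic form does not
   depend on z and leaves the integral. *)
set c := (v^T *m invmx p *m v) 0 0.
set K := vertex_product lam vs t.
rewrite /coord_int.
transitivity (\int[@lebesgue_measure R]_z ((K * expR (- qf ((s k)^-1 *: invmx p)
  (v - p *m b k)))%:E *
  (if 0 < z - c then expR (- ((z - c) / s k)) * (z - c) `^ lam k else 0)%:E))%E.
  apply: eq_integral => z _.
  have [e1 e2 e3] := vertex_coords_data z tt'.
  rewrite vertex_product_rcons (vertex_product_local lam (t := t) vk); last
    first.
    move=> a; rewrite mem_cat inE negb_or => /andP[a1 a2].
    by rewrite tnth_upd (negbTE a2) tt'.
  rewrite /vertex_factor /regr /pivot e1 e2 e3 trmxK -/v -/p -/c -/K.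
  rewrite -EFinM; congr EFin; case: ifP => _; last by rewrite !mulr0.
  rewrite qf_invmx// qfZ mulrDl opprD expRD [_ / s k in X in _ * (_ * X *
    _)]mulrC; ring.
rewrite ge0_integralZl//; last 3 first.
- exact: measurable_shifted_gamma.
- by move=> z _; rewrite lee_fin; case: ifP => // _; rewrite mulr_ge0 ?expR_ge0
  ?powR_ge0.
- by rewrite lee_fin mulr_ge0 ?expR_ge0 ?vertex_product_ge0.
rewrite integral_shifted_gamma// EFinM -!muleA; congr (_ * _)%E.
by rewrite muleC -!muleA.
Qed.

(* The determinant |x_P| produced by the Gaussian integral is the product of the
   pivots of P = Par k, whence the shift by 1/2 of their exponents. *)
Lemma elimination_step lam (vs : seq 'I_r) k t : {in vs, forall j, prec E j k}
  ->
  {subset Par E k <= vs} -> uniq vs ->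
  iter_int (vertex_coords k) (fun t => (vertex_product lam (rcons vs k) t)%:E) t
    =
  (vertex_const k (lam k) *
   (vertex_product (fun j => lam j + (j \in Par E k)%:R / 2) vs t)%:E)%E.
Proof.
move=> vk Pvs uvs.
(* If an earlier pivot fails to be positive, x_P may be singular, but then both sides vanish. *)
have [/allP pos|/allPn[j jvs nj]] := boolP (all (fun j => 0 < pivot E j (x_ t))
  vs); last first.
  have zero lam' : vertex_product lam' vs t = 0.
    by rewrite /vertex_product (big_rem j)//= /vertex_factor (negbTE nj) mul0r.
  rewrite zero mule0 (eq_iter_int (G := fun=> 0%E)) ?iter_int0// => t' tt'.
  by rewrite vertex_product_rcons (vertex_product_local lam vk tt') zero mul0r.
have [sx _] := of_coords_IG t.
have [pp dp] := initial_block rE sE hE sx (initial_Par rE sE hE k) (fun j jP =>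
  pos _ (Pvs _ jP)).
rewrite -/(parent_block E k (x_ t)) in pp dp.
have -> F : iter_int (vertex_coords k) F =
    iter_int (codom (@parent_coord k)) (coord_int (coord_index k k) F).
  by rewrite /vertex_coords iter_int_cat.
set p := parent_block E k (x_ t) in pp dp *.
pose h (v : 'cV[R]_#|Par E k|) : \bar R :=
  ((vertex_product lam vs t)%:E * (s k `^ (lam k + 1))%:E * eGamma (lam k + 1) *
    (expR (- qf ((s k)^-1 *: invmx p) (v - p *m b k)))%:E)%E.
rewrite (iter_int_vec_int (h := h) (@parent_coord_inj k)); last first.
  by move=> t' tt'; rewrite /h (int_diag_coord lam vk pp tt').
rewrite /h.
rewrite vec_int_gauss; last 2 first.
- by apply: posdef_scale; [rewrite invr_gt0|exact: posdef_inv].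
- by rewrite !mule_ge0 ?eGamma_ge0// lee_fin ?powR_ge0 ?vertex_product_ge0.
have dp0 := posdef_det_gt0 pp.
have -> : vertex_product (fun j => lam j + (j \in Par E k)%:R / 2) vs t =
    vertex_product lam vs t * \det p `^ 2^-1.
  rewrite dp powR_prodr => [|j jP]; last exact/pos/Pvs.
  rewrite big_mkcond (bigID (mem vs))/= [X in _ = _ * (_ * X)]big1 ?mulr1; last
    first.
    by move=> j; case: ifPn => // jP; rewrite (Pvs _ jP).
  rewrite -(big_uniq _ uvs) -big_split/=; apply: eq_big_seq => j jvs.
  rewrite /vertex_factor (pos _ jvs) -mulrA; congr (_ * _).
  rewrite powRD; last by rewrite (gt_eqF (pos _ jvs)) implybT.
  by case: (j \in Par E k); rewrite ?mul0r ?powRr0// mul1r.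
have -> : (pi ^+ #|Par E k| / \det ((s k)^-1 *: invmx p)) `^ 2^-1 =
    (pi * s k) `^ (#|Par E k|%:R / 2) * \det p `^ 2^-1.
  rewrite detZ det_inv exprVn invfM !invrK mulrA -exprMn.
  have ps0 : 0 <= pi * s k by rewrite mulr_ge0 ?pi_ge0 ?ltW.
  by rewrite powRrM powR_mulrn// -powRM// ?exprn_ge0// ltW.
rewrite /vertex_const -!EFinM muleAC -EFinM [RHS]muleAC -EFinM; congr (_%:E *
  _)%E.
by ring.
Qed.

(** [vs] is closed under taking earlier vertices, so it contains the parents of its last vertex. The
    induction is over all [lam], because each step shifts exponents: that of k once for every i with
    k in Par i. *)
Lemma elimination_integral lam (vs : seq 'I_r) t : pairwise (prec E) vs ->
  (forall k j, k \in vs -> prec E j k -> j \in vs) ->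
  iter_int (all_coords vs) (fun t => (vertex_product lam vs t)%:E) t =
  (\prod_(k <- vs) vertex_const k (lam k + (count (fun i => k \in Par E i)
    vs)%:R / 2))%E.
Proof.
elim/last_ind: vs lam t => [|vs k IHvs] lam t.
  by rewrite /= big_nil /vertex_product big_nil.
rewrite pairwise_rcons => /andP[/allP vk pvs] down.
have uvs : uniq vs by apply: pairwise_uniq pvs => i; exact: prec_irr.
have Pvs : {subset Par E k <= vs}.
  move=> j; rewrite in_Par => /andP[_ jk].
  have := down k j; rewrite !mem_rcons !inE eqxx => /(_ isT jk).
  by case/predU1P => // e; rewrite e prec_irr in jk.
have down' k' j : k' \in vs -> prec E j k' -> j \in vs.
  move=> k'vs jk'; have := down k' j; rewrite !mem_rcons !inE k'vs orbT => /(_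
    isT jk').
  by case/predU1P => // e; move: (vk _ k'vs); rewrite -e (precNsym jk').
rewrite /all_coords map_rcons flatten_rcons iter_int_cat -/(all_coords vs).
rewrite (_ : iter_int (vertex_coords k) _ = fun t => (vertex_const k (lam k) *
   (vertex_product (fun j => lam j + (j \in Par E k)%:R / 2) vs t)%:E)%E); last
     first.
  by apply/funext => t'; exact: elimination_step.
rewrite iter_intZ; last 3 first.
- exact: measurable_vertex_product.
- by move=> t'; rewrite lee_fin vertex_product_ge0.
- exact: vertex_const_ge0.
rewrite IHvs// -[in RHS]cats1 big_cat big_seq1/= muleC; congr (_ * vertex_const
  k _)%E.
  apply: eq_big_seq => j jvs; rewrite cats1 -cats1 count_cat/= addn0 natrD.
  by congr (vertex_const j _); ring.
(* The last vertex is a parent of no vertex in the list, so its own exponent is unshifted. *)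
rewrite cats1 -cats1 count_cat/= addn0 (negbTE (Par_irr E k)) addn0.
rewrite (_ : count _ vs = 0%N) ?mul0r ?addr0//; apply/eqP; rewrite -leqn0 leqNgt
  -has_count.
apply/hasPn => i /vk ik; rewrite in_Par negb_and; apply/orP; right.
by rewrite (precNsym ik).
Qed.

End EliminationIntegral.

End Coordinates.

(** * The Wishart integral *)

Section EliminationOrder.
Import fintype boot.finset.
Variables (r : nat) (E : rel 'I_r).

Lemma elimination_order : exists2 vs : seq 'I_r, pairwise (prec E) vs & forall
  k, k \in vs.
Proof.
pose le i j := (i == j) || prec E i j.
have le_total : total le.
  by move=> i j; rewrite /le (eq_sym j); case: eqVneq => //= /(prec_total E).
have le_trans : transitive le.
  move=> j i k /predU1P[->//|ij] /predU1P[<-|jk]; rewrite /le ?ij ?orbT//.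
  by rewrite (prec_trans ij jk) orbT.
exists (sort le (enum 'I_r)); last by move=> k; rewrite mem_sort mem_enum.
have pl : pairwise le (sort le (enum 'I_r)).
  by rewrite -sorted_pairwise// sort_sorted.
have pn : pairwise [rel x y | x != y] (sort le (enum 'I_r)).
  by rewrite -uniq_pairwise sort_uniq enum_uniq.
have := pairwise_relI le [rel x y | x != y] (sort le (enum 'I_r)).
rewrite pl pn => pi; apply: sub_pairwise pi => i j /= /andP[].
by rewrite /le => /predU1P[->|//]; rewrite eqxx.
Qed.

End EliminationOrder.

Section WishartIntegral.
Import fintype boot.finset.
Variables (R : realType) (r : nat) (E : rel 'I_r) (Cs : seq {set 'I_r}).
Hypotheses (rE : reflexive E) (sE : symmetric E) (hE : homogeneous E).
Hypothesis pCs : perfect_order E Cs.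
Implicit Types (sigma : 'M[R]_r) (k : 'I_r).
Local Notation D := (@of_coords R r E @^-1` QG E)%classic.
Local Notation mu := (lebesgue_tuple R #|upper_edges E|).

Section FixedParameters.
Variables (alpha beta : {set 'I_r} -> R) (sigma : 'M[R]_r).
Hypothesis Qs : QG E sigma.
Local Notation Y := (inv_completion E sigma).
Local Notation rho_ k := (rho E Cs alpha beta (cl E k)).
Let lam k : R := rho_ k - #|cnb E k|.+1%:R / 2.
Let factor := vertex_product (pivot E ^~ sigma) (regr E ^~ sigma) lam.

Lemma integrand_vertex_product vs t : uniq vs -> (forall k, k \in vs) ->
  factor vs t = if of_coords t \in QG E then
     integrand E Cs alpha beta Y (of_coords t) * muG_density E Cs (of_coords t)
       else 0.
Proof.
move=> uvs vsT; set x := of_coords t; have Ix := of_coords_IG rE sE t; have [sx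
  _] := Ix.
rewrite /factor /vertex_product (big_uniq _ uvs)/= (eq_bigl predT); last by
  move=> k; exact: vsT.
case: ifPn => [Qx|nQ].
  have {}Qx := set_mem Qx; have px k := QG_pivot_gt0 rE sE hE k Qx.
  rewrite /integrand -mulrA HG_muG_pivot// pairing_inv_completion// -sumrN
    expR_sum -big_split/=.
  apply: eq_bigr => k _; rewrite /vertex_factor px; congr (expR (- _) * _).
  rewrite mulrC qf_elim_vec//; exact: posdef_unitmx (posdef_parent_block rE sE
    hE k sx px).
have [/forallP px|/forallPn[k nk]] := boolP [forall k, 0 < pivot E k x].
  by case/negP: nQ; apply: mem_set; apply/(QG_pivot rE sE hE).
by rewrite (bigD1 k)//= /vertex_factor (negbTE nk) mul0r.
Qed.

Lemma integrand_ge0 t : D t ->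
  0 <= integrand E Cs alpha beta Y (of_coords t) * muG_density E Cs (of_coords
    t).
Proof.
move=> Qt; rewrite /integrand -mulrA HG_muG_pivot// mulr_ge0 ?expR_ge0//.
by apply: prodr_ge0 => k _; exact: powR_ge0.
Qed.

Lemma measurable_integrand : measurable_fun D
  (fun t => (integrand E Cs alpha beta Y (of_coords t) * muG_density E Cs
    (of_coords t))%:E).
Proof.
have [vs pvs vsT] := elimination_order E.
have uvs : uniq vs by apply: pairwise_uniq pvs => i; exact: prec_irr.
apply: (eq_measurable_fun (fun t => (factor vs t)%:E)).
  by move=> t /set_mem tD; rewrite integrand_vertex_product// ifT//; exact:
    mem_set.
apply: (measurable_funS (E := classical_sets.setT)) => //.
exact: (measurable_vertex_product rE sE).
Qed.

(** An identity of extended reals without conditions on [alpha] and [beta]: it decides convergence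
    as well as giving the value. *)
Lemma integral_integrand :
  (\int[mu]_(t in D) (integrand E Cs alpha beta Y (of_coords t)
      * muG_density E Cs (of_coords t))%:E =
  \prod_k ((pi `^ (#|Par E k|%:R / 2) * pivot E k sigma `^ rho_ k)%:E
     * eGamma (rho_ k - #|Par E k|%:R / 2)))%E.
Proof.
have [vs pvs vsT] := elimination_order E.
have uvs : uniq vs by apply: pairwise_uniq pvs => i; exact: prec_irr.
rewrite integral_mkcond.
transitivity (\int[mu]_t (factor vs t)%:E)%E.
  apply: eq_integral => t _; rewrite patchE integrand_vertex_product//.
  have -> : (t \in D) = (of_coords t \in QG E) by apply/idP/idP => /set_mem ?;
    apply: mem_set.
  by case: ifP.
rewrite (integral_lebesgue_tuple (nseq_tuple _ 0)); last 2 first.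
- exact: measurable_vertex_product.
- by move=> t; rewrite lee_fin vertex_product_ge0.
rewrite (perm_iter_int _ _ (all_coords_perm rE sE uvs vsT)); last 2 first.
- exact: measurable_vertex_product.
- by move=> t; rewrite lee_fin vertex_product_ge0.
rewrite elimination_integral//; last by move=> k; exact: QG_pivot_gt0.
rewrite (big_uniq _ uvs)/= (eq_bigl predT); last by move=> k; exact: vsT.
apply: eq_bigr => k _; have pk := QG_pivot_gt0 rE sE hE k Qs.
rewrite /vertex_const; set n := count _ vs.
(* [n] is the number of later neighbours of k, and |N(k)| = |Par k| + n + 1. *)
have -> : lam k + n%:R / 2 + 1 = rho_ k - #|Par E k|%:R / 2.
  rewrite /lam (card_cnb rE sE) (_ : n = #|[set i | k \in Par E i]%SET|).
    by rewrite -!natr1 natrD; field.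
  rewrite /n -size_filter -(card_uniqP _) ?filter_uniq//; apply: eq_card => i.
  by rewrite inE mem_filter vsT andbT.
(* The power |Par k|/2 of the pivot of sigma coming from the Gaussian integral cancels the one in
   the Gamma integral and leaves the exponent rho_k. *)
congr (_%:E * _)%E; rewrite powRM ?pi_ge0 ?(ltW pk)// -mulrA; congr (_ * _).
by rewrite -powRD ?(gt_eqF pk) ?implybT//; congr (_ `^ _); ring.
Qed.

End FixedParameters.

Lemma prod_gt0_pinfty (I : finType) (f : I -> \bar R) :
  (forall i, 0 < f i)%E -> (\prod_i f i < +oo)%E -> forall i, (f i < +oo)%E.
Proof.
move=> f0 pf i; rewrite ltey; apply: contraTneq pf => fi.
rewrite (bigD1 i)//= fi gt0_mulye ?ltxx//.
by apply: (big_ind (fun x : \bar R => (0 < x)%E)) => // x y; exact: mule_gt0.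
Qed.

(** Within a class the conditions on single vertices are strictest at the last one, for which |Par
    k| = |V_u| - 1. *)
Lemma rho_conditionP (alpha beta : {set 'I_r} -> R) :
  (forall u, u \in T E -> rho E Cs alpha beta u >
     (\sum_(v in T E | tle E v u) #|v|%:R - 1) / 2) <->
  (forall k, 0 < rho E Cs alpha beta (cl E k) - #|Par E k|%:R / 2).
Proof.
have sT u : u \in T E -> \sum_(v in T E | tle E v u) #|v|%:R = #|Vset E u|%:R :>
  R.
  by move=> uT; rewrite -natr_sum sum_T_Vset.
have cV k : #|Vset E (cl E k)| = (#|anc E (cl E k)| + #|cl E k|)%N.
  by rewrite -ancU_cl cardsU disjoint_setI0 ?cards0 ?subn0//; exact:
    anc_cl_disjoint.
split=> [h k|h u].
  have := h _ (cl_T E k); rewrite sT ?cl_T//.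
  have : (#|Par E k| < #|Vset E (cl E k)|)%N.
    rewrite (card_Par rE sE hE) cV ltn_add2l; apply: proper_card; apply/properP;
      split.
      by apply/subsetP => j; rewrite !inE => /andP[].
    by exists k; rewrite ?mem_cl// !inE prec_irr andbF.
  by rewrite -(ler_nat R) -natr1 => ? ?; lra.
move=> uT; rewrite sT//; move: (uT) => /TP[i ui].
have u0 : u != finset.set0 by rewrite ui; apply/set0Pn; exists i; exact: mem_cl.
have [k ku hk] := prec_last E u0.
have uk := T_cl uT ku; have := h k; rewrite uk cV (card_Par rE sE hE).
have -> : [set j in cl E k | prec E j k]%SET = (cl E k :\ k)%SET.
  apply/setP => j; rewrite in_set in_setD1 -uk; have [->|jk] := eqVneq j k.
    by rewrite prec_irr andbF.
  by case: (boolP (j \in u)) => //= ju; rewrite hk.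
have -> : #|cl E k| = #|(cl E k :\ k)%SET|.+1 by rewrite (cardsD1 k) mem_cl.
by rewrite !natrD -natr1 => ?; lra.
Qed.

(** Here [a] counts the strict ancestors and [j] is the rank in the class. The exponents (a + j)/2
    add up to n a/2 + n (n - 1)/4, whose second term is the power of pi in Gamma_n. *)
Lemma prod_class_gamma (n a : nat) (p : R) :
  \prod_(j < n) (pi `^ ((a + j)%:R / 2) * Gamma (p - (a + j)%:R / 2)) =
  pi `^ (n%:R * a%:R / 2) * Gamma_multi n (p - a%:R / 2) :> R.
Proof.
rewrite big_split/= /Gamma_multi mulrA; congr (_ * _); last first.
  by apply: eq_bigr => j _; congr Gamma; rewrite natrD; field.
rewrite -powRD; last by rewrite (lt0r_neq0 (pi_gt0 R)) implybT.
elim: n => [|n IHn]; first by rewrite big_ord0 (_ : (0 * 0.-1)%N = 0%N)// !mul0r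
  addr0 powRr0.
rewrite big_ord_recr/= IHn -powRD; last by rewrite (lt0r_neq0 (pi_gt0 R))
  implybT.
congr (_ `^ _); case: n {IHn} => [|n]/=; by rewrite ?mul0n ?mul1n ?natrD ?natrM
  -?natr1; field.
Qed.

Lemma prod_vertex_class (alpha beta : {set 'I_r} -> R) sigma : QG E sigma ->
  \prod_k (pi `^ (#|Par E k|%:R / 2) * pivot E k sigma `^ rho E Cs alpha beta
    (cl E k)
     * Gamma (rho E Cs alpha beta (cl E k) - #|Par E k|%:R / 2)) =
  HG E Cs alpha beta sigma
  * \prod_(u in T E)
      (pi `^ ((\sum_(v in T E | tlt E v u) #|u|%:R * #|v|%:R) / 2)
       * Gamma_multi #|u| (rho E Cs alpha beta u
            - (\sum_(v in T E | tlt E v u) #|v|%:R / 2))) :> R.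
Proof.
move=> Qs; rewrite (HG_pivot rE sE hE pCs)//.
under eq_bigr do rewrite mulrAC mulrC.
rewrite big_split/=; congr (_ * _).
pose f (u : {set 'I_r}) (m : nat) : R := pi `^ (m%:R / 2) * Gamma (rho E Cs
  alpha beta u - m%:R / 2).
rewrite (big_class rE sE hE _ f)/=; apply: eq_bigr => u uT.
rewrite prod_class_gamma.
have -> : \sum_(v in T E | tlt E v u) #|u|%:R * #|v|%:R = #|u|%:R * #|anc E
  u|%:R :> R.
  by rewrite -mulr_sumr -natr_sum (sum_T_anc uT).
have -> // : \sum_(v in T E | tlt E v u) #|v|%:R / 2 = #|anc E u|%:R / 2 :> R.
by rewrite -mulr_suml -natr_sum (sum_T_anc uT).
Qed.

Lemma HG_schur_block (alpha beta : {set 'I_r} -> R) sigma : QG E sigma ->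
  HG E Cs alpha beta sigma =
  \prod_(u in T E) \det (schur_block E u sigma) `^ rho E Cs alpha beta u.
Proof.
move=> Qs; rewrite (HG_pivot rE sE hE pCs)//.
rewrite (eq_bigl (fun k => k \in [set: 'I_r]%SET)); last by move=> i; rewrite
  in_setT.
rewrite (set_partition_big _ (T_partition E))/=; apply: eq_bigr => u uT.
have [i ui] := TP _ _ uT; rewrite ui det_schur_block// powR_prodr => [|k _];
  last exact: QG_pivot_gt0.
by apply: eq_bigr => k ku; rewrite (T_cl (cl_T E i) ku).
Qed.

Lemma prod_eGamma_fine (I : finType) (c p : I -> R) : (forall i, 0 < p i) ->
  (\prod_i ((c i)%:E * eGamma (p i)) = (\prod_i (c i * Gamma (p i)))%:E)%E.
Proof.
move=> p0; rewrite -prodEFin; apply: eq_bigr => i _.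
rewrite EFinM GammaE fineK// ge0_fin_numE ?eGamma_ge0//.
exact: eGamma_lty.
Qed.

(** The integrand is nonnegative, so integrability is finiteness of a product of positive factors,
    that is, of each Gamma integral. The criterion does not involve sigma, so convergence at one
    point of P_G settles all of them. *)
Lemma integrable_integrand (alpha beta : {set 'I_r} -> R) sigma : QG E sigma ->
  integrable_muG E Cs (integrand E Cs alpha beta (inv_completion E sigma)) <->
  forall k, 0 < rho E Cs alpha beta (cl E k) - #|Par E k|%:R / 2.
Proof.
move=> Qs; have mf := measurable_integrand alpha beta sigma.
have int := integral_integrand alpha beta Qs.
have abs : (\int[mu]_(t in D) `|(integrand E Cs alpha beta (inv_completion E
  sigma) (of_coords t)
     * muG_density E Cs (of_coords t))%:E| = \int[mu]_(t in D)
    (integrand E Cs alpha beta (inv_completion E sigma) (of_coords t) *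
      muG_density E Cs (of_coords t))%:E)%E.
  by apply: eq_integral => t /set_mem tD; rewrite gee0_abs// lee_fin
    integrand_ge0.
have c0 k : 0 < pi `^ (#|Par E k|%:R / 2) * pivot E k sigma `^ rho E Cs alpha
  beta (cl E k) :> R.
  by rewrite mulr_gt0 ?powR_gt0 ?pi_gt0// QG_pivot_gt0.
split=> [/integrableP[_]|cond].
  rewrite abs int => h k; rewrite ltNge; apply/negP => /eGamma_pinfty e.
  have f0 j : (0 < (pi `^ (#|Par E j|%:R / 2) * pivot E j sigma `^ rho E Cs
    alpha beta (cl E j))%:E
     * eGamma (rho E Cs alpha beta (cl E j) - #|Par E j|%:R / 2))%E.
    by rewrite mule_gt0 ?lte_fin ?eGamma_gt0.
  by have := prod_gt0_pinfty f0 h k; rewrite e gt0_muley ?lte_fin// ltxx.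
apply/integrableP; split => //; rewrite abs int.
rewrite prod_eGamma_fine//; exact: ltry.
Qed.

Lemma integral_muG_integrand (alpha beta : {set 'I_r} -> R) sigma : QG E sigma
  ->
  (forall k, 0 < rho E Cs alpha beta (cl E k) - #|Par E k|%:R / 2) ->
  integral_muG E Cs (integrand E Cs alpha beta (inv_completion E sigma)) =
  HG E Cs alpha beta sigma
  * \prod_(u in T E)
      (pi `^ ((\sum_(v in T E | tlt E v u) #|u|%:R * #|v|%:R) / 2)
       * Gamma_multi #|u| (rho E Cs alpha beta u
            - (\sum_(v in T E | tlt E v u) #|v|%:R / 2))).
Proof.
move=> Qs cond; rewrite /integral_muG /Rintegral integral_integrand//
  prod_eGamma_fine//.
exact: prod_vertex_class.
Qed.

End WishartIntegral.

Local Open Scope classical_set_scope.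
Local Open Scope ring_scope.

Theorem theorem3p1 (R : realType) (r : nat) (E : rel 'I_r)
    (Cs : seq {set 'I_r}) :
  reflexive E -> symmetric E -> homogeneous E -> perfect_order E Cs ->
  calA E Cs =
    [set ab : ({set 'I_r} -> R) * ({set 'I_r} -> R) |
      forall u, u \in T E ->
        rho E Cs ab.1 ab.2 u >
          (\sum_(v in T E | tle E v u) #|v|%:R - 1) / 2]
  /\
  forall (alpha beta : {set 'I_r} -> R) (sigma : 'M[R]_r),
    calA E Cs (alpha, beta) -> QG E sigma ->
    [/\ integrable_muG E Cs (integrand E Cs alpha beta (invmx (hat E sigma))),
        integral_muG E Cs (integrand E Cs alpha beta (invmx (hat E sigma))) =
          \prod_(u in T E)
            (pi `^ ((\sum_(v in T E | tlt E v u) #|u|%:R * #|v|%:R) / 2)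
             * \det (schur_block E u sigma) `^ rho E Cs alpha beta u
             * Gamma_multi #|u|
                 (rho E Cs alpha beta u
                  - \sum_(v in T E | tlt E v u) #|v|%:R / 2))
      & integral_muG E Cs (integrand E Cs alpha beta (invmx (hat E sigma))) =
          HG E Cs alpha beta sigma
          * \prod_(u in T E)
              (pi `^ ((\sum_(v in T E | tlt E v u) #|u|%:R * #|v|%:R) / 2)
               * Gamma_multi #|u|
                   (rho E Cs alpha beta u
                    - \sum_(v in T E | tlt E v u) #|v|%:R / 2))].
Proof.
move=> rE sE hE pCs.
have calAP (alpha beta : {set 'I_r} -> R) : calA E Cs (alpha, beta) <->
    forall k, 0 < rho E Cs alpha beta (cl E k) - #|Par E k|%:R / 2.
  split=> [[int _]|cond].
    (* Convergence at a single y suffices, and the identity matrix lies in P_G for every graph. *)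
    have PG1 : PG E (1%:M : 'M[R]_r).
      split; split; rewrite ?trmx1//.
        by move=> i j nij; rewrite mxE; case: eqP nij => // ->; rewrite rE.
      move=> v v0; rewrite mulmx1 mxE lt_neqAle sumr_ge0 => [|i _]; last first.
        by rewrite mxE -expr2 sqr_ge0.
      rewrite andbT eq_sym; apply: contraNneq v0 => /eqP; rewrite psumr_eq0 =>
        [/allP h|i _]; last first.
        by rewrite mxE -expr2 sqr_ge0.
      apply/eqP/colP => i; have := h i (mem_index_enum i).
      by rewrite !mxE /= mulf_eq0 orbb => /eqP.
    have [sigma Qs e] := PG_inv_completion rE sE hE PG1.
    by apply/(integrable_integrand rE sE hE pCs alpha beta Qs); rewrite -e;
      exact: int.
  split=> [y /(PG_inv_completion rE sE hE)[sigma Qs ->]|].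
    exact/(integrable_integrand rE sE hE pCs).
  (* The constant, found by unification, is the product over [T] that multiplies H_G(sigma), where
     sigma = phi y. *)
  eexists=> y /(PG_inv_completion rE sE hE)[sigma Qs ->] /=.
  rewrite (phiE rE sE hE Qs) (integral_muG_integrand rE sE hE pCs Qs cond) mulrC
    mulKf//.
  by rewrite gt_eqF// (HG_gt0 rE sE hE pCs).
split=> [|alpha beta sigma /calAP cond Qs].
  apply/seteqP; split=> -[alpha beta] /=.
    by move=> /calAP/(rho_conditionP Cs rE sE hE).
  by move=> /(rho_conditionP Cs rE sE hE)/calAP.
have int := integral_muG_integrand rE sE hE pCs Qs cond.
rewrite (inv_hat rE sE hE Qs); split => //.
  exact/(integrable_integrand rE sE hE pCs).
rewrite int (HG_schur_block rE sE hE pCs)// -big_split/=; apply: eq_bigr => u _.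
by rewrite mulrA [X in X * _ = _]mulrC.
Qed.
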